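(* Let $\mathcal M$ be an o-minimal expansion of an ordered group, with universe $M$ and language $\mathcal L$, and let $\mathcal N=\langle\mathcal M,P\rangle$ be the expansion of $\mathcal M$ by a unary predicate for a dense $\mathrm{dcl}$-independent set $P\subseteq M$. Then every group definable in $\mathcal N$ is definably isomorphic (in $\mathcal N$) to a group definable in $\mathcal M$.
   Context: $\mathrm{dcl}$ denotes definable closure in $\mathcal M$; $P$ being $\mathrm{dcl}$-independent means no $p\in P$ lies in $\mathrm{dcl}(P\setminus\{p\})$ (over the empty set). Definability is with parameters. A group definable in $\mathcal N$ is one whose universe and operation are definable in $\mathcal N$; a definable isomorphism is a group isomorphism whose graph is definable in $\mathcal N$. *)

(* Defs.v *)
From mathcomp Require Import all_boot.
Set Implicit Arguments. Unset Strict Implicit. Unset Printing Implicit Defensive.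

Inductive formula (I : Type) (ar : I -> nat) : Type :=
| FRel (i : I) (vs : (ar i).-tuple nat)
| FEq (a b : nat)
| FNot (f : formula ar)
| FAnd (f g : formula ar)
| FEx (x : nat) (f : formula ar).

Section Semantics.
Variables (M : Type) (I : Type) (ar : I -> nat)
          (rel : forall i : I, (ar i).-tuple M -> Prop).

Fixpoint sat (v : nat -> M) (f : formula ar) : Prop :=
  match f with
  | FRel i vs => rel (map_tuple v vs)
  | FEq a b => v a = v b
  | FNot g => ~ sat v g
  | FAnd g h => sat v g /\ sat v h
  | FEx x g => exists a : M, sat (fun k => if k == x then a else v k) g
  end.

Definition extend n (x : n.-tuple M) (w : nat -> M) : nat -> M :=
  fun k => nth (w k) x k.

(* X ⊆ M^n is definable with parameters: the parameters are the values of w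
   on the variables >= n *)
Definition definable n (X : n.-tuple M -> Prop) : Prop :=
  exists (f : formula ar) (w : nat -> M),
    forall x : n.-tuple M, X x <-> sat (extend x w) f.

Definition definable0 n (X : n.-tuple M -> Prop) : Prop :=
  exists f : formula ar, forall (x : n.-tuple M) (w : nat -> M),
    X x <-> sat (extend x w) f.

(* b ∈ dcl(A) : b is the unique solution of a parameter-free formula phi(y, a)
   with a a finite tuple from A (y is variable 0, a_j is variable j+1). *)
Definition in_dcl (A : M -> Prop) (b : M) : Prop :=
  exists (f : formula ar) (m : nat) (a : m.-tuple M),
    (forall j : 'I_m, A (tnth a j)) /\
    forall (y : M) (w : nat -> M), sat (extend [tuple of y :: a] w) f <-> y = b.

Definition dcl_independent (P : M -> Prop) : Prop :=
  forall p, P p -> ~ in_dcl (fun q => P q /\ q <> p) p.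

Definition is_group_on T (G : T -> Prop) (mul : T -> T -> T) : Prop :=
  exists (e : T) (inv : T -> T),
    G e /\
    (forall x y, G x -> G y -> G (mul x y)) /\
    (forall x, G x -> G (inv x)) /\
    (forall x y z, G x -> G y -> G z -> mul (mul x y) z = mul x (mul y z)) /\
    (forall x, G x -> mul e x = x /\ mul x e = x) /\
    (forall x, G x -> mul (inv x) x = e /\ mul x (inv x) = e).

Definition graph_op n (G : n.-tuple M -> Prop) (mul : n.-tuple M -> n.-tuple M -> n.-tuple M)
  : (n + (n + n)).-tuple M -> Prop :=
  fun t => exists x y : n.-tuple M,
    G x /\ G y /\ t = cat_tuple x (cat_tuple y (mul x y)).

Definition definable_group n (G : n.-tuple M -> Prop)
  (mul : n.-tuple M -> n.-tuple M -> n.-tuple M) : Prop :=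
  definable G /\ definable (graph_op G mul) /\ is_group_on G mul.

Definition graph_map n m (G : n.-tuple M -> Prop) (f : n.-tuple M -> m.-tuple M)
  : (n + m).-tuple M -> Prop :=
  fun t => exists x : n.-tuple M, G x /\ t = cat_tuple x (f x).

Definition definable_iso n m (G : n.-tuple M -> Prop) mulG
  (H : m.-tuple M -> Prop) mulH (f : n.-tuple M -> m.-tuple M) : Prop :=
  (forall x, G x -> H (f x)) /\
  (forall x y, G x -> G y -> f x = f y -> x = y) /\
  (forall z, H z -> exists x, G x /\ f x = z) /\
  (forall x y, G x -> G y -> f (mulG x y) = mulH (f x) (f y)) /\
  definable (graph_map G f).

End Semantics.

Definition ordered_group (M : Type) (lt : M -> M -> Prop) (op : M -> M -> M)
  (e : M) (inv : M -> M) : Prop :=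
  (forall x y z, op (op x y) z = op x (op y z)) /\
  (forall x, op e x = x /\ op x e = x) /\
  (forall x, op (inv x) x = e /\ op x (inv x) = e) /\
  (forall x, ~ lt x x) /\
  (forall x y z, lt x y -> lt y z -> lt x z) /\
  (forall x y, lt x y \/ x = y \/ lt y x) /\
  (forall x y z, lt x y -> lt (op z x) (op z y) /\ lt (op x z) (op y z)).

(* pieces of a finite union of points and open intervals (None = ±∞) *)
Inductive piece (M : Type) : Type :=
| PPoint (a : M)
| PInt (a b : option M).

Definition in_piece (M : Type) (lt : M -> M -> Prop) (p : piece M) (y : M) : Prop :=
  match p with
  | PPoint a => y = a
  | PInt a b => (match a with Some a => lt a y | None => True end) /\
                (match b with Some b => lt y b | None => True end)
  end.

Definition o_minimal (M : Type) (I : Type) (ar : I -> nat)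
  (rel : forall i : I, (ar i).-tuple M -> Prop) (lt : M -> M -> Prop) : Prop :=
  forall X : 1.-tuple M -> Prop, definable rel X ->
    exists ps : seq (piece M),
      forall y : M, X [tuple y] <->
        exists2 k, k < size ps & in_piece lt (nth (PPoint y) ps k) y.

Definition dense_in (M : Type) (lt : M -> M -> Prop) (P : M -> Prop) : Prop :=
  forall a b, lt a b -> exists p, P p /\ lt a p /\ lt p b.

(* the expansion <M, P>: one new unary relation symbol (None) interpreted as P *)
Definition ar_P (I : Type) (ar : I -> nat) (o : option I) : nat :=
  match o with Some i => ar i | None => 1 end.

Definition rel_P (M : Type) (I : Type) (ar : I -> nat)
  (rel : forall i : I, (ar i).-tuple M -> Prop) (P : M -> Prop)
  : forall o : option I, (ar_P ar o).-tuple M -> Prop :=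
  fun o => match o return (ar_P ar o).-tuple M -> Prop with
           | Some i => rel i
           | None => fun t => P (thead t)
           end.

(* Main.v *)
From Stdlib Require List.
Require Import Defs.
From mathcomp Require Import all_boot zify.
From mathcomp Require Import boolp classical_sets filter.
Set Implicit Arguments. Unset Strict Implicit. Unset Printing Implicit Defensive.

(** Only finitely many symbols matter, so a countably saturated ultrapower K of
    the structure <M, P> is available, and the conclusion is transferred back by
    Los's theorem. In K, the small closure cl (the union of the small L-definable
    sets over a set) is a pregeometry in which P is independent; the support of
    a set B consists of the p in P that depend on B and the rest of P. A finite
    partial map that is L-elementary, respects P and has domain and range
    containing their supports is elementary for <M, P> by back and forth.

    Let G be definable over A. For independent generic g and h (of maximal rank
    over A and P) the support of gh is the union of the supports of g and h up to
    A; as the size of the support is bounded on generics, generic elements have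
    no support outside A. Hence, by compactness, the group law agrees on generic
    pairs with an L-definable relation F. Fix independent generic test points a_p
    and translations e_i. Since G is covered by finitely many translates of its
    generic part, an element g is coded by an index i and the tuple y = g e_i,
    and g acts on almost all test points as F y (a_p) prescribes; this makes the
    set of codes and its multiplication L-definable. *)

(** * First-order definability *)

Section Language.
Variables (I : Type) (ar : I -> nat).
Local Notation fm := (formula (ar_P ar)).

(** Genericity is not definable. That a rank over A and P is below d is witnessed by finitely many
    elements of P and by formulas, so it is a union of definable sets; compactness can avoid such
    sets, but no single formula says that a point avoids them all. In the definition of the codes
    genericity is therefore replaced by counting: adding n elements to the base spoils at most n
    members of an independent sequence of tuples. What should hold at a generic test point is
    required at all but a bounded number of fixed ones, a finite disjunction over sets of indices,
    and the numbers of translations and test points are dictated by these counts. Everything has to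
    pass through Los's theorem, which is why smallness replaces finiteness and graphs replace
    functions. Cell decomposition is avoided: exchange comes from [small_swap], where the group
    operation provides intervals of a common length. The operation serves again in [codense]:
    products of many elements of P are dense and do not depend on few elements of P. *)

Record Str := MkStr {
  car :> eqType;
  rl : forall o : option I, (ar_P ar o).-tuple car -> Prop }.

Definition holds (s : Str) (v : nat -> s) (f : fm) : Prop := sat (@rl s) v f.

Fixpoint isL (f : fm) : bool :=
  match f with
  | FRel o _ => isSome o
  | FEq _ _ => true
  | FNot g => isL g
  | FAnd g h => isL g && isL h
  | FEx _ g => isL g
  end.

Fixpoint vmax (f : fm) : nat :=
  match f with
  | FRel _ vs => foldr maxn 0 (map S vs)
  | FEq a b => maxn a.+1 b.+1
  | FNot g => vmax g
  | FAnd g h => maxn (vmax g) (vmax h)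
  | FEx x g => maxn x.+1 (vmax g)
  end.

Lemma mem_foldr_max (l : seq nat) k : k \in l -> k < foldr maxn 0 (map S l).
Proof.
elim: l => //= a l IH; rewrite inE leq_max => /orP[/eqP->|/IH->].
  by rewrite leqnn.
by rewrite orbT.
Qed.

Lemma holds_ext (s : Str) (f : fm) (v v' : nat -> s) :
  (forall k, k < vmax f -> v k = v' k) -> holds v f <-> holds v' f.
Proof.
rewrite /holds; elim: f v v' => [o vs|a b|g IH|g IHg h IHh|x g IH] v v' H /=.
- suff -> : map_tuple v vs = map_tuple v' vs by [].
  by apply: val_inj => /=; apply/eq_in_map => k /mem_foldr_max; apply: H.
- by rewrite !H //= leq_max leqnn ?orbT.
- by have := IH _ _ H; tauto.
- have Hg : sat (@rl s) v g <-> sat (@rl s) v' g.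
    by apply: IHg => k kg; apply: H => /=; rewrite leq_max kg.
  have Hh : sat (@rl s) v h <-> sat (@rl s) v' h.
    by apply: IHh => k kh; apply: H => /=; rewrite leq_max kh orbT.
  by tauto.
- have E a : sat (@rl s) (fun k => if k == x then a else v k) g <->
             sat (@rl s) (fun k => if k == x then a else v' k) g.
    apply: IH => k kg; case: eqP => // _; apply: H => /=.
    by rewrite leq_max kg orbT.
  by split=> -[a /E]; exists a.
Qed.

(** Bound variables are named, so a quantifier is moved past the images of all variables below
    [vmax g]. Only these influence the truth value, hence no capture occurs, whether or not [r] is
    injective. *)
Fixpoint ren (r : nat -> nat) (f : fm) : fm :=
  match f with
  | FRel o vs => FRel (map_tuple r vs)
  | FEq a b => FEq _ (r a) (r b)
  | FNot g => FNot (ren r g)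
  | FAnd g h => FAnd (ren r g) (ren r h)
  | FEx x g => let z := (\max_(k < vmax g) r k).+1 in
               FEx z (ren (fun k => if k == x then z else r k) g)
  end.

Lemma isL_ren r f : isL (ren r f) = isL f.
Proof.
by elim: f r => [o vs|a b|g IH|g IHg h IHh|x g IH] r //=; rewrite ?IHg ?IHh ?IH.
Qed.

Lemma holds_ren (s : Str) r f (v : nat -> s) :
  holds v (ren r f) <-> holds (fun k => v (r k)) f.
Proof.
rewrite /holds.
elim: f r v => [o vs|a b|g IH|g IHg h IHh|x g IH] r v //=.
- suff -> : map_tuple v (map_tuple r vs) = map_tuple (fun k => v (r k)) vs by [].
  by apply: val_inj => /=; rewrite -map_comp.
- by rewrite IH.
- by rewrite IHg IHh.
- set z := _.+1.
  have E a : sat (@rl s) (fun k => if k == z then a else v k)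
                (ren (fun k => if k == x then z else r k) g) <->
             sat (@rl s) (fun k => if k == x then a else v (r k)) g.
    rewrite IH; apply: holds_ext => k kg; case: (k == x); first by rewrite eqxx.
    case: eqP => // rz; have := leq_bigmax (Ordinal kg) (F := fun i => r (val i)).
    by rewrite /= rz /z ltnn.
  by split=> -[a /E]; exists a.
Qed.

Definition scons (T : Type) (a : T) (v : nat -> T) (k : nat) : T :=
  if k is k'.+1 then v k' else a.

(* The flag b forbids the symbol of P. A predicate is given on all structures
   at once, so that it can be transferred to and from an ultrapower. *)
Definition FO (b : bool) (Q : forall s : Str, (nat -> s) -> Prop) : Prop :=
  exists2 f, b ==> isL f & forall s v, Q s v <-> holds v f.

Lemma FO_ext b (Q Q' : forall s : Str, (nat -> s) -> Prop) :
  (forall s v, Q s v <-> Q' s v) -> FO b Q -> FO b Q'.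
Proof. by move=> E [f Lf H]; exists f => // s v; rewrite -E. Qed.

Lemma FO_weak b Q : FO b Q -> FO false Q.
Proof. by case=> f _ H; exists f. Qed.

Lemma FO_rename b (Q : forall s : Str, (nat -> s) -> Prop) (r : nat -> nat) :
  FO b Q -> FO b (fun s u => Q s (fun k => u (r k))).
Proof.
case=> f Lf H; exists (ren r f); first by rewrite isL_ren.
by move=> s v; rewrite holds_ren H.
Qed.

Lemma FO_subst b (Q : forall s : Str, (nat -> s) -> Prop) (r : nat -> nat)
  (V : forall s : Str, (nat -> s) -> nat -> s) :
  (forall s u k, V s u k = u (r k)) -> FO b Q -> FO b (fun s u => Q s (V s u)).
Proof.
move=> E /(FO_rename r); apply: FO_ext => s v.
by suff -> : (fun k => v (r k)) = V s v by []; apply/funext => k; rewrite E.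
Qed.

Lemma FO_holds b f (r : nat -> nat) (V : forall s : Str, (nat -> s) -> nat -> s) :
  (forall s u k, V s u k = u (r k)) -> b ==> isL f ->
  FO b (fun s u => holds (V s u) f).
Proof. by move=> E Lf; apply: (@FO_subst b (fun s v => holds v f) r V E); exists f. Qed.

Lemma FO_eq b i j : FO b (fun s v => v i = v j).
Proof. by exists (FEq _ i j); rewrite ?implybT. Qed.

Lemma FO_not b (Q : forall s : Str, (nat -> s) -> Prop) :
  FO b Q -> FO b (fun s v => ~ Q s v).
Proof. by case=> f Lf H; exists (FNot f) => // s v; rewrite H. Qed.

Lemma FO_and b (Q Q' : forall s : Str, (nat -> s) -> Prop) :
  FO b Q -> FO b Q' -> FO b (fun s v => Q s v /\ Q' s v).
Proof.
case=> f Lf H [f' Lf' H']; exists (FAnd f f') => [/=|s v].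
  by case: b Lf Lf' => //= -> ->.
by rewrite H H'.
Qed.

Lemma FO_imp b (Q Q' : forall s : Str, (nat -> s) -> Prop) :
  FO b Q -> FO b Q' -> FO b (fun s v => Q s v -> Q' s v).
Proof.
move=> HQ HQ'; apply: FO_ext (FO_not (FO_and HQ (FO_not HQ'))) => s v.
split=> [H q|H [q]]; last by apply; apply: H.
by apply: contrapT => nq; apply: H.
Qed.

Lemma FO_iff b (Q Q' : forall s : Str, (nat -> s) -> Prop) :
  FO b Q -> FO b Q' -> FO b (fun s v => Q s v <-> Q' s v).
Proof. by move=> HQ HQ'; apply: FO_and; apply: FO_imp. Qed.

Lemma FO_True b : FO b (fun s v => True).
Proof. by apply: FO_ext (FO_eq b 0 0) => s v. Qed.

Lemma FO_cst b (p : Prop) : FO b (fun s v => p).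
Proof.
case: (pselect p) => H; first by apply: FO_ext (FO_True b).
by apply: FO_ext (FO_not (FO_True b)) => s v; split=> // /(_ Logic.I).
Qed.

(** Predicates follow the de Bruijn convention: the quantified value sits at 0 and the old valuation
    is shifted. The formula keeps named variables, and [vmax f] is the fresh name that takes over
    position 0. *)
Lemma FO_ex b (B : forall s : Str, (nat -> s) -> s -> Prop) :
  FO b (fun s u => B s (fun k => u k.+1) (u 0)) ->
  FO b (fun s v => exists a, B s v a).
Proof.
case=> f Lf H; pose x := vmax f.
exists (FEx x (ren (fun k => if k is k'.+1 then k' else x) f)) => [|s v].
  by rewrite /= isL_ren.
have E a : B s v a <-> holds (fun k => if k == x then a else v k)
                 (ren (fun k => if k is k'.+1 then k' else x) f).
  rewrite holds_ren (H s (scons a v)); apply: holds_ext => -[|k] kf.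
    by rewrite eqxx.
  by rewrite /= ltn_eqF // ltnW.
by split=> -[a /E]; exists a.
Qed.

Lemma FO_all b (B : forall s : Str, (nat -> s) -> s -> Prop) :
  FO b (fun s u => B s (fun k => u k.+1) (u 0)) ->
  FO b (fun s v => forall a, B s v a).
Proof.
move=> H; apply: FO_ext
  (FO_not (@FO_ex b (fun s v a => ~ B s v a) (FO_not H))) => s v.
split=> [nH a|H' [a]]; last by apply.
by apply: contrapT => nB; apply: nH; exists a.
Qed.

Lemma FO_all_seq b (T : eqType) (l : seq T)
  (Q : T -> forall s : Str, (nat -> s) -> Prop) :
  (forall t, FO b (Q t)) -> FO b (fun s v => forall t, t \in l -> Q t s v).
Proof.
move=> H; elim: l => [|x l IH]; first by apply: FO_ext (FO_True b) => s v.
apply: FO_ext (FO_and (H x) IH) => s v.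
split=> [[Hx Hl] t|Hl]; first by rewrite inE => /orP[/eqP->|/Hl].
by split=> [|t tl]; apply: Hl; rewrite inE ?eqxx ?tl ?orbT.
Qed.

Lemma FO_all_fin b (T : finType) (Q : T -> forall s : Str, (nat -> s) -> Prop) :
  (forall t, FO b (Q t)) -> FO b (fun s v => forall t, Q t s v).
Proof.
move=> H; apply: FO_ext (FO_all_seq (enum T) H) => s v.
by split=> HQ t => [|_]; apply: HQ; rewrite ?mem_enum.
Qed.

Definition tk (s : Type) m (u : nat -> s) : m.-tuple s := [tuple u i | i < m].

Lemma tnth_tk (s : Type) m (u : nat -> s) i : tnth (tk m u) i = u i.
Proof. by rewrite tnth_mktuple. Qed.

Lemma FO_exT b m (B : forall s : Str, (nat -> s) -> m.-tuple s -> Prop) :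
  FO b (fun s u => B s (fun k => u (m + k)) (tk m u)) ->
  FO b (fun s v => exists x, B s v x).
Proof.
elim: m B => [|m IH] B H.
  apply: FO_ext H => s v; rewrite [tk 0 v]tuple0; split=> [|[x]].
    by exists [tuple].
  by rewrite tuple0.
pose B1 := fun (s : Str) (v : nat -> s) (a : s) =>
             exists x : m.-tuple s, B s v [tuple of a :: x].
have /FO_ex : FO b (fun s u => B1 s (fun k => u k.+1) (u 0)).
  rewrite /B1.
  apply: (IH (fun s u x => B s (fun k => u k.+1) [tuple of u 0 :: x])).
  (* The induction binds the head of the tuple outside the other m coordinates, so it is found at
     position m; [r] brings it back to the front. *)
  pose r k := if k is j.+1 then (if j < m then j else j.+1) else m.
  apply: FO_ext (FO_rename r H) => s v.
  have -> : (fun k => v (r (m.+1 + k))) = (fun k => v (m + k.+1)).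
    by apply/funext => k; rewrite addSn /r ltnNge leq_addr /= addnS.
  have -> // : tk m.+1 (fun k => v (r k)) = [tuple of v (m + 0) :: tk m v].
  apply: eq_from_tnth => i; rewrite tnth_tk.
  case: (unliftP ord0 i) => [j|] ->; rewrite /r.
    by rewrite tnthS tnth_tk lift0 /= ltn_ord.
  by rewrite tnth0 addn0.
apply: FO_ext => s v; rewrite /B1; split=> [[a [x]]|[x]]; first by exists [tuple of a :: x].
by rewrite {1}(tuple_eta x) => Hx; exists (thead x), (behead_tuple x).
Qed.

Lemma FO_allT b m (B : forall s : Str, (nat -> s) -> m.-tuple s -> Prop) :
  FO b (fun s u => B s (fun k => u (m + k)) (tk m u)) ->
  FO b (fun s v => forall x, B s v x).
Proof.
move=> H; apply: FO_ext
  (FO_not (@FO_exT b m (fun s v x => ~ B s v x) (FO_not H))) => s v.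
split=> [nH a|H' [a]]; last by apply.
by apply: contrapT => nB; apply: nH; exists a.
Qed.

Definition sP (s : Str) (x : s) : Prop := @rl s None [tuple x].

Lemma FO_P i : FO false (fun s v => sP (v i)).
Proof.
exists (@FRel _ (ar_P ar) None [tuple i]) => // s v; rewrite /sP /holds /=.
by suff -> : [tuple v i] = map_tuple v [tuple i] by []; apply: val_inj.
Qed.

Variable ltf : fm.
Hypothesis Lltf : isL ltf.

Definition slt (s : Str) (x y : s) : Prop := holds (scons x (fun=> y)) ltf.

Lemma FO_lt b i j : FO b (fun s v => slt (v i) (v j)).
Proof.
apply: (@FO_holds b ltf (fun k => if k is 0 then i else j)); last first.
  by rewrite Lltf implybT.
by move=> s u [].
Qed.

(* For definable sets in o-minimal structures this means finite; unlike
   finiteness, it is a first-order condition. *)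
Definition small (s : Str) (X : s -> Prop) : Prop :=
  ~ exists a b, slt a b /\ forall x, slt a x -> slt x b -> X x.

Lemma FO_small b (B : forall s : Str, (nat -> s) -> s -> Prop) :
  FO b (fun s u => B s (fun k => u k.+1) (u 0)) ->
  FO b (fun s v => small (B s v)).
Proof.
move=> H; apply: FO_not; apply: FO_ex; apply: FO_ex; apply: FO_and; first exact: FO_lt.
apply: FO_all; apply: FO_imp; first exact: (FO_lt b 2 0).
apply: FO_imp; first exact: (FO_lt b 0 1).
by apply: (@FO_subst b _ (fun k => if k is j.+1 then j.+3 else 0)
  (fun s u => fun k => if k is j.+1 then u j.+3 else u 0) _ H) => s u [].
Qed.

End Language.

(** * Small sets in o-minimal structures *)

Section Operation.
Variables (I : Type) (ar : I -> nat) (opf : formula (ar_P ar)).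
Hypothesis Lopf : isL opf.

Definition sop (s : Str ar) (x y z : s) : Prop :=
  holds (scons x (scons y (fun=> z))) opf.

Lemma FO_op b i j k : FO b (fun s v => sop (v i) (v j) (v k)).
Proof.
apply: (@FO_holds _ ar b opf (fun l => if l is l'.+1 then if l' is 0 then j else k else i)).
  by move=> s u [|[|l]].
by rewrite Lopf implybT.
Qed.

End Operation.

Section Ominimal.
Variables (I : Type) (ar : I -> nat) (ltf opf : formula (ar_P ar)).
Hypotheses (Lltf : isL ltf) (Lopf : isL opf).
Variable s : Str ar.
Local Notation lt := (@slt _ ar ltf s).
Local Notation le x y := (~ slt ltf y x).
Local Notation small X := (small ltf X).

Definition defL (X : s -> Prop) : Prop :=
  exists2 f, isL f & exists v, forall y, X y <-> holds (scons y v) f.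

Lemma defL_FO (Q : forall t : Str ar, (nat -> t) -> Prop) (X : s -> Prop) v :
  FO true Q -> (forall y, X y <-> Q s (scons y v)) -> defL X.
Proof. by case=> f Lf H E; exists f => //; exists v => y; rewrite E H. Qed.

Fixpoint inps (ps : seq (piece s)) (y : s) : Prop :=
  if ps is p :: ps' then in_piece lt p y \/ inps ps' y else False.

Variables (o : s -> s -> s) (e : s) (i : s -> s).
Hypothesis opE : forall x y z, sop opf x y z <-> o x y = z.
Hypothesis oA : forall x y z, o (o x y) z = o x (o y z).
Hypothesis oe : forall x, o e x = x.
Hypothesis eo : forall x, o x e = x.
Hypothesis io : forall x, o (i x) x = e.
Hypothesis oi : forall x, o x (i x) = e.
Hypothesis ltxx : forall x, ~ lt x x.
Hypothesis lt_trans : forall x y z, lt x y -> lt y z -> lt x z.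
Hypothesis lt_tot : forall x y, lt x y \/ x = y \/ lt y x.
Hypothesis o_ltl : forall x y z, lt x y -> lt (o z x) (o z y).
Hypothesis o_ltr : forall x y z, lt x y -> lt (o x z) (o y z).
Hypothesis dense : forall x y, lt x y -> exists z, lt x z /\ lt z y.
Variable one : s.
Hypothesis one_gt0 : lt e one.
Hypothesis omin : forall X, defL X -> exists ps, forall y, X y <-> inps ps y.

Lemma gt_ex x : exists y, lt x y.
Proof. by exists (o x one); have := @o_ltl e one x one_gt0; rewrite eo. Qed.

Lemma lt_ex x : exists y, lt y x.
Proof.
exists (o x (i one)).
have := o_ltl (o x (i one)) one_gt0; rewrite eo oA io eo; exact.
Qed.

Lemma le_lt_trans x y z : le x y -> lt y z -> lt x z.
Proof. by move=> xy yz; case: (lt_tot x y) => [/lt_trans|[->|/xy]] //; apply. Qed.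

Lemma lt_le_trans x y z : lt x y -> le y z -> lt x z.
Proof. by move=> xy yz; case: (lt_tot y z) => [|[<-|/yz]] //; apply: lt_trans. Qed.

Lemma ltW x y : lt x y -> le x y.
Proof. by move=> xy /(lt_trans xy)/ltxx. Qed.

Lemma lt_min_ex u v w : lt u v -> lt u w -> exists z, [/\ lt u z, le z v & le z w].
Proof.
move=> uv uw; case: (lt_tot v w) => [vw|[<-|wv]].
- by exists v; split=> //; apply: ltW.
- by exists v; split.
- by exists w; split=> //; apply: ltW.
Qed.

Lemma gap_above (l : seq s) u : exists2 v, lt u v & forall x, x \in l -> lt u x -> le v x.
Proof.
elim: l => [|y l [v uv IH]]; first by have [v uv] := gt_ex u; exists v.
case: (pselect (lt u y)) => uy.
  have [z [uz zv zy]] := lt_min_ex uv uy; exists z => // x.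
  rewrite inE => /orP[/eqP->//|xl] ux /lt_le_trans-/(_ _ zv)//.
  by apply: IH.
by exists v => // x; rewrite inE => /orP[/eqP->//|]; apply: IH.
Qed.

Lemma fin_small (X : s -> Prop) (l : seq s) : (forall x, X x -> x \in l) -> small X.
Proof.
move=> H [a [b [ab Hab]]]; have [v av Hv] := gap_above l a.
have [z [az zv zb]] := lt_min_ex av ab.
have [y [ay yz]] := dense az.
have yb : lt y b by exact: lt_le_trans yz zb.
apply: (Hv y (H _ (Hab _ ay yb)) ay).
exact: lt_le_trans yz zv.
Qed.

Lemma small1 (x : s) : small (fun y => y = x).
Proof. by apply: (@fin_small _ [:: x]) => y ->; rewrite inE. Qed.

Lemma small_sub (X Y : s -> Prop) : (forall x, X x -> Y x) -> small Y -> small X.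
Proof. by move=> H nY [a [b [ab Hab]]]; apply: nY; exists a, b; split=> // x ax /(Hab x ax)/H. Qed.

(** A nonempty interval piece contains an interval to the right of each of its points, which
    smallness forbids; only the point pieces can contribute. *)
Lemma small_fin (X : s -> Prop) : defL X -> small X ->
  exists l : seq s, forall x, X x -> x \in l.
Proof.
move=> /omin[ps]; elim: ps X => [|p ps IH] X HX sX; first by exists [::] => x /HX.
have [|l Hl] := IH (inps ps) (fun=> conj id id).
  by apply: small_sub sX => x Hx; apply/HX; right.
case: p HX => [a|a b] HX.
  by exists (a :: l) => x /HX[/= ->|/Hl]; rewrite inE ?eqxx // => ->; rewrite orbT.
exists l => x /HX[[ax xb]|/Hl//]; case: sX.
have [c xc cb] : exists2 c, lt x c & forall y, lt y c -> if b is Some b' then lt y b' else True.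
  case: b xb {HX} => [b|] xb; first by exists b.
  by have [c] := gt_ex x; exists c.
exists x, c; split=> // y xy yc; apply/HX; left; split; last exact: cb.
by case: (a) ax => // a' ax; apply: lt_trans xy.
Qed.

Lemma fin_min (X : s -> Prop) (l : seq s) x0 : (forall x, X x -> x \in l) -> X x0 ->
  exists2 m, X m & forall x, X x -> le m x.
Proof.
elim: l X x0 => [|a l IH] X x0 H Xx0; first by have := H _ Xx0.
case: (pselect (exists x, X x /\ lt x a)) => [[x [Xx xa]]|Ha].
  have [|m [Xm ma] Hm] := IH (fun x => X x /\ lt x a) x _ (conj Xx xa).
    by move=> y [/H]; rewrite inE => /orP[/eqP->/ltxx|].
  exists m => // y Xy ym; apply: (Hm y _ ym); split=> //; exact: lt_trans ma.
case: (pselect (X a)) => Xa.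
  by exists a => // x Xx xa; apply: Ha; exists x.
apply: (IH X x0) => // x Xx; have := H _ Xx; rewrite inE => /orP[/eqP xa|//].
by rewrite xa in Xx.
Qed.

(** The infimum is found piece by piece, the smaller of two being kept. A nonempty piece unbounded
    to the left would contain a point below t. *)
Lemma inps_inf ps t : (exists x, inps ps x) -> (forall x, inps ps x -> le t x) ->
  exists2 m, forall x, inps ps x -> le m x & forall y, lt m y -> exists2 x, inps ps x & lt x y.
Proof.
elim: ps => [|p ps IH] [x Hx] Ht; first by case: Hx.
have Tps z : inps ps z -> le t z by move=> Hz; apply: Ht; right.
have step (m1 : s) : (forall x, in_piece lt p x -> le m1 x) ->
    (forall y, lt m1 y -> exists2 x, in_piece lt p x & lt x y) ->
  exists2 m, forall x, inps (p :: ps) x -> le m x &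
    forall y, lt m y -> exists2 x, inps (p :: ps) x & lt x y.
  move=> H1 H2; case: (pselect (exists z, inps ps z)) => [/IH/(_ Tps)[m Hm1 Hm2]|nps]; last first.
    exists m1 => [z [/H1//|z_in]|y /H2[z z_in zy]]; last by exists z => //; left.
    by case: nps; exists z.
  case: (lt_tot m m1) => [mm1|[mm1|m1m]].
  - exists m => [z [/H1 zm1|/Hm1//]|y /Hm2[z z_in zy]]; last by exists z => //; right.
    by move=> zm; apply: zm1; apply: lt_trans zm mm1.
  - rewrite -mm1 in H1 H2.
    exists m => [z [/H1 zm1|/Hm1//]|y /Hm2[z z_in zy]] //; by exists z => //; right.
  - exists m1 => [z [/H1//|/Hm1 zm]|y /H2[z z_in zy]]; last by exists z => //; left.
    by move=> zm1; apply: zm; apply: lt_trans zm1 m1m.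
case: (pselect (exists z, in_piece lt p z)) => [[z Hz]|np]; last first.
  have [|m Hm1 Hm2] := IH _ Tps; first by exists x; case: Hx => // Hx; case: np; exists x.
  exists m => [z [z_in|/Hm1//]|y /Hm2[z z_in zy]]; first by case: np; exists z.
  by exists z => //; right.
case: p Hx Ht step Hz => [a|a b] Hx Ht step Hz.
  apply: (step a) => [y -> |y ay]; first exact: ltxx.
  by exists a.
case: a Hx Ht step Hz => [a|] Hx Ht step [az zb].
  apply: (step a) => [y [ay _]|y ay]; first exact: ltW.
  have [w [aw wz wy]] := lt_min_ex az ay.
  have [v [av vw]] := dense aw; exists v; last exact: lt_le_trans vw wy.
  split=> //; case: (b) zb => // b' zb; apply: lt_trans zb.
  exact: lt_le_trans vw wz.
have [w wt] := lt_ex t.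
have [v [vw vz]] : exists v, lt v t /\ lt v z.
  case: (lt_tot w z) => [wz|[wz|zw]]; first by exists w.
    by have [v vw] := lt_ex w; exists v; rewrite -wz; split=> //; apply: lt_trans wt.
  have [v vz] := lt_ex z; exists v; split=> //; apply: lt_trans vz _.
  exact: lt_trans zw wt.
case: (Ht v) => //; left; split=> //.
by case: (b) zb => // b' zb; apply: lt_trans zb.
Qed.

Lemma def_inf (X : s -> Prop) t : defL X -> (exists x, X x) -> (forall x, X x -> le t x) ->
  exists2 m, forall x, X x -> le m x & forall y, lt m y -> exists2 x, X x & lt x y.
Proof.
move=> /omin[ps HX] [x /HX Hx] Ht.
have [||m H1 H2] := @inps_inf ps t; first by exists x.
  by move=> y /HX/Ht.
by exists m => [y /HX/H1//|y /H2[z /HX]]; exists z.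
Qed.

Lemma small_bigcup (Y : s -> Prop) (X : s -> s -> Prop) :
  defL Y -> (forall c, defL (X c)) -> small Y -> (forall c, Y c -> small (X c)) ->
  small (fun y => exists c, Y c /\ X c y).
Proof.
move=> dY dX /(small_fin dY)[l Hl] sX.
suff [l' Hl'] : exists l' : seq s, forall c y, c \in l -> Y c -> X c y -> y \in l'.
  by apply: (@fin_small _ l') => y [c [Yc Xcy]]; apply: (Hl' c) => //; apply: Hl.
elim: l {Hl} => [|c l [l' Hl']]; first by exists [::].
case: (pselect (Y c)) => [Yc|nY].
  have [l1 Hl1] := small_fin (dX c) (sX c Yc).
  exists (l1 ++ l') => d y; rewrite mem_cat inE => /orP[/eqP-> _ /Hl1->//|dl Yd Xd].
  by rewrite (Hl' d) ?orbT.
exists l' => d y; rewrite inE => /orP[/eqP->/nY//|dl Yd Xd].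
exact: (Hl' d).
Qed.

(* Otherwise the points of (u, w) that enter the family strictly later than
   all points of (u, w) on their left accumulate at u, hence fill an interval,
   and the family cannot stay finite there. *)
Lemma nested_not_small (E : forall t : Str ar, (nat -> t) -> Prop) (v : nat -> s) u w :
  FO true E -> lt u w ->
  (forall t t', (forall x, E s (scons t (scons x v)) -> E s (scons t' (scons x v))) \/
                (forall x, E s (scons t' (scons x v)) -> E s (scons t (scons x v)))) ->
  (forall x, lt u x -> lt x w -> exists t, E s (scons t (scons x v))) ->
  exists t, ~ small (fun x => E s (scons t (scons x v))).
Proof.
move=> FE uw nest cover; apply: contrapT => /forallNP nsm.
have sm t : small (fun x => E s (scons t (scons x v))) by apply: contrapT; apply: nsm.
have fin t : exists l : seq s, forall x, E s (scons t (scons x v)) -> x \in l.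
  apply: small_fin => //.
  apply: (@defL_FO (fun _ u => E _ (scons (u 1) (scons (u 0) (fun k => u k.+2)))) _ (scons t v)) => //.
  by apply: (@FO_subst _ _ _ _ (fun k => if k is k'.+1 then if k' is k''.+1 then k''.+2 else 0 else 1)) FE
     => t' u' [|[|k]].
pose Rec := fun x => [/\ lt u x, lt x w & forall y, lt u y -> lt y x ->
   exists t, E s (scons t (scons x v)) /\ ~ E s (scons t (scons y v))].
have dRec : defL Rec.
  apply: (@defL_FO (fun t z => (slt ltf (z 1) (z 0) /\ slt ltf (z 0) (z 2)) /\
     forall y, slt ltf (z 1) y -> slt ltf y (z 0) -> exists a : t,
       E t (scons a (scons (z 0) (fun k => z k.+3))) /\
       ~ E t (scons a (scons y (fun k => z k.+3)))) _ (scons u (scons w v))); last first.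
    by move=> y; split=> [[]|[[]]] //.
  apply: FO_and; first by apply: FO_and; apply: FO_lt.
  apply: FO_all; apply: FO_imp; first exact: (FO_lt Lltf _ 2 0).
  apply: FO_imp; first exact: (FO_lt Lltf _ 0 1).
  apply: FO_ex; apply: FO_and; last apply: FO_not.
    by apply: (@FO_subst _ _ _ _ (fun k => if k is k'.+1 then if k' is k''.+1 then k''.+1.+4 else 2 else 0)) FE
     => t' u' [|[|k]].
  by apply: (@FO_subst _ _ _ _ (fun k => if k is k'.+1 then if k' is k''.+1 then k''.+1.+4 else 1 else 0)) FE
     => t' u' [|[|k]].
(* Consider the points of (u, z') that lie in every set of the family containing y. They are
   finitely many, and the least one, m, is in [Rec]: a point x < m is not among them, so some set
   contains y, hence m, but not x. *)
have accum z : lt u z -> exists2 x, Rec x & lt x z.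
  move=> uz; have [z' [uz' z'z z'w]] := lt_min_ex uz uw.
  have [y [uy yz']] := dense uz'.
  have yz := lt_le_trans yz' z'z; have yw := lt_le_trans yz' z'w.
  have [t Ety] := cover _ uy yw; have [l Hl] := fin t.
  pose Q x := [/\ lt u x, lt x z', lt x w & forall t, E s (scons t (scons y v)) -> E s (scons t (scons x v))].
  have [||m [um mz mw Hm] mmin] := @fin_min Q l y.
  - by move=> x [_ _ _ /(_ _ Ety)/Hl].
  - by split.
  exists m; last exact: lt_le_trans mz z'z.
  split=> // x ux xm; apply: contrapT => /forallNP nt.
  apply: (mmin x _ xm); split=> //; [exact: lt_trans mz|exact: lt_trans mw|].
  by move=> t' /Hm Em; apply: contrapT => nE; apply: (nt t').
have nsRec : ~ small Rec.
  move=> /(small_fin dRec)[l Hl]; have [z uz Hz] := gap_above l u.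
  have [x Rx xz] := accum _ uz; apply: (Hz x) => //; first exact: Hl.
  by case: Rx.
case: nsRec => -[a [b [ab Hab]]].
have [x1 [ax1 x1b]] := dense ab.
have [ux1 x1w _] := Hab _ ax1 x1b.
(* A set that contains x1 contains all of (x1, b): each x there lies in a set omitting x1, and
   nestedness puts that set inside the given one. *)
have [t Et] := cover _ ux1 x1w; apply: (sm t); exists x1, b; split=> // x x1x xb.
have [ux xw /(_ x1 ux1 x1x)[t' [E1 E2]]] := Hab _ (lt_trans ax1 x1x) xb.
by case: (nest t t') => [/(_ _ Et)|] //; apply.
Qed.

(** The geometric content of exchange: if all fibres in one direction are finite, then only finitely
    many fibres in the other direction are infinite. Otherwise, over some interval of y, the fibres
    contain intervals of one common length, and the least left endpoint of such an interval is a
    definable function of y that can be neither almost constant nor spread over an interval. *)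
Lemma small_swap f (v : nat -> s) : isL f ->
  (forall x, small (fun y => holds (scons x (scons y v)) f)) ->
  small (fun y => ~ small (fun x => holds (scons x (scons y v)) f)).
Proof.
move=> Lf; pose R x y := holds (scons x (scons y v)) f => sR.
pose FR (t : Str ar) (x y : t) (v : nat -> t) := holds (scons x (scons y v)) f.
move=> [c0 [c1 [c01 Hc]]].
(* The set of b whose fibre contains an interval to the right of t grows as t decreases, so one
   bound t0 serves for an interval of b. *)
have [t0 /contrapT[d0 [d1 [d01 Hd]]]] :
  exists t0, ~ small (fun b => exists l u, [/\ lt t0 l, lt l u & forall x, lt l x -> lt x u -> R x b]).
  apply: (@nested_not_small (fun t z => exists l u, [/\ slt ltf (z 0) l, slt ltf l u &
       forall x, slt ltf l x -> slt ltf x u -> FR t x (z 1) (fun k => z k.+2)]) v c0 c1) => //.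
  - apply: (@FO_ext _ _ true (fun t z => exists l u, slt ltf (z 0) l /\ (slt ltf l u /\
       forall x, slt ltf l x -> slt ltf x u -> FR t x (z 1) (fun k => z k.+2)))).
      by move=> t z; split=> -[l [u]] => [[? [? ?]]|[]]; exists l, u.
    apply: FO_ex; apply: FO_ex; apply: FO_and; first exact: (FO_lt Lltf _ 2 1).
    apply: FO_and; first exact: (FO_lt Lltf _ 1 0).
    apply: FO_all; apply: FO_imp; first exact: (FO_lt Lltf _ 2 0).
    apply: FO_imp; first exact: (FO_lt Lltf _ 0 1).
    by apply: (@FO_holds _ _ _ _ (fun k => if k is k'.+1 then if k' is k''.+1 then k''.+1.+4 else 4 else 0))
      => // t u [|[|k]].
  - move=> t t'; have [tt'|t't] : le t t' \/ le t' t.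
      by case: (lt_tot t t') => [/ltW|[->|/ltW]]; [left|left; apply: ltxx|right].
      by right=> x [l [u [tl lu H]]]; exists l, u; split=> //; apply: le_lt_trans tl.
    by left=> x [l [u [tl lu H]]]; exists l, u; split=> //; apply: le_lt_trans tl.
  - move=> b c0b bc1; have /contrapT[l [u [lu H]]] := Hc _ c0b bc1.
    by have [t tl] := lt_ex l; exists t, l, u.
(* Containing an interval of length [dl] becomes weaker as [dl] decreases, so one positive length
   serves for an interval of b. *)
have [dl /contrapT[h0 [h1 [h01 Hh]]]] :
  exists dl, ~ small (fun b => lt e dl /\ exists l, lt t0 l /\ forall x, lt l x -> lt x (o l dl) -> R x b).
  have -> : (fun dl => ~ small (fun b => lt e dl /\
      exists l, lt t0 l /\ forall x, lt l x -> lt x (o l dl) -> R x b)) =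
    (fun dl => ~ small (fun b => lt e dl /\
      exists l, lt t0 l /\ forall x, lt l x -> (exists z, sop opf l dl z /\ lt x z) -> R x b)).
    apply/funext => dl; congr (~ small _); apply/funext => b; apply/propext.
    split=> -[edl [l [tl H]]]; split=> //; exists l; split=> // x lx.
      by move=> [z [/opE<-]]; apply: H.
    by move=> xl; apply: H => //; exists (o l dl); split=> //; apply/opE.
  apply: (@nested_not_small (fun t z => slt ltf (z 2) (z 0) /\ exists l, slt ltf (z 3) l /\
    forall x, slt ltf l x -> (exists w, sop opf l (z 0) w /\ slt ltf x w) ->
    FR t x (z 1) (fun k => z k.+4)) (scons e (scons t0 v)) d0 d1) => //.
  - apply: FO_and; first exact: (FO_lt Lltf _ 2 0).
    apply: FO_ex; apply: FO_and; first exact: (FO_lt Lltf _ 4 0).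
    apply: FO_all; apply: FO_imp; first exact: (FO_lt Lltf _ 1 0).
    apply: FO_imp.
      apply: FO_ex; apply: FO_and; first exact: (FO_op Lopf _ 2 3 0).
      exact: (FO_lt Lltf _ 1 0).
    by apply: (@FO_holds _ _ _ _ (fun k => if k is k'.+1 then if k' is k''.+1 then k''.+2.+4 else 3 else 0))
      => // t u [|[|k]].
  - have mono t t' x : le t t' -> lt e t ->
      (lt e t' /\ exists l, lt t0 l /\
       forall y, lt l y -> (exists w, sop opf l t' w /\ lt y w) -> R y x) ->
      (lt e t /\ exists l, lt t0 l /\
       forall y, lt l y -> (exists w, sop opf l t w /\ lt y w) -> R y x).
      move=> tt' et [et' [l [tl H]]]; split=> //; exists l; split=> // y ly [w [/opE<- yw]].
      apply: H => //; exists (o l t'); split; first exact/opE.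
      case: (lt_tot t t') => [/(@o_ltl _ _ l)|[<-//|/tt'//]].
      exact: lt_trans.
    move=> t t'; case: (pselect (lt e t)) => [et|nt]; last by left=> x [/nt].
    case: (pselect (lt e t')) => [et'|nt]; last by right=> x [/nt].
    case: (lt_tot t t') => [/ltW tt'|[->|/ltW tt']]; last by left=> x; apply: mono.
      by right=> x; apply: mono.
    by left.
  - move=> b d0b bd1; have [l [u [tl lu H]]] := Hd _ d0b bd1.
    exists (o (i l) u); split; first by have := @o_ltl _ _ (i l) lu; rewrite io.
    exists l; split=> // x lx [z [/opE]]; rewrite -oA oi oe => <-.
    exact: H.
have e_dl : lt e dl by have [b [hb bh]] := dense h01; have [] := Hh b hb bh.
have l_dl l : lt l (o l dl) by have := @o_ltl _ _ l e_dl; rewrite eo.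
pose L l b := ~ lt l t0 /\ forall x, lt l x -> (exists z, sop opf l dl z /\ lt x z) -> R x b.
have LR l b x : L l b -> lt l x -> lt x (o l dl) -> R x b.
  by move=> [_ H] lx xl; apply: H => //; exists (o l dl); split=> //; apply/opE.
pose FL (t : Str ar) (l b : t) (z : nat -> t) :=
  ~ slt ltf l (z 0) /\ forall x, slt ltf l x -> (exists w, sop opf l (z 1) w /\ slt ltf x w) ->
    FR t x b (fun k => z k.+2).
have FOL : FO true (fun t z => FL t (z 0) (z 1) (fun k => z k.+2)).
  apply: FO_and; first by apply: FO_not; exact: (FO_lt Lltf _ 0 2).
  apply: FO_all; apply: FO_imp; first exact: (FO_lt Lltf _ 1 0).
  apply: FO_imp.
    apply: FO_ex; apply: FO_and; first exact: (FO_op Lopf _ 2 5 0).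
    exact: (FO_lt Lltf _ 1 0).
  by apply: (@FO_holds _ _ _ _ (fun k => if k is k'.+1 then if k' is k''.+1 then k''.+1.+4 else 2 else 0))
    => // t u [|[|k]].
(* The least left endpoint at or above t0. It exists because the infimum of the admissible endpoints
   is again admissible. *)
pose Mn l b := L l b /\ forall l', L l' b -> le l l'.
pose vL := scons t0 (scons dl v).
pose FM (t : Str ar) (l b : t) (z : nat -> t) :=
  FL t l b z /\ forall l', FL t l' b z -> ~ slt ltf l' l.
have FOM : FO true (fun t z => FM t (z 0) (z 1) (fun k => z k.+2)).
  apply: FO_and => //; apply: FO_all; apply: FO_imp.
    by apply: (@FO_subst _ _ _ _ (fun k => if k is k'.+1 then if k' is k''.+1 then k''.+3 else 2 else 0)
      (fun t z k => if k is k'.+1 then if k' is k''.+1 then z k''.+3 else z 2 else z 0) _ FOL)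
     => t u [|[|k]].
  by apply: FO_not; exact: (FO_lt Lltf _ 0 1).
have dMb b : defL (fun l => Mn l b) by apply: (@defL_FO _ _ (scons b vL) FOM).
have dMl l : defL (fun b => Mn l b).
  apply: (@defL_FO (fun t z => FM t (z 1) (z 0) (fun k => z k.+2)) _ (scons l vL) _ (fun=> conj id id)).
  by apply: (@FO_subst _ _ _ _ (fun k => if k is k'.+1 then if k' is k''.+1 then k''.+2 else 0 else 1)
      (fun t z k => if k is k'.+1 then if k' is k''.+1 then z k''.+2 else z 0 else z 1) _ FOM)
     => t u [|[|k]].
have Mn_ex b : lt h0 b -> lt b h1 -> exists l, Mn l b.
  move=> hb bh; have [_ [l0 [tl0 Hl0]]] := Hh b hb bh.
  have [||| m Hm1 Hm2] := @def_inf (fun l => L l b) t0.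
  - by apply: (@defL_FO _ _ (scons b vL) FOL).
  - exists l0; split; first exact: ltW.
    by move=> x lx [z [/opE<-]]; apply: Hl0.
  - by move=> x [].
  exists m; split=> //; split.
    by move=> /Hm2[x [xt _] /xt].
  move=> x /Hm2[l Ll lx] [z [/opE<- xm]]; apply: (LR _ _ _ Ll lx).
  case: (lt_tot m l) => [/(@o_ltr _ _ dl)/(lt_trans xm)//|[<-//|lm]].
  by case: (Hm1 _ Ll).
have sMb b : small (fun l => Mn l b).
  case: (pselect (exists l, Mn l b)) => [[l [Ll Hl]]|nl].
    apply: (@small_sub _ (fun l' => l' = l)); last exact: small1.
    move=> l' [Ll' Hl']; case: (lt_tot l' l) => [/(Hl _ Ll')//|[//|]].
    by move=> /(Hl' _ Ll).
  by apply: (@fin_small _ [::]) => l Hl; case: nl; exists l.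
pose Im l := exists b, (lt h0 b /\ lt b h1) /\ Mn l b.
have dIm : defL Im.
  apply: (@defL_FO (fun t z => exists b, (slt ltf (z 1) b /\ slt ltf b (z 2)) /\
    FM t (z 0) b (fun k => z k.+3))
    _ (scons h0 (scons h1 vL)) _ (fun=> conj id id)).
  apply: FO_ex; apply: FO_and.
    apply: FO_and; [exact: (FO_lt Lltf _ 2 0)|exact: (FO_lt Lltf _ 0 3)].
  by apply: (@FO_subst _ _ _ _ (fun k => if k is k'.+1 then if k' is k''.+1 then k''.+4 else 0 else 1)
      (fun t z k => if k is k'.+1 then if k' is k''.+1 then z k''.+4 else z 0 else z 1) _ FOM)
     => t u [|[|k]].
(* The value l is taken only at points b of the small set R x, for any x in (l, l + dl). A small set
   of values could therefore not account for all of (h0, h1). *)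
have : ~ small Im.
  move=> sIm; have := @small_bigcup Im Mn dIm dMl sIm.
  case=> [l _|].
    have [x [lx xl]] := dense (l_dl l); apply: small_sub (sR x) => b [Ll _].
    exact: LR Ll lx xl.
  exists h0, h1; split=> // b hb bh; have [l Hl] := Mn_ex b hb bh.
  by exists l; split=> //; exists b.
move=> /contrapT[j0 [j1 [j01 Hj]]].
(* This x belongs to (l, l + dl) for every l in (j0, x). All these values are then taken on the
   small set R x, with one value for each b, which would make (j0, x) small. *)
have [x [j0x xj1 xd]] := lt_min_ex j01 (l_dl j0).
have := @small_bigcup (R x) (fun b l => Mn l b) _ dMb (sR x) (fun b _ => sMb b).
case.
  apply: (@defL_FO (fun t z => FR t (z 1) (z 0) (fun k => z k.+2)) _ (scons x v) _ (fun=> conj id id)).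
  by apply: (@FO_holds _ _ _ f (fun k => if k is k'.+1 then if k' is k''.+1 then k''.+2 else 0 else 1)
      (fun t z k => if k is k'.+1 then if k' is k''.+1 then z k''.+2 else z 0 else z 1))
     => // t u [|[|k]].
exists j0, x; split=> // l jl lx; have lj1 := lt_le_trans lx xj1.
have [b [_ Hb]] := Hj l jl lj1; exists b; split=> //.
apply: LR (proj1 Hb) lx _; apply: le_lt_trans xd _; exact: o_ltr.
Qed.

End Ominimal.

(** * Ultrapowers *)

Section Ultrapower.
Local Open Scope classical_set_scope.
Variables (I : Type) (ar : I -> nat).
Local Notation fm := (formula (ar_P ar)).
Variables (M : Str ar) (m0 : M) (U : set_system nat).
Context {UF : UltraFilter U}.

Definition ueq (f g : nat -> M) : Prop := U [set j | f j = g j].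

Lemma ueq_refl f : ueq f f.
Proof. by apply: filterS filterT. Qed.

Lemma ueq_sym f g : ueq f g -> ueq g f.
Proof. by apply: filterS => j /= ->. Qed.

Lemma ueq_trans f g h : ueq f g -> ueq g h -> ueq f h.
Proof. by move=> H1 H2; apply: filterS (filterI H1 H2) => j [/= -> ->]. Qed.

Definition ucanon (f : nat -> M) : nat -> M :=
  @xget {classic (nat -> M)} (fun=> m0) (ueq f).

Lemma ucanonP f : ueq f (ucanon f).
Proof. by apply: (@xgetPex {classic (nat -> M)}); exists f; apply: ueq_refl. Qed.

Lemma ucanon_eq f g : ueq f g -> ucanon f = ucanon g.
Proof.
move=> fg; have E : ueq f = ueq g; last by rewrite /ucanon E.
by apply/funext => h; apply/propext; split; apply: ueq_trans => //; apply: ueq_sym.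
Qed.

(** Each class is stored as its chosen representative, so equality in the ultrapower is Leibniz
    equality and representatives are read off by projection. *)
Definition ucar : Type := {f : nat -> M | ucanon f = f}.

Definition urep (a : ucar) : nat -> M := sval a.

Definition ucls (f : nat -> M) : ucar :=
  exist _ (ucanon f) (esym (ucanon_eq (ucanonP f))).

Lemma ucls_eq f g : ueq f g -> ucls f = ucls g.
Proof. by move=> fg; apply: eq_exist; apply: ucanon_eq. Qed.

Lemma urepK a : ucls (urep a) = a.
Proof. by case: a => f Hf; apply: eq_exist. Qed.

Lemma uclsK f : ueq (urep (ucls f)) f.
Proof. exact/ueq_sym/ucanonP. Qed.

Lemma ucls_inj f g : ucls f = ucls g -> ueq f g.
Proof. by move=> E; apply: ueq_trans (ueq_sym (uclsK f)) _; rewrite E; apply: uclsK. Qed.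

Definition upower : Str ar :=
  @MkStr _ ar {classic ucar}
    (fun o t => U [set j | rl (map_tuple (fun a : ucar => urep a j) t)]).

Lemma ultraP (A : set nat) : U (~` A) <-> ~ U A.
Proof.
split=> [nA UA|nA]; last by case: (in_ultra_setVsetC A UF).
by apply: (filter_not_empty U); rewrite -(setICr A); apply: filterI.
Qed.

Lemma Los (f : fm) (g : nat -> nat -> M) :
  @holds _ _ upower (fun k => ucls (g k)) f <-> U [set j | holds (fun k => g k j) f].
Proof.
rewrite /holds.
elim: f g => [o vs|a b|f IH|f IHf h IHh|x f IH] g /=.
- have H : U [set j | forall k, k \in (vs : seq nat) -> urep (ucls (g k)) j = g k j].
    elim: (vs : seq nat) => [|k l IH]; first by apply: filterS filterT.
    apply: filterS (filterI (uclsK (g k)) IH) => j [/= E1 E2] k'.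
    by rewrite inE => /orP[/eqP->|/E2].
  split=> /(filterI H); apply: filterS => j [/= E].
    suff -> : map_tuple (fun a : ucar => urep a j) (map_tuple (fun k => ucls (g k)) vs) =
              map_tuple (fun k => g k j) vs by [].
    by apply: val_inj; rewrite /= -map_comp; apply/eq_in_map => k /E.
  suff -> : map_tuple (fun a : ucar => urep a j) (map_tuple (fun k => ucls (g k)) vs) =
            map_tuple (fun k => g k j) vs by [].
  by apply: val_inj; rewrite /= -map_comp; apply/eq_in_map => k /E.
- by split=> [/ucls_inj|/ucls_eq].
- have := IH g; have := ultraP [set j | sat (@rl _ _ M) (fun k => g k j) f].
  by rewrite /setC /=; tauto.
- split=> [[/IHf H1 /IHh H2]|H]; first exact: filterS (filterI H1 H2).
  by split; [apply/IHf|apply/IHh]; apply: filterS H => j [].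
- split=> [[a]|H].
    have -> : (fun k => if k == x then a else ucls (g k)) =
              (fun k => ucls (if k == x then urep a else g k)).
      by apply/funext => k; case: eqP => // _; rewrite urepK.
    move=> /IH; apply: filterS => j /= Hj; exists (urep a j).
    by move: Hj; congr sat; apply/funext => k; case: eqP.
  have [h Hh] : {h : nat -> M & forall j,
      (exists a, sat (@rl _ _ M) (fun k => if k == x then a else g k j) f) ->
      sat (@rl _ _ M) (fun k => if k == x then h j else g k j) f}.
    apply: (choice (P := fun j y => (exists a, sat (@rl _ _ M)
      (fun k => if k == x then a else g k j) f) -> sat (@rl _ _ M)
      (fun k => if k == x then y else g k j) f)) => j; case: (pselect (exists a, sat (@rl _ _ M)
      (fun k => if k == x then a else g k j) f)) => [[a Ha]|nH]; [by exists a|by exists m0].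
  exists (ucls h).
  have -> : (fun k => if k == x then ucls h else ucls (g k)) =
            (fun k => ucls (if k == x then h else g k)).
    by apply/funext => k; case: eqP.
  apply/IH; apply: filterS H => j /= /Hh.
  by congr sat; apply/funext => k; case: eqP.
Qed.

Lemma Los_rep (f : fm) (v : nat -> upower) :
  holds v f <-> U [set j | holds (fun k => urep (v k) j) f].
Proof.
by rewrite -Los; have -> : (fun k => ucls (urep (v k))) = v
  by apply/funext => k; rewrite urepK.
Qed.

Lemma transfer_up b (Q : forall s : Str ar, (nat -> s) -> Prop) :
  FO b Q -> (forall v, Q M v) -> forall v, Q upower v.
Proof. by case=> f _ H HM v; apply/H/Los_rep; apply: filterS filterT => j _; apply/H. Qed.

Hypothesis Uoo : eventually `<=` U.
Variable code : fm -> nat.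
Hypothesis code_inj : injective code.

(** Countable saturation: [code] enumerates the formulas and [Uoo] makes U nonprincipal. The
    variables selected by [fix_] carry the parameters; the others, possibly infinitely many, are
    solved for simultaneously. *)
Lemma saturation (Sg : fm -> Prop) (fix_ : nat -> bool) (v : nat -> upower) :
  (forall l : list fm, (forall f, List.In f l -> Sg f) ->
     exists v', (forall k, fix_ k -> v' k = v k) /\ forall f, List.In f l -> holds v' f) ->
  exists v', (forall k, fix_ k -> v' k = v k) /\ forall f, Sg f -> holds v' f.
Proof.
move=> fin.
have listS j : exists l : list fm, forall f, List.In f l <-> Sg f /\ code f < j.
  elim: j => [|j [l Hl]]; first by exists nil => f; split=> [[]|[]].
  case: (pselect (exists f, Sg f /\ code f = j)) => [[f [Sf cf]]|nf].
    exists (cons f l) => g /=; rewrite Hl (ltnS (code g) j) (leq_eqVlt (code g) j); split=> [[<-|[Sg' ->]]|[Sg']].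
    - by rewrite cf eqxx.
    - by rewrite orbT.
    - by case/orP => [/eqP E|]; [left; apply: code_inj; rewrite cf|right].
  exists l => g; rewrite Hl (ltnS (code g) j) (leq_eqVlt (code g) j); split=> [[Sg' ->]|[Sg' /orP[/eqP E|->]]] //.
    by rewrite orbT.
  by case: nf; exists g.
have [l Hl] := choice listS.
have [w Hw] := choice (fun j => fin (l j) (fun f Hf => proj1 (proj1 (Hl j f) Hf))).
pose A j := [set i | forall f, List.In f (l j) -> holds (fun k => urep (w j k) i) f].
have UA j : U (A j).
  have [_] := Hw j; rewrite /A.
  elim: (l j) => [|f t IH] Ht; first by apply: filterS filterT => i _ f [].
  have Hf : holds (w j) f by apply: Ht; left.
  have IH' := IH (fun g Hg => Ht g (or_intror Hg)).
  move/Los_rep: Hf => /filterI/(_ IH'); apply: filterS => i [/= H1 H2] g [<-//|/H2].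
  exact.
have A0 i : `[< A 0 i >] by apply/asboolP => f /Hl[].
have exJ i : exists j, (j <= i) && `[< A j i >] by exists 0; rewrite A0.
have bJ i j : (j <= i) && `[< A j i >] -> j <= i by case/andP.
(* At index i the solution for the longest initial part of the enumeration that is satisfied there
   is used. The cap j <= i makes the maximum exist and costs only finitely many indices; j = 0
   always qualifies, because no code is below 0. *)
pose J i := ex_maxn (exJ i) (bJ i).
have JA i : A (J i) i by rewrite /J; case: ex_maxnP => j /andP[_ /asboolP].
have Jge i j : j <= i -> A j i -> j <= J i.
  move=> ji Aj; rewrite /J; case: ex_maxnP => j' _; apply.
  by rewrite ji; apply/asboolP.
exists (fun k => ucls (fun i => urep (w (J i) k) i)); split=> [k fk|f Sf].
  rewrite -[RHS]urepK; congr ucls; apply/funext => i.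
  by have [-> //] := Hw (J i).
apply/(Los f (fun k i => urep (w (J i) k) i)).
have T : U [set i | (code f).+1 <= i] by apply: Uoo; exists (code f).+1.
apply: filterS (filterI T (UA (code f).+1)) => i [/= ci Ai].
apply: JA; apply/Hl; split=> //.
exact: (Jge i _ ci Ai).
Qed.

End Ultrapower.

(** * Pregeometries *)

Lemma setU_cons (T : eqType) (B : set T) x (s : seq T) :
  (B `|` [set` x :: s] = B `|` [set x] `|` [set` s])%classic.
Proof.
rewrite -setUA; congr (_ `|` _)%classic; apply/seteqP; split=> y /=; rewrite inE.
  by case/orP=> [/eqP|]; [left|right].
by case=> [->|->]; rewrite ?eqxx ?orbT.
Qed.

Section Pregeometry.
Local Open Scope classical_set_scope.
Variable T : eqType.

Record pregeom (cl : set T -> set T) : Prop := Pregeom {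
  pg_mono : forall A B, A `<=` B -> cl A `<=` cl B;
  pg_ext : forall A, A `<=` cl A;
  pg_fin : forall A x, cl A x ->
    exists l : seq T, (forall y, y \in l -> A y) /\ cl [set` l] x;
  pg_trans : forall A B, A `<=` cl B -> cl A `<=` cl B;
  pg_exch : forall A a b,
    cl (A `|` [set a]) b -> ~ cl A b -> cl (A `|` [set b]) a }.

Variables (cl : set T -> set T) (pg : pregeom cl).
Local Notation cl_mono := (pg_mono pg).
Local Notation cl_ext := (pg_ext pg).
Local Notation cl_fin := (pg_fin pg).
Local Notation cl_trans := (pg_trans pg).
Local Notation cl_exch := (pg_exch pg).

(** The dimension of the tuple [s] over [B], counted along the list; by [rk_perm] the order does not
    matter. *)
Fixpoint rk (B : set T) (s : seq T) : nat :=
  if s is x :: s' then ~~ `[< cl B x >] + rk (B `|` [set x]) s' else 0.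

Lemma cl_finU B Q x : cl (B `|` Q) x ->
  exists t : seq T, (forall y, y \in t -> Q y) /\ cl (B `|` [set` t]) x.
Proof.
move=> /cl_fin[l [Hl cx]].
suff [t [Ht lt]] : exists t : seq T, (forall y, y \in t -> Q y) /\
    forall y, y \in l -> B y \/ y \in t.
  by exists t; split=> //; apply: cl_mono cx => y /lt.
elim: l Hl {cx} => [|y l IH] Hl; first by exists [::].
have [t [Ht lt]] := IH (fun z zl => Hl z (mem_behead (s := y :: l) zl)).
case: (Hl y (mem_head _ _)) => [By|Qy].
  by exists t; split=> // z; rewrite inE => /orP[/eqP->|/lt]; [left|].
exists (y :: t); split=> [z|z]; rewrite inE => /orP[/eqP->//|].
- exact: Ht.
- by right; rewrite mem_head.
- by move=> /lt[|zt]; [left|right; rewrite inE zt orbT].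
Qed.

Lemma rk_anti B B' s : B `<=` cl B' -> rk B' s <= rk B s.
Proof.
elim: s B B' => //= x s IH B B' H; apply: leq_add.
  case: asboolP => // n1; case: asboolP => //= n2; case: n1.
  exact: cl_trans H _ n2.
apply: IH => y [/H|->]; first by apply: cl_mono => z; left.
by apply: cl_ext; right.
Qed.

Lemma rk_mono B B' s : B `<=` B' -> rk B' s <= rk B s.
Proof. by move=> H; apply: rk_anti => x /H; apply: cl_ext. Qed.

Lemma rk_cat B s t : rk B (s ++ t) = rk B s + rk (B `|` [set` s]) t.
Proof.
elim: s B => [|x s IH] B /=.
  by rewrite add0n; congr rk; apply/seteqP; split=> y; [left|case].
rewrite IH addnA; congr (_ + rk _ _); apply/seteqP; split=> y /=; rewrite inE.
  by move=> [[]|]; [left|move=> ->; right; rewrite eqxx|move=> ->; right; rewrite orbT].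
by move=> [|/orP[/eqP->|]]; [left; left|left; right|right].
Qed.

Lemma rk_swap B x y s : rk B (x :: y :: s) = rk B (y :: x :: s).
Proof.
have le_ x' y' : rk B (x' :: y' :: s) <= rk B (y' :: x' :: s).
  rewrite /= !addnA; apply: leq_add; last first.
    by apply: rk_mono => z [[]|]; [left; left|right|left; right].
  case: (asboolP (cl B x')) => cx; case: (asboolP (cl B y')) => cy;
  case: (asboolP (cl (B `|` [set x']) y')) => cxy; case: (asboolP (cl (B `|` [set y']) x')) => cyx //=.
  - by case: cxy; apply: cl_mono cy => z; left.
  - by case: cx; apply: cl_trans cyx => z [|->//]; apply: cl_ext.
  - by case: cxy; apply: cl_mono cy => z; left.
  - by case: cxy; apply: cl_mono cy => z; left.
  - by case: cxy; apply: cl_exch cyx cx.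
by apply/eqP; rewrite eqn_leq !le_.
Qed.

Lemma rk_perm B s t : perm_eq s t -> rk B s = rk B t.
Proof.
have front x (s1 s2 : seq T) C : rk C (s1 ++ x :: s2) = rk C (x :: s1 ++ s2).
  elim: s1 C => //= y s1 IH C; rewrite IH; exact: (rk_swap C y x).
elim: s t B => [|x s IH] t B st; first by move: st; rewrite perm_sym => /perm_nilP->.
have xt : x \in t by rewrite -(perm_mem st) mem_head.
case/splitPr: xt st => t1 t2 st; rewrite front /=; congr (_ + _); apply: IH.
by rewrite -(perm_cons x); apply: perm_trans st _; rewrite perm_catC /= perm_cons perm_catC.
Qed.

Lemma rk_eq0 B s : (forall x, x \in s -> cl B x) -> rk B s = 0.
Proof.
elim: s B => //= x s IH B H; have cx := H x (mem_head _ _).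
rewrite asboolT // IH // => y ys; apply: (@cl_mono B) => [z|]; first by left.
by apply: H; rewrite inE ys orbT.
Qed.

Lemma rk_sub B s t : (forall x, x \in t -> cl (B `|` [set` s]) x) -> rk B t <= rk B s.
Proof.
move=> H; have -> : rk B s = rk B (t ++ s).
  by rewrite (rk_perm B (permEl (perm_catC t s))) rk_cat (rk_eq0 H) addn0.
by rewrite rk_cat leq_addr.
Qed.

Lemma rk_addC B s t : rk B s + rk (B `|` [set` s]) t = rk B t + rk (B `|` [set` t]) s.
Proof. by rewrite -!rk_cat; apply: rk_perm; rewrite (permEl (perm_catC s t)). Qed.

Lemma rk_size B s : rk B s <= size s.
Proof. by elim: s B => //= x s IH B; rewrite -add1n leq_add // leq_b1. Qed.

Lemma rk_finU B Q s d : rk (B `|` Q) s < d ->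
  exists t : seq T, (forall y, y \in t -> Q y) /\ rk (B `|` [set` t]) s < d.
Proof.
have UAC (A C D : set T) : A `|` C `|` D = A `|` D `|` C.
  by rewrite -!setUA (setUC C).
elim: s B d => [|x s IH] B d /=; first by exists [::]; split.
case: asboolP => [cx|ncx] /=; rewrite ?add0n ?add1n UAC.
  move=> /IH[t2 [Ht2 H2]]; have [t1 [Ht1 H1]] := cl_finU cx.
  exists (t1 ++ t2); split=> [y|].
    by rewrite mem_cat => /orP[/Ht1|/Ht2].
  rewrite asboolT /= ?add0n; last first.
    by apply: cl_mono H1 => y [|yt]; [left|right; rewrite /= mem_cat yt].
  apply: leq_ltn_trans H2; apply: rk_mono => y [[|->]|yt]; [by left; left|by right|].
  by left; right; rewrite /= mem_cat yt orbT.
case: d => // d; rewrite ltnS => /IH[t [Ht H]]; exists t; split=> //.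
rewrite UAC; apply: (@leq_ltn_trans (1 + rk (B `|` [set x] `|` [set` t]) s)).
  by rewrite leq_add // leq_b1.
by rewrite add1n ltnS.
Qed.

Variable P : set T.

Definition supp (B : set T) : set T := [set p | P p /\ cl (B `|` (P `\ p)) p].

Lemma supp_mono B B' : B `<=` B' -> supp B `<=` supp B'.
Proof. by move=> H p [Pp cp]; split=> //; apply: cl_mono cp => y [/H|]; [left|right]. Qed.

Lemma supp_cl B C : C `<=` cl B -> supp C `<=` supp B.
Proof.
move=> H p [Pp cp]; split=> //; apply: cl_trans cp => y [/H|].
  by apply: cl_mono => z; left.
by move=> ?; apply: cl_ext; right.
Qed.

Lemma supp_UP B t : t `<=` P -> supp (B `|` t) `<=` supp B `|` t.
Proof.
move=> tP p [Pp cp]; case: (pselect (t p)) => tp; [by right|left; split=> //].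
apply: cl_mono cp => y [[|ty]|]; [by left| |by right].
by right; split; [apply: tP|move=> /= E; rewrite E in ty].
Qed.

(** If p became dependent only with the help of x, exchange would put x into the closure of B and
    P. *)
Lemma supp_new B x : ~ cl (B `|` P) x -> supp (B `|` [set x]) `<=` supp B.
Proof.
move=> nx p [Pp cp]; split=> //; apply: contrapT => ncp; apply: nx.
have cp' : cl (B `|` (P `\ p) `|` [set x]) p.
  by apply: cl_mono cp => y [[|]|]; [left; left|right|left; right].
apply: cl_mono (cl_exch cp' ncp) => y [[|[]]|->]; [by left|by right|by right].
Qed.

Lemma supp_supp B : supp (B `|` supp B) `<=` supp B.
Proof. by move=> p /supp_UP[q []|//|]. Qed.

(** Take a minimal t in P with z in the closure of B and t. Each element of t can be exchanged for
    z, so it belongs to the support of B and z. *)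
Lemma span_supp B z : cl (B `|` P) z -> cl (B `|` supp (B `|` [set z])) z.
Proof.
move=> /cl_finU[t [tP ct]].
elim: {t}(size t) {-2}t (leqnn (size t)) tP ct => [|k IH] t tk tP ct.
  by apply: cl_mono ct => y [|]; [left|case: t tk {tP} => //].
case: (pselect (exists2 p, p \in t & cl (B `|` [set` [seq u <- t | u != p]]) z)) => [[p pt cz]|np].
  apply: (IH ([seq u <- t | u != p])) => //; last by move=> y; rewrite mem_filter => /andP[_ /tP].
  rewrite -ltnS; apply: leq_trans tk; rewrite size_filter -(count_predC (pred1 p) t).
  by rewrite -{1}[count _ t]add0n ltn_add2r -has_count has_pred1.
apply: (cl_mono _ ct) => y [|yt]; first by left.
right; split; first exact: tP.
have nz : ~ cl (B `|` [set` [seq u <- t | u != y]]) z by move=> cz; apply: np; exists y.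
have cz : cl (B `|` [set` [seq u <- t | u != y]] `|` [set y]) z.
  apply: cl_mono ct => u [|ut]; first by left; left.
  case: (eqVneq u y) => [->|uy]; [by right|left; right].
  by rewrite /= mem_filter /= uy.
apply: cl_mono (cl_exch cz nz) => u [[|]|->]; [by left; left| |by left; right].
by rewrite /= mem_filter => /andP[/= uy /tP Pu]; right; split=> //=; apply/eqP.
Qed.

Lemma supp_fin B (s : seq T) : exists2 t : seq T, (forall p, p \in t -> P p) &
  supp (B `|` [set` s]) `<=` supp B `|` [set` t].
Proof.
elim: s B => [|x s IH] B; first by exists [::] => // p /(@supp_mono _ B)-[y []|Pp cp] //; left.
have E := setU_cons B x s.
have [t Pt Ht] := IH (B `|` [set x]); rewrite E.
case: (pselect (cl (B `|` P) x)) => [/cl_finU[t' [Pt' ct']]|nx]; last first.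
  by exists t => // p /Ht[/(supp_new nx)|]; [left|right].
exists (t' ++ t) => [p|p /Ht[sp|]]; first by rewrite mem_cat => /orP[/Pt'|/Pt].
  have : supp (B `|` [set` t']) p.
    apply: supp_cl sp => y [By|->//]; apply: cl_ext; by left.
  by case/(supp_UP Pt') => [|pt]; [left|right; rewrite /= mem_cat pt].
by right; rewrite /= mem_cat orbC (_ : p \in t).
Qed.

(** If adding P loses no rank, every coordinate that is new over B and its predecessors is also new
    over P, and [supp_new] applies to it; the remaining coordinates lie in the closure already. *)
Lemma rk_supp_sub B s : rk B s <= rk (B `|` P) s -> supp (B `|` [set` s]) `<=` supp B.
Proof.
elim: s B => [|x s IH] B.
  by move=> _; apply: supp_mono => y [].
have E := setU_cons B x s.
rewrite /= E; have -> : B `|` P `|` [set x] = B `|` [set x] `|` P by rewrite -!setUA (setUC P).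
have le2 : rk (B `|` [set x] `|` P) s <= rk (B `|` [set x]) s by apply: rk_mono => y; left.
case: asboolP => [cx|ncx] /=; last first.
  case: asboolP => [cxP|ncxP] /=; first by rewrite add0n add1n => /leq_trans-/(_ _ le2); rewrite ltnn.
  rewrite !add1n ltnS => /IH H; exact: subset_trans H (supp_new ncxP).
rewrite add0n asboolT /= ?add0n; last by apply: cl_mono cx => y; left.
move=> /IH H; apply: subset_trans H (supp_cl _) => y [|->//]; exact: cl_ext.
Qed.

Lemma rk_good B s : supp (B `|` [set` s]) `<=` B -> rk (B `|` P) s = rk B s.
Proof.
elim: s B => //= x s IH B H.
have E := setU_cons B x s.
have -> : B `|` P `|` [set x] = B `|` [set x] `|` P by rewrite -!setUA (setUC P).
rewrite IH; last by rewrite -E => p /H; left.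
congr (~~ _ + _); apply: asbool_equiv_eq; split; last by apply: cl_mono => y; left.
move=> /span_supp; apply: cl_mono => y [//|sy]; apply: H; apply: supp_mono sy.
by rewrite E => z; left.
Qed.

(** The hypothesis says that y is independent of X over B and P. A coordinate outside the closure of
    B, X and P adds no support; any other one lies in the closure of B and P already, hence by
    [span_supp] is generated by B and the support of B with that coordinate. *)
Lemma supp_union B X y : rk (B `|` P) y <= rk (B `|` X `|` P) y ->
  supp (B `|` X `|` [set` y]) `<=` supp (B `|` X) `|` supp (B `|` [set` y]).
Proof.
elim: y B => [|z y IH] B.
  by move=> _ p sp; left; apply: supp_mono sp => w [].
have E C := setU_cons C z y.
have E1 : B `|` X `|` [set z] = B `|` [set z] `|` X by rewrite -!setUA (setUC X).
rewrite /= !E E1.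
have -> : B `|` X `|` P `|` [set z] = B `|` [set z] `|` X `|` P.
  by rewrite -E1 -!setUA (setUC P).
have -> : B `|` P `|` [set z] = B `|` [set z] `|` P by rewrite -!setUA (setUC P).
move=> Hrk; have le2 : rk (B `|` [set z] `|` X `|` P) y <= rk (B `|` [set z] `|` P) y.
  by apply: rk_mono => w [|]; [left; left|right].
have le1 : nat_of_bool (~~ `[< cl (B `|` X `|` P) z >]) <= nat_of_bool (~~ `[< cl (B `|` P) z >]).
  case: asboolP => [|n1] //=; case: asboolP => //= c; case: n1; apply: cl_mono c.
  by move=> w [|]; [left; left|right].
have Hy : rk (B `|` [set z] `|` P) y <= rk (B `|` [set z] `|` X `|` P) y.
  rewrite -(leq_add2l (~~ `[< cl (B `|` P) z >])); apply: (leq_trans Hrk).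
  by rewrite leq_add2r.
move=> p /(IH _ Hy)[sp|]; last by right.
rewrite -E1 in sp.
case: (pselect (cl (B `|` X `|` P) z)) => cz; last by left; apply: supp_new cz _ sp.
have {}cz : cl (B `|` P) z.
  by move: Hrk; rewrite (asboolT cz); case: (asboolP (cl (B `|` P) z)) => //= _;
    rewrite add0n add1n => /leq_trans-/(_ _ le2); rewrite ltnn.
have : supp (B `|` X `|` supp (B `|` [set z])) p.
  apply: supp_cl sp => w [wBX|->]; first by apply: cl_ext; left.
  by apply: cl_mono (span_supp cz) => u [|]; [left; left|right].
case/supp_UP => [q []//|sp'|sp']; [by left|right].
by apply: supp_mono sp' => u; left.
Qed.

End Pregeometry.

(** * Tame structures *)

Definition pre (T : Type) (l : seq T) (u : nat -> T) (k : nat) : T :=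
  nth (u (k - size l)) l k.

Lemma pre_nil (T : Type) (u : nat -> T) : pre [::] u = u.
Proof. by apply/funext => k; rewrite /pre nth_nil subn0. Qed.

Lemma pre_cons (T : Type) c (l : seq T) (u : nat -> T) : pre (c :: l) u = scons c (pre l u).
Proof. by apply/funext => -[|k]; rewrite /pre //= subSS. Qed.

Lemma pre_size (T : Type) (l : seq T) (u : nat -> T) k : pre l u (size l + k) = u k.
Proof. by rewrite /pre nth_default ?leq_addr // addKn. Qed.

Lemma pre_cat (T : Type) (l l' : seq T) (u : nat -> T) : pre (l ++ l') u = pre l (pre l' u).
Proof.
elim: l => [|c l IH] /=; first by rewrite pre_nil.
by rewrite !pre_cons IH.
Qed.

Lemma pre_lt (T : Type) (x0 : T) (l : seq T) (u : nat -> T) k :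
  k < size l -> pre l u k = nth x0 l k.
Proof. by move=> kl; rewrite /pre; apply: set_nth_default. Qed.

Section Definability.
Variables (I : Type) (ar : I -> nat) (ltf : formula (ar_P ar)).
Hypothesis Lltf : isL ltf.
Variable K : Str ar.

(** The parameters D are listed explicitly, at the first positions, because closures and supports
    depend on which parameters a formula uses. *)
Definition DefO (b : bool) (D : seq K) (X : (nat -> K) -> Prop) : Prop :=
  exists2 f, b ==> isL f & forall u, X u <-> holds (pre D u) f.

Lemma DefO_FO b D (Q : forall s : Str ar, (nat -> s) -> Prop) (X : (nat -> K) -> Prop) :
  FO b Q -> (forall u, X u <-> Q K (pre D u)) -> DefO b D X.
Proof. by case=> f Lf H E; exists f => // u; rewrite E H. Qed.

Lemma DefO_eqv b D (X X' : (nat -> K) -> Prop) :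
  (forall u, X u <-> X' u) -> DefO b D X -> DefO b D X'.
Proof. by move=> E [f Lf H]; exists f => // u; rewrite -E. Qed.

Lemma DefO_weak b D X : DefO b D X -> DefO false D X.
Proof. by case=> f Lf H; exists f. Qed.

Lemma DefO_subst b D D' (X : (nat -> K) -> Prop) (t : (nat -> K) -> nat -> K) :
  DefO b D X -> {subset D <= D'} ->
  (forall k, (exists j, forall u, t u k = u j) \/ (exists2 c, c \in D' & forall u, t u k = c)) ->
  DefO b D' (fun u => X (t u)).
Proof.
move=> [f Lf H] DD' Ht.
have [r Hr] : {r : nat -> nat & forall k u, pre D (t u) k = pre D' u (r k)}.
  apply: (choice (P := fun k j => forall u, pre D (t u) k = pre D' u j)) => k.
  have cst c : c \in D' -> exists j, forall u, c = pre D' u j.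
    by exists (index c D') => u; rewrite (pre_lt c) ?index_mem // nth_index.
  case: (ltnP k (size D)) => [kD|Dk].
    have [c cD Hc] : exists2 c, c \in D & forall w, pre D w k = c.
      case: (D) kD => // d D0 kD; exists (nth d (d :: D0) k); first exact: mem_nth.
      by move=> w; apply: pre_lt.
    by have [j Hj] := cst c (DD' _ cD); exists j => u; rewrite Hc.
  rewrite -(subnKC Dk); case: (Ht (k - size D)) => [[j Hj]|[c cD' Hc]].
    by exists (size D' + j) => u; rewrite !pre_size.
  by have [j Hj] := cst c cD'; exists j => u; rewrite pre_size Hc.
exists (ren r f); first by rewrite isL_ren.
move=> u; rewrite holds_ren H.
by have -> : pre D (t u) = (fun k => pre D' u (r k)) by apply/funext => k.
Qed.

Lemma DefO_sub b D D' X : {subset D <= D'} -> DefO b D X -> DefO b D' X.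
Proof.
by move=> DD' H; apply: (@DefO_subst b D D' X (fun u => u)) => // k; left; exists k.
Qed.

Lemma DefO_rename b D (X : (nat -> K) -> Prop) (r : nat -> nat) :
  DefO b D X -> DefO b D (fun u => X (fun k => u (r k))).
Proof.
by move=> H; apply: (@DefO_subst b D D X (fun u k => u (r k))) => // k; left; exists (r k).
Qed.

Lemma DefO_not b D X : DefO b D X -> DefO b D (fun u => ~ X u).
Proof. by case=> f Lf H; exists (FNot f) => // u; rewrite H. Qed.

Lemma DefO_and b D X X' : DefO b D X -> DefO b D X' -> DefO b D (fun u => X u /\ X' u).
Proof.
case=> f Lf H [f' Lf' H']; exists (FAnd f f') => [/=|u]; last by rewrite H H'.
by case: b Lf Lf' => //= -> ->.
Qed.

Lemma DefO_imp b D X X' : DefO b D X -> DefO b D X' -> DefO b D (fun u => X u -> X' u).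
Proof.
move=> HX HX'; apply: DefO_eqv (DefO_not (DefO_and HX (DefO_not HX'))) => u.
split=> [H q|H [q]]; last by apply; apply: H.
by apply: contrapT => nq; apply: H.
Qed.

Lemma DefO_or b D X X' : DefO b D X -> DefO b D X' -> DefO b D (fun u => X u \/ X' u).
Proof.
move=> HX HX'; apply: DefO_eqv (DefO_imp (DefO_not HX) HX') => u.
by split=> [H|[]//]; case: (pselect (X u)) => [|/H]; [left|right].
Qed.

Lemma DefO_ex b D (B : (nat -> K) -> K -> Prop) :
  DefO b D (fun u => B (fun k => u k.+1) (u 0)) -> DefO b D (fun u => exists a, B u a).
Proof.
case=> f Lf H; pose r k := if k < size D then k.+1 else if k == size D then 0 else k.
apply: (@DefO_FO b D (fun s v => exists a : s, holds (fun k => scons a v (r k)) f)) => [|u].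
  apply: FO_ex; apply: (@FO_holds _ _ _ _ r) => // s u k.
  by case: (r k).
have E a : B u a <-> holds (fun k => scons a (pre D u) (r k)) f.
  rewrite (H (scons a u)); apply: holds_ext => k _; rewrite /r.
  case: (ltngtP k (size D)) => [kD|Dk|->] /=.
  - by rewrite !(pre_lt a).
  - case: k Dk => // k; rewrite ltnS => Dk.
    by rewrite /= -(subnKC Dk) pre_size -addnS pre_size.
  - by rewrite -{1}[size D]addn0 pre_size.
by split=> -[a /E]; exists a.
Qed.

Lemma DefO_all b D (B : (nat -> K) -> K -> Prop) :
  DefO b D (fun u => B (fun k => u k.+1) (u 0)) -> DefO b D (fun u => forall a, B u a).
Proof.
move=> H; apply: DefO_eqv
  (DefO_not (@DefO_ex b D (fun v a => ~ B v a) (DefO_not H))) => v.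
split=> [nH a|H' [a]]; last by apply.
by apply: contrapT => nB; apply: nH; exists a.
Qed.

Lemma DefO_exT b D m (B : (nat -> K) -> m.-tuple K -> Prop) :
  DefO b D (fun u => B (fun k => u (m + k)) (tk m u)) -> DefO b D (fun u => exists x, B u x).
Proof.
elim: m B => [|m IH] B H.
  apply: DefO_eqv H => v; rewrite [tk 0 v]tuple0; split=> [|[x]].
    by exists [tuple].
  by rewrite tuple0.
pose B1 v (a : K) := exists x : m.-tuple K, B v [tuple of a :: x].
have /DefO_ex : DefO b D (fun u => B1 (fun k => u k.+1) (u 0)).
  apply: (IH (fun u x => B (fun k => u k.+1) [tuple of u 0 :: x])).
  pose r k := if k is j.+1 then (if j < m then j else j.+1) else m.
  apply: DefO_eqv (DefO_rename r H) => v.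
  have -> : (fun k => v (r (m.+1 + k))) = (fun k => v (m + k.+1)).
    by apply/funext => k; rewrite addSn /r ltnNge leq_addr /= addnS.
  have -> // : tk m.+1 (fun k => v (r k)) = [tuple of v (m + 0) :: tk m v].
  apply: eq_from_tnth => i; rewrite tnth_tk.
  case: (unliftP ord0 i) => [j|] ->; rewrite /r.
    by rewrite tnthS tnth_tk lift0 /= ltn_ord.
  by rewrite tnth0 addn0.
apply: DefO_eqv => v; rewrite /B1; split=> [[a [x]]|[x]]; first by exists [tuple of a :: x].
by rewrite {1}(tuple_eta x) => Hx; exists (thead x), (behead_tuple x).
Qed.

Lemma DefO_all_fin b D (T : finType) (Q : T -> (nat -> K) -> Prop) :
  (forall t, DefO b D (Q t)) -> DefO b D (fun v => forall t, Q t v).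
Proof.
move=> H.
have {}H l : DefO b D (fun v => forall t, t \in (l : seq T) -> Q t v).
  elim: l => [|x l IH].
    apply: (@DefO_eqv _ _ (fun u => u 0 = u 0)) => //.
    by apply: (@DefO_FO b D (fun s u => u (size D) = u (size D))) => //; apply: FO_eq.
  apply: DefO_eqv (DefO_and (H x) IH) => v.
  split=> [[Hx Hl] t|Hl]; first by rewrite inE => /orP[/eqP->|/Hl].
  by split=> [|t tl]; apply: Hl; rewrite inE ?eqxx ?tl ?orbT.
apply: DefO_eqv (H (enum T)) => v.
by split=> HQ t => [|_]; apply: HQ; rewrite ?mem_enum.
Qed.

Lemma DefO_var b D (X : (nat -> K) -> Prop) : DefO b [::] X -> DefO b D X.
Proof. exact: DefO_sub. Qed.

Lemma DefO_nil b (Q : forall s : Str ar, (nat -> s) -> Prop) :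
  FO b Q -> DefO b [::] (fun u => Q K u).
Proof. by move=> H; apply: (DefO_FO H) => u; rewrite pre_nil. Qed.

Lemma DefO_eq b D i j : DefO b D (fun u => u i = u j).
Proof. by apply: DefO_var; apply: (@DefO_nil b (fun s u => u i = u j)); apply: FO_eq. Qed.

Lemma DefO_lt b D i j : DefO b D (fun u => slt ltf (u i) (u j)).
Proof. by apply: DefO_var; apply: (@DefO_nil b (fun s u => slt ltf (u i) (u j))); apply: FO_lt. Qed.

Lemma DefO_P D i : DefO false D (fun u => sP (u i)).
Proof. by apply: DefO_var; apply: (@DefO_nil _ (fun s u => sP (u i))); apply: FO_P. Qed.

Lemma DefO_cst b D (p : Prop) : DefO b D (fun=> p).
Proof. by apply: DefO_var; apply: (@DefO_nil b (fun s u => p)); apply: FO_cst. Qed.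

Lemma DefO_small b D (B : (nat -> K) -> K -> Prop) :
  DefO b D (fun u => B (fun k => u k.+1) (u 0)) -> DefO b D (fun u => small ltf (B u)).
Proof.
move=> H; apply: DefO_not; apply: DefO_ex; apply: DefO_ex; apply: DefO_and; first exact: DefO_lt.
apply: DefO_all; apply: DefO_imp; first exact: (DefO_lt b D 2 0).
apply: DefO_imp; first exact: (DefO_lt b D 0 1).
exact: (DefO_rename (fun k => if k is j.+1 then j.+3 else 0) H).
Qed.

(** Turns the parameter c into a variable, which is then varied in the proofs of transitivity and
    exchange. *)
Lemma DefO_head b c D (X : K -> Prop) : DefO b (c :: D) (fun u => X (u 0)) ->
  exists2 R : K -> K -> Prop, DefO b D (fun u => R (u 0) (u 1)) & forall y, X y <-> R c y.
Proof.
case=> f Lf H; exists (fun c' y => holds (pre (c' :: D) (fun=> y)) f) => [|y]; last first.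
  exact: (H (fun=> y)).
pose r k := if k is j.+1 then (if j < size D then j else (size D).+1) else size D.
apply: (@DefO_FO b D (fun s v => holds (fun k => v (r k)) f)).
  by apply: (@FO_holds _ _ _ _ r).
move=> u; apply: holds_ext => -[|k] _; rewrite pre_cons /r /=.
  by have := pre_size D u 0; rewrite addn0 => ->.
case: ltnP => kD; first by rewrite !(pre_lt (u 0)).
have := pre_size D u 1; rewrite addn1 => ->.
by rewrite -(subnKC kD) pre_size.
Qed.

End Definability.

Arguments DefO {I ar K}.

Section Tame.
Local Open Scope classical_set_scope.
Variables (I : Type) (ar : I -> nat) (ltf opf : formula (ar_P ar)).
Variable K : Str ar.
Local Notation lt := (@slt _ ar ltf K).

(** What is kept of o-minimality, density and independence. Every clause but saturation amounts to
    first-order sentences, one for each formula where definable sets occur, and so passes to an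
    ultrapower by Los's theorem. *)
Record tame : Prop := Tame {
  tame_irr : forall x, ~ lt x x;
  tame_trans : forall x y z, lt x y -> lt y z -> lt x z;
  tame_dense : forall x y, lt x y -> exists p : K, [/\ sP p, lt x p & lt p y];
  tame_nontriv : exists x y, lt x y;
  tame_op : forall c x y, lt x y -> exists x' y', lt x' y' /\
    forall z, lt x' z -> lt z y' -> exists w, [/\ sop opf c z w, lt x w & lt w y];
  tame_op3 : forall x y z z', sop opf x y z -> sop opf x y z' -> z = z' :> K;
  tame_op2 : forall x y y' z, sop opf x y z -> sop opf x y' z -> y = y' :> K;
  tame_op1 : forall x x' y z, sop opf x y z -> sop opf x' y z -> x = x' :> K;
  tame_bigcup : forall D (Y : K -> Prop) (X : K -> K -> Prop),
    DefO true D (fun u => Y (u 0)) -> DefO true D (fun u => X (u 0) (u 1)) ->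
    small ltf Y -> (forall c, Y c -> small ltf (X c)) ->
    small ltf (fun y => exists c, Y c /\ X c y);
  tame_swap : forall D (R : K -> K -> Prop), DefO true D (fun u => R (u 0) (u 1)) ->
    (forall x, small ltf (R x)) -> small ltf (fun y => ~ small ltf (fun x => R x y));
  tame_indep : forall D p (X : K -> Prop), (forall q, q \in D -> sP q) -> sP p ->
    p \notin D -> DefO true D (fun u => X (u 0)) -> small ltf X -> ~ X p;
  tame_sat : forall (Sg : formula (ar_P ar) -> Prop) (fix_ : nat -> bool) (v : nat -> K),
    (forall l : list (formula (ar_P ar)), (forall f, List.In f l -> Sg f) ->
     exists v', (forall k, fix_ k -> v' k = v k) /\ forall f, List.In f l -> holds v' f) ->
    exists v', (forall k, fix_ k -> v' k = v k) /\ forall f, Sg f -> holds v' f }.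

End Tame.

Section Closure.
Local Open Scope classical_set_scope.
Variables (I : Type) (ar : I -> nat) (ltf opf : formula (ar_P ar)).
Hypotheses (Lltf : isL ltf) (Lopf : isL opf).
Variable K : Str ar.
Hypothesis tK : tame ltf opf K.
Local Notation lt := (@slt _ ar ltf K).
Local Notation P := (@sP _ ar K : set K).
Local Notation small := (small ltf).

(** Plays the role of the algebraic closure for L, with smallness in place of finiteness. *)
Definition cl (B : set K) : set K := [set b | exists (D : seq K) (X : K -> Prop),
  [/\ forall y, y \in D -> B y, DefO true D (fun u => X (u 0)), small X & X b]].

Lemma dense_P_avoid (F : seq K) x y : lt x y -> exists p, [/\ P p, lt x p, lt p y & p \notin F].
Proof.
elim: F x y => [|a F IH] x y xy.
  by have [p [Pp xp py]] := tame_dense tK xy; exists p.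
have [p [Pp xp py pF]] := IH _ _ xy.
case: (eqVneq p a) => [pa|npa]; last by exists p; split=> //; rewrite inE negb_or npa.
have [q [Pq xq qp qF]] := IH _ _ xp.
exists q; split=> //; first exact: (tame_trans tK) qp py.
rewrite inE negb_or qF andbT; apply/eqP => qa.
by apply: (@tame_irr _ _ _ _ _ tK p); rewrite {1}pa -qa.
Qed.

Lemma small_set1 (x : K) : small (eq^~ x).
Proof.
move=> [a [b [ab H]]]; have [p [_ ap pb]] := dense_P_avoid [:: x] ab.
by rewrite inE => /eqP; apply; apply: H.
Qed.

Lemma small_subset (X Y : K -> Prop) : (forall x, X x -> Y x) -> small Y -> small X.
Proof.
move=> H nY [a [b [ab Hab]]]; apply: nY; exists a, b; split=> // x ax xb.
exact/H/Hab.
Qed.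

Lemma notsmall_P (X : K -> Prop) (F : seq K) : ~ small X -> exists p, [/\ P p, X p & p \notin F].
Proof.
move=> /contrapT[a [b [ab H]]]; have [p [Pp ap pb pF]] := dense_P_avoid F ab.
by exists p; split=> //; apply: H.
Qed.

Lemma cl_mono A B : A `<=` B -> cl A `<=` cl B.
Proof. by move=> AB x [D [X [DA]]]; exists D, X; split=> // y /DA/AB. Qed.

Lemma cl_def1 (B : set K) D (X : K -> Prop) x : (forall y, y \in D -> B y) ->
  DefO true D (fun u => X (u 0)) -> X x -> (forall y, X y -> y = x) -> cl B x.
Proof.
move=> DB DX Xx uX; exists D, X; split=> //.
exact (@small_subset X (eq^~ x) uX (@small_set1 x)).
Qed.

Lemma cl_ext B : B `<=` cl B.
Proof.
move=> x Bx; apply: (@cl_def1 B [:: x] (eq^~ x)) => //; first by move=> y; rewrite inE => /eqP->.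
apply: (@DefO_FO _ _ _ true [:: x] (fun s u => u 1 = u 0)); first exact: FO_eq.
by move=> u; rewrite pre_cons /= pre_nil.
Qed.

Lemma cl_fin A x : cl A x -> exists l : seq K, (forall y, y \in l -> A y) /\ cl [set` l] x.
Proof. by move=> [D [X [DA H1 H2 H3]]]; exists D; split=> //; exists D, X; split. Qed.

Lemma cl_trans A B : A `<=` cl B -> cl A `<=` cl B.
Proof.
move=> AB x [D [X [DA DX sX Xx]]].
have {DA}DB y : y \in D -> cl B y by move=> /DA/AB.
suff H (D0 : seq K) : (forall y, y \in D0 -> B y) -> DefO true (D ++ D0) (fun u => X (u 0)) -> cl B x.
  by apply: (H [::]) => //; rewrite cats0.
elim: D DB D0 X Xx sX {DX} => [|c D IH] DB D0 X Xx sX D0B DX; first by exists D0, X.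
have [D1 [Y [D1B DY sY Yc]]] := DB c (mem_head _ _).
have [R DR XR] := DefO_head DX.
(* The parameter c is replaced by all candidates c' in a small set defined over B. Restricting to
   those with a small fibre, a definable condition that c satisfies, keeps the union small. *)
pose Y' c' := Y c' /\ small (R c').
apply: (IH _ (D0 ++ D1) (fun y => exists c', Y' c' /\ R c' y)).
- by move=> y yD; apply: DB; rewrite inE yD orbT.
- exists c; split; last exact/XR.
  by split=> //; apply: small_subset sX => y /XR.
- apply: (@tame_bigcup _ _ _ _ _ tK (D ++ D0 ++ D1)) => [|||c' []//].
  + apply: DefO_and; first by apply: DefO_sub DY => y yD1; rewrite !mem_cat yD1 !orbT.
    apply: DefO_small => //; apply: DefO_sub; last exact: (DefO_rename (fun k => if k is 0 then 1 else 0) DR).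
    by move=> y; rewrite catA mem_cat => ->.
  + by apply: DefO_sub DR => y; rewrite catA mem_cat => ->.
  + by apply: small_subset sY => y [].
- by move=> y; rewrite mem_cat => /orP[/D0B|/D1B].
- rewrite catA; apply: DefO_ex; apply: DefO_and.
    apply: DefO_and; first by apply: DefO_sub DY => y yD1; rewrite mem_cat yD1 orbT.
    apply: DefO_small => //; apply: DefO_sub; last exact: (DefO_rename (fun k => if k is 0 then 1 else 0) DR).
    by move=> y; rewrite mem_cat => ->.
  by apply: DefO_sub; [|exact: DR]; move=> y; rewrite mem_cat => ->.
Qed.

Lemma cl_exch A a b : cl (A `|` [set a]) b -> ~ cl A b -> cl (A `|` [set b]) a.
Proof.
move=> [D [X [DA DX sX Xb]]] nb.
pose D' := [seq y <- D | y != a].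
have D'A y : y \in D' -> A y.
  by rewrite mem_filter => /andP[/eqP ya /DA[]].
have {}DX : DefO true (a :: D') (fun u => X (u 0)).
  by apply: DefO_sub DX => y yD; rewrite inE mem_filter yD andbT; case: eqP.
have [R DR XR] := DefO_head DX.
pose R' c y := R c y /\ small (R c).
have DR' : DefO true D' (fun u => R' (u 0) (u 1)).
  apply: DefO_and => //; apply: DefO_small => //.
  exact: (DefO_rename (fun k => if k is 0 then 1 else 0) DR).
have sRa : small (R a) by apply: small_subset sX => y /XR.
(* Either the c related to b form a small set, which puts a in the closure through b, or b belongs
   to the set of points with a large fibre. The latter set is small by [tame_swap] and is defined
   without a, contrary to [nb]. *)
case: (pselect (small (fun c => R' c b))) => sb; last first.
  case: nb; exists D', (fun y => ~ small (fun c => R' c y)); split=> //.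
    apply: DefO_not; apply: DefO_small => //.
  apply: (tame_swap tK DR') => x; case: (pselect (small (R x))) => sx.
    by apply: small_subset sx => y [].
  by apply: (@small_subset _ (eq^~ x)); [move=> y [_ /sx]|exact: small_set1].
exists (b :: D'), (fun c => R' c b); split=> //.
- by move=> y; rewrite inE => /orP[/eqP->|/D'A]; [right|left].
- apply: (@DefO_subst _ _ _ _ _ _ _ (fun u k => if k is 0 then u 0 else b) DR') => [y yD|[|k]].
  + by rewrite inE yD orbT.
  + by left; exists 0.
  + by right; exists b; rewrite ?mem_head.
- by split=> //; apply/XR.
Qed.

Lemma cl_pregeom : pregeom cl.
Proof.
by split; [exact: cl_mono|exact: cl_ext|exact: cl_fin|exact: cl_trans|exact: cl_exch].
Qed.

End Closure.

(** * Open sets and codensity *)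

Section Model.
Local Open Scope classical_set_scope.
Variables (I : Type) (ar : I -> nat) (ltf opf : formula (ar_P ar)).
Hypotheses (Lltf : isL ltf) (Lopf : isL opf).
Variable K : Str ar.
Hypothesis tK : tame ltf opf K.
Local Notation lt := (@slt _ ar ltf K).
Local Notation P := (@sP _ ar K : set K).
Local Notation small := (small ltf).
Local Notation cl := (@cl _ ar ltf K).
Local Notation rk := (rk cl).
Local Notation supp := (supp cl P).
Local Notation pg := (cl_pregeom Lltf tK).

Lemma supp0 : supp set0 = set0.
Proof.
apply/seteqP; split=> // p [Pp [D [X [DP DX sX Xp]]]].
apply: (tame_indep tK (D := D) _ Pp _ DX sX Xp) => [q /DP[]//[]//|].
by apply/negP => /DP[]// [_ /=].
Qed.

Lemma supp_list (D : seq K) : exists t : seq K, [set` t] = supp [set` D].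
Proof.
have [t _ Ht] := supp_fin pg P set0 D; rewrite set0U supp0 set0U in Ht.
exists [seq p <- t | `[< supp [set` D] p >]]; apply/seteqP; split=> p /=.
  by rewrite mem_filter => /andP[/asboolP].
by move=> sp; rewrite mem_filter; apply/andP; split; [apply/asboolP|apply: Ht].
Qed.

Lemma cl_op (x y z : K) : sop opf x y z ->
  [/\ cl [set` [:: x; y]] z, cl [set` [:: x; z]] y & cl [set` [:: y; z]] x].
Proof.
move=> xyz; split.
- apply: (@cl_def1 _ _ _ _ _ tK _ [:: x; y] (fun z => sop opf x y z)) => // [|z'].
    by apply: (DefO_FO (FO_op Lopf true 0 1 2)) => u; rewrite !pre_cons pre_nil.
  by move/(tame_op3 tK xyz).
- apply: (@cl_def1 _ _ _ _ _ tK _ [:: x; z] (fun y => sop opf x y z)) => // [|y'].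
    by apply: (DefO_FO (FO_op Lopf true 0 2 1)) => u; rewrite !pre_cons pre_nil.
  by move/(tame_op2 tK xyz).
- apply: (@cl_def1 _ _ _ _ _ tK _ [:: y; z] (fun x => sop opf x y z)) => // [|x'].
    by apply: (DefO_FO (FO_op Lopf true 2 0 1)) => u; rewrite !pre_cons pre_nil.
  by move/(tame_op1 tK xyz).
Qed.

Fixpoint isprod (ps : seq K) (x : K) : Prop :=
  match ps with
  | [::] => False
  | [:: p] => x = p
  | p :: ps' => exists2 y, isprod ps' y & sop opf p y x
  end.

(** By [tame_op] the values of a left translation on a suitable interval fall into (a, b), so
    density of P propagates from products of m factors to products of one factor more. *)
Lemma isprod_ex m (F : seq K) a b : lt a b -> exists ps x,
  [/\ size ps = m.+1, uniq ps, forall p, p \in ps -> P p /\ p \notin F,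
      isprod ps x & lt a x /\ lt x b].
Proof.
elim: m F a b => [|m IH] F a b ab.
  have [p [Pp ap pb pF]] := dense_P_avoid tK F ab; exists [:: p], p; split=> // q.
  by rewrite inE => /eqP->.
have [p [Pp _ _ pF]] := dense_P_avoid tK F ab.
have [a' [b' [ab' H]]] := tame_op tK p ab.
have [ps [y [sz us HP Hy [ay yb]]]] := IH (p :: F) _ _ ab'.
have [x [pyx ax xb]] := H _ ay yb.
exists (p :: ps), x; split=> //=; first by rewrite sz.
- by rewrite us andbT; apply/negP => /HP[_]; rewrite mem_head.
- move=> q; rewrite inE => /orP[/eqP->//|/HP[Pq]].
  by rewrite inE negb_or => /andP[].
- by case: ps sz Hy {us HP} => // p' ps _ Hy; exists y.
Qed.

Lemma isprod_cl ps x : isprod ps x -> cl [set` ps] x.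
Proof.
elim: ps x => // p [|p' ps] IH x; first by move=> ->; apply: (pg_ext pg); rewrite /= mem_head.
case=> y /IH cy /cl_op[cx _ _]; apply: (pg_trans pg) cx => z; rewrite /= !inE.
case/orP=> /eqP->; first by apply: (pg_ext pg); rewrite /= mem_head.
by apply: (pg_mono pg) cy => u /= ups; rewrite inE ups orbT.
Qed.

(** A product equation can be solved for any one factor; distinctness keeps p off the list of the
    others. *)
Lemma isprod_exch ps x p : uniq ps -> isprod ps x -> p \in ps ->
  cl ([set q | q \in ps /\ q <> p] `|` [set x]) p.
Proof.
elim: ps x => // p1 [|p2 ps] IH x us.
  by move=> ->; rewrite inE => /eqP->; apply: (pg_ext pg); right.
case=> y Hy /cl_op[_ cy c1]; rewrite inE => /orP[/eqP->|pps].
  apply: (pg_trans pg) c1 => z; rewrite /= !inE => /orP[]/eqP->; last by apply: (pg_ext pg); right.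
  apply: (pg_mono pg) (@isprod_cl (p2 :: ps) y Hy) => q qps; left; split; first by rewrite inE qps orbT.
  by move=> E; move: us; rewrite -E => /andP[/negP].
have := IH y (andP us).2 Hy pps.
apply: (pg_trans pg) => z [[zps zp]|->].
  by apply: (pg_ext pg); left; split=> //; rewrite inE zps orbT.
apply: (pg_mono pg) cy => q; rewrite /= !inE => /orP[]/eqP->; last by right.
left; split; first by rewrite ?inE eqxx.
by move=> E; move: us; rewrite E => /andP[/negP].
Qed.

(* A product of k+1 elements of P off the support of D has these elements in
   its own support over D, so it is not generated by k elements of P. *)
Lemma codense (D : seq K) k (X : K -> Prop) : ~ small X ->
  exists2 y, X y & forall q : seq K, size q <= k -> (forall p, p \in q -> P p) ->
    ~ cl ([set` D] `|` [set` q]) y.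
Proof.
move=> /contrapT[a [b [ab Hab]]]; have [t Ht] := supp_list D.
have [ps [x [sz us HP Hx [ax xb]]]] := isprod_ex k t ab.
exists x => [|q qk qP cx]; first exact: Hab.
have [p pps pq] : exists2 p, p \in ps & p \notin q.
  apply: contrapT => /forall2NP H; suff : size ps <= size q by rewrite sz leqNgt ltnS qk.
  by apply: uniq_leq_size => // p pps; case: (H p) => // /negP; rewrite negbK.
have [Pp] := HP _ pps; apply/negP; rewrite negbK.
suff : supp [set` D] p by rewrite -Ht.
split=> //; apply: (pg_trans pg) (isprod_exch us Hx pps) => z [[zps zp]|->].
  by apply: (pg_ext pg); right; split=> //; case: (HP _ zps).
apply: (pg_mono pg) cx => y [|yq]; [by left|right; split; first exact: qP].
by move=> /= E; rewrite -E yq in pq.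
Qed.

(** Openness in the logic topology: a union of sets definable without parameters. Dependence and low
    rank are open, independence is not. An open condition is preserved by elementary maps
    ([elem_open]), and where it holds a definable neighbourhood is available to compactness. *)
Definition isopen (b : bool) (R : (nat -> K) -> Prop) : Prop :=
  forall u, R u -> exists2 Q : forall s : Str ar, (nat -> s) -> Prop,
    FO b Q & Q K u /\ forall u', Q K u' -> R u'.

Lemma open_FO b (Q : forall s : Str ar, (nat -> s) -> Prop) :
  FO b Q -> isopen b (fun u => Q K u).
Proof. by move=> FQ u Qu; exists Q. Qed.

Lemma open_and b R R' : isopen b R -> isopen b R' -> isopen b (fun u => R u /\ R' u).
Proof.
move=> H H' u [/H[Q FQ [Qu HQ]] /H'[Q' FQ' [Qu' HQ']]].
exists (fun s v => Q s v /\ Q' s v); first exact: FO_and.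
by split=> // v [/HQ ? /HQ'].
Qed.

Lemma open_or b R R' : isopen b R -> isopen b R' -> isopen b (fun u => R u \/ R' u).
Proof.
move=> H H' u [/H[Q FQ [Qu HQ]]|/H'[Q FQ [Qu HQ]]]; exists Q => //; split=> // v /HQ.
  by left.
by right.
Qed.

Lemma open_weak b R : isopen b R -> isopen false R.
Proof. by move=> H u /H[Q FQ HQ]; exists Q => //; apply: FO_weak FQ. Qed.

Lemma open_eqv b R R' : (forall u, R u <-> R' u) -> isopen b R -> isopen b R'.
Proof.
move=> E H u /E/H[Q FQ [Qu HQ]]; exists Q => //; split=> // v /HQ.
by move/E.
Qed.

Definition vals (J : nat -> Prop) (u : nat -> K) : set K := [set y | exists2 i, J i & y = u i].

(** The formula witnessing the dependence is conjoined with the smallness of the set it defines,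
    which is first-order, so every other valuation that satisfies both has the same dependence. *)
Lemma open_cl (J : nat -> Prop) x : isopen true (fun u => cl (vals J u) (u x)).
Proof.
move=> u [D [X [DJ [f Lf Hf] sX Xx]]].
have [js Jjs Djs] : exists2 js : seq nat, (forall j, j \in js -> J j) & D = map u js.
  elim: (D) DJ => [|d D0 IH] H; first by exists [::].
  have [js Jjs ->] := IH (fun y yD => H y (mem_behead (s := d :: D0) yD)).
  have [j Jj ->] := H d (mem_head _ _); exists (j :: js) => // i.
  by rewrite inE => /orP[/eqP->|/Jjs].
pose r (y : nat) k := nth y js k.
have E s (v : nat -> s) (y : nat) : pre (map v js) (fun=> v y) = (fun k => v (r y k)).
  apply/funext => k; rewrite /pre /r; case: (ltnP k (size js)) => kj.
    by rewrite (nth_map y).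
  by rewrite !nth_default ?size_map.
exists (fun s v => small (fun y => holds (pre (map v js) (fun=> y)) f) /\
   holds (pre (map v js) (fun=> v x)) f).
  apply: FO_and.
    apply: FO_small => //.
    apply: (@FO_holds _ _ _ _ (fun k => if k < size js then (nth 0 js k).+1 else 0)) => // s v k.
    rewrite /pre; case: ltnP => kj; first by rewrite (nth_map 0).
    by rewrite nth_default ?size_map.
  by apply: (@FO_holds _ _ _ _ (r x)) => // s v k; rewrite E.
have EX y : X y <-> holds (pre (map u js) (fun=> y)) f by rewrite -Djs (Hf (fun=> y)).
split=> [|v [sv Hv]].
  by split; [apply: small_subset sX => y /EX|apply/EX].
exists (map v js), (fun y => holds (pre (map v js) (fun=> y)) f); split=> //.
  by move=> y /mapP[j /Jjs Jj ->]; exists j.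
apply: (@DefO_FO _ _ _ _ _ (fun s w => holds (fun k => w (if k < size js then k else size js)) f)).
  by apply: (@FO_holds _ _ _ _ (fun k => if k < size js then k else size js)).
move=> w; apply: holds_ext => k _; case: ltnP => kj.
  by rewrite !(pre_lt (w 0)) ?size_map.
rewrite -(size_map v) in kj *; rewrite -(subnKC kj) pre_size.
by have := pre_size (map v js) w 0; rewrite addn0 => ->.
Qed.

Lemma vals_or J j u : vals (fun i => J i \/ i = j) u = vals J u `|` [set u j].
Proof.
apply/seteqP; split=> y; first by case=> i [Ji|->] ->; [left; exists i|right].
by case=> [[i Ji ->]|->]; [exists i => //; left|exists j => //; right].
Qed.

Lemma open_rk (J : nat -> Prop) (js : seq nat) d :
  isopen true (fun u => rk (vals J u) (map u js) < d).
Proof.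
elim: js J d => [|j js IH] J d /=.
  by case: d => [|d] u //= _; exists (fun _ _ => True); [apply: FO_True|].
apply: (@open_eqv _ (fun u => (cl (vals J u) (u j) /\ rk (vals (fun i => J i \/ i = j) u) (map u js) < d)
    \/ rk (vals (fun i => J i \/ i = j) u) (map u js) < d.-1)).
  move=> u; rewrite vals_or; case: asboolP => cj /=; rewrite ?add0n ?add1n.
    split=> [[[]//|]|H]; last by left.
    by move=> H; apply: leq_trans H (leq_pred d).
  split=> [[[]//|]|H]; first by case: d.
  by right; case: d H.
by apply: open_or => //; apply: open_and => //; apply: open_cl.
Qed.

Lemma open_exP b R : isopen b R -> isopen false (fun u => exists2 p, P p & R (scons p u)).
Proof.
move=> H u [p Pp /H[Q FQ [Qu HQ]]].
exists (fun (s : Str ar) v => exists a : s, sP a /\ Q s (scons a v)).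
  apply: FO_ex; apply: FO_and; first exact: FO_P.
  by apply: (@FO_subst _ _ _ _ (fun k => k)); [move=> s w []|apply: FO_weak FQ].
by split=> [|v [a [Pa /HQ]]]; [exists p|exists a].
Qed.

Lemma open_exPn b R k : isopen b R ->
  isopen false (fun u => exists q : seq K, [/\ size q = k, forall p, p \in q -> P p & R (pre q u)]).
Proof.
move=> H; elim: k => [|k IH].
  apply: open_eqv (open_weak H) => u; split=> [Ru|[q [/size0nil-> _]]].
    by exists [::]; rewrite pre_nil.
  by rewrite pre_nil.
apply: (@open_eqv _ (fun u => exists2 p, P p & exists q : seq K, [/\ size q = k,
   forall p, p \in q -> P p & R (pre q (scons p u))])); last exact: (open_exP IH).
move=> u; split=> [[p Pp [q [sq qP Rq]]]|[q [sq qP Rq]]].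
  exists (q ++ [:: p]); rewrite pre_cat pre_cons pre_nil size_cat sq addn1; split=> // p'.
  by rewrite mem_cat inE => /orP[/qP|/eqP->].
case/lastP: q sq qP Rq => // q p; rewrite size_rcons -cats1 => -[sq] qP Rq.
exists p; first by apply: qP; rewrite mem_cat mem_head orbT.
exists q; split=> //; first by move=> p' p'q; apply: qP; rewrite mem_cat p'q.
by move: Rq; rewrite pre_cat pre_cons pre_nil.
Qed.

Definition shiftJ (k : nat) (J : nat -> Prop) (i : nat) : Prop :=
  i < k \/ exists2 j, J j & i = k + j.

Lemma vals_pre (J : nat -> Prop) (q : seq K) u :
  vals (shiftJ (size q) J) (pre q u) = vals J u `|` [set` q].
Proof.
apply/seteqP; split=> y.
  case=> i [iq|[j Jj ->]] ->; last by left; exists j; rewrite ?pre_size.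
  by right; rewrite /= (pre_lt (u 0)) // mem_nth.
case=> [[j Jj ->]|/= yq]; first by exists (size q + j); [right; exists j|rewrite pre_size].
by exists (index y q); [left; rewrite index_mem|rewrite (pre_lt y) ?index_mem // nth_index].
Qed.

Lemma open_rkPn (J : nat -> Prop) (js : seq nat) d k :
  isopen false (fun u => exists q : seq K, [/\ size q = k, forall p, p \in q -> P p &
     rk (vals J u `|` [set` q]) (map u js) < d]).
Proof.
have H := @open_exPn _ _ k (@open_rk (shiftJ k J) (map (addn k) js) d).
apply: (open_eqv _ H) => u {H}.
have E q : size q = k -> map (pre q u) (map (addn k) js) = map u js.
  by move=> <-; rewrite -map_comp; apply: eq_map => j /=; rewrite pre_size.
by split=> -[q [sq qP H]]; exists q; split=> //; move: H; rewrite -{1}sq vals_pre (E _ sq).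
Qed.

End Model.

(** * Elementary maps *)

Section ElementaryMaps.
Local Open Scope classical_set_scope.
Variables (I : Type) (ar : I -> nat) (ltf opf : formula (ar_P ar)).
Hypotheses (Lltf : isL ltf) (Lopf : isL opf).
Variable K : Str ar.
Hypothesis tK : tame ltf opf K.
Local Notation fm := (formula (ar_P ar)).
Local Notation lt := (@slt _ ar ltf K).
Local Notation P := (@sP _ ar K : set K).
Local Notation small := (small ltf).
Local Notation cl := (@cl _ ar ltf K).
Local Notation rk := (rk cl).
Local Notation supp := (supp cl P).
Local Notation pg := (cl_pregeom Lltf tK).

Lemma sat_directed (QQ : ((nat -> K) -> Prop) -> Prop) (fx : nat -> bool) (v : nat -> K) :
  (forall Q, QQ Q -> DefO false [::] Q) -> (exists Q, QQ Q) ->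
  (forall Q1 Q2, QQ Q1 -> QQ Q2 -> exists2 Q3, QQ Q3 & forall u, Q3 u -> Q1 u /\ Q2 u) ->
  (forall Q, QQ Q -> exists2 v', forall k, fx k -> v' k = v k & Q v') ->
  exists2 v', forall k, fx k -> v' k = v k & forall Q, QQ Q -> Q v'.
Proof.
move=> QD [Q0 QQ0] dir fsat.
pose Sg (f : fm) := exists2 Q, QQ Q & forall u, Q u <-> holds u f.
have [|v' [fv' Hv']] := tame_sat tK (Sg := Sg) (fix_ := fx) (v := v); last first.
  exists v' => // Q QQQ; have [f _ Hf] := QD _ QQQ.
  by apply/Hf; rewrite pre_nil; apply: Hv'; exists Q => // u; rewrite Hf pre_nil.
move=> l Hl.
have [Q QQQ HQ] : exists2 Q, QQ Q & forall f u, List.In f l -> Q u -> holds u f.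
  elim: l Hl => [|f l IH] Hl; first by exists Q0.
  have [Q1 QQ1 H1] := IH (fun g Hg => Hl g (or_intror Hg)).
  have [Q2 QQ2 H2] := Hl f (or_introl erefl).
  have [Q3 QQ3 H3] := dir _ _ QQ1 QQ2; exists Q3 => // g u [<-|gl] /H3[q1 q2].
    exact/H2.
  exact: H1.
by have [v' fv' Qv'] := fsat _ QQQ; exists v'; split=> // f fl; apply: HQ Qv'.
Qed.

Definition doms (E : seq (K * K)) : set K := [set` map fst E].
Definition rans (E : seq (K * K)) : set K := [set` map snd E].
Definition swap (E : seq (K * K)) : seq (K * K) := map (fun e => (e.2, e.1)) E.

Lemma mem_swap E x y : ((x, y) \in swap E) = ((y, x) \in E).
Proof.
have inj : injective (fun e : K * K => (e.2, e.1)) by move=> [a b] [c d] [-> ->].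
exact: (mem_map inj E (y, x)).
Qed.

Lemma doms_swap E : doms (swap E) = rans E.
Proof. by rewrite /doms /swap -map_comp. Qed.

Lemma rans_swap E : rans (swap E) = doms E.
Proof. by rewrite /rans /swap -map_comp. Qed.

Lemma mem_doms E x y : (x, y) \in E -> doms E x.
Proof. by move=> H; apply/mapP; exists (x, y). Qed.

Lemma mem_rans E x y : (x, y) \in E -> rans E y.
Proof. by move=> H; apply/mapP; exists (x, y). Qed.

Lemma doms_ex E x : doms E x -> exists y, (x, y) \in E.
Proof. by case/mapP => -[x' y] H ->; exists y. Qed.

Lemma rans_ex E y : rans E y -> exists x, (x, y) \in E.
Proof. by case/mapP => -[x y'] H ->; exists x. Qed.

Lemma doms_cons E x y : doms ((x, y) :: E) = doms E `|` [set x].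
Proof. by rewrite /doms /= -[LHS]set0U setU_cons set0U setUC. Qed.

Lemma rans_cons E x y : rans ((x, y) :: E) = rans E `|` [set y].
Proof. by rewrite /rans /= -[LHS]set0U setU_cons set0U setUC. Qed.

Definition elem (b : bool) (E : seq (K * K)) : Prop :=
  forall f : fm, b ==> isL f -> forall v : nat -> K * K, (forall k, v k \in E) ->
  holds (fun k => (v k).1) f <-> holds (fun k => (v k).2) f.

Lemma elem_FO b E (Q : forall s : Str ar, (nat -> s) -> Prop) (v : nat -> K * K) :
  elem b E -> FO b Q -> (forall k, v k \in E) ->
  Q K (fun k => (v k).1) <-> Q K (fun k => (v k).2).
Proof. by move=> EE [f Lf H] vE; rewrite !H; apply: EE. Qed.

Lemma elem_open b E R (v : nat -> K * K) :
  elem b E -> isopen b R -> (forall k, v k \in E) ->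
  R (fun k => (v k).1) -> R (fun k => (v k).2).
Proof. by move=> EE OR vE /OR[Q FQ [/(elem_FO EE FQ vE) Q2]]; apply. Qed.

Lemma elem_swap b E : elem b E -> elem b (swap E).
Proof.
move=> EE f Lf v vE; symmetry; apply: (EE f Lf (fun k => ((v k).2, (v k).1))) => k.
by rewrite -mem_swap; case: (v k) (vE k).
Qed.

Lemma elem_eq b E x y y' : elem b E -> (x, y) \in E -> (x, y') \in E -> y = y'.
Proof.
move=> EE H H'.
have := @elem_FO b E _ (fun k => if k is 0 then (x, y) else (x, y')) EE (FO_eq ar b 0 1).
by case=> [[]//|/(_ erefl)].
Qed.

Lemma elem_cons e0 E z z' : e0 \in E ->
  (forall f : fm, isL f -> holds (scons z (fun k => (nth e0 E k).1)) f ->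
               holds (scons z' (fun k => (nth e0 E k).2)) f) ->
  elem true ((z, z') :: E).
Proof.
move=> e0E H f /= Lf v vE.
have {}H (g : fm) : isL g -> holds (scons z (fun k => (nth e0 E k).1)) g <->
               holds (scons z' (fun k => (nth e0 E k).2)) g.
  move=> Lg; split; first exact: H.
  by move=> H2; apply: contrapT => H1; apply: (H (FNot g)) H2.
pose r k := if v k == (z, z') then 0 else (index (v k) E).+1.
have E1 k : v k = scons (z, z') (nth e0 E) (r k).
  rewrite /r; case: eqP => [//|ne] /=; rewrite nth_index //.
  by have := vE k; rewrite inE => /orP[/eqP|].
have := H (ren r f); rewrite isL_ren => /(_ Lf); rewrite !holds_ren.
have -> : (fun k => scons z (fun k => (nth e0 E k).1) (r k)) = (fun k => (v k).1).
  by apply/funext => k; rewrite E1; case: (r k).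
have -> // : (fun k => scons z' (fun k => (nth e0 E k).2) (r k)) = (fun k => (v k).2).
by apply/funext => k; rewrite E1; case: (r k).
Qed.

Lemma nth_in (T : eqType) (e0 : T) E k : e0 \in E -> nth e0 E k \in E.
Proof. by move=> e0E; case: (ltnP k (size E)) => kE; [apply: mem_nth|rewrite nth_default]. Qed.

(** Looks for an image of z realizing the transported L-type together with extra conditions over W,
    which may mention P. Directedness of [CC] reduces finite satisfiability to one formula and one
    condition. *)
Lemma realize e0 E z (W : seq K) (CC : (K -> Prop) -> Prop) : e0 \in E ->
  (forall C, CC C -> DefO false W (fun u => C (u 0))) -> (exists C, CC C) ->
  (forall C1 C2, CC C1 -> CC C2 -> exists2 C3, CC C3 & forall y, C3 y -> C1 y /\ C2 y) ->
  (forall (f : fm) C, isL f -> CC C -> holds (scons z (fun k => (nth e0 E k).1)) f ->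
     exists2 y, C y & holds (scons y (fun k => (nth e0 E k).2)) f) ->
  exists2 z', elem true ((z, z') :: E) & forall C, CC C -> C z'.
Proof.
move=> e0E CD [C0 CC0] dir fsat.
pose w := pre W (fun k => (nth e0 E k).2).
(* One valuation is read in two ways. It lists the unknown, then W, then the range of E; [rf] skips
   W, while [rg] puts W in front of the unknown as [DefO] expects. *)
pose rf (u : nat -> K) := scons (u 0) (fun k => u (size W + k).+1).
pose rg (u : nat -> K) := pre (map (fun k => u k.+1) (iota 0 (size W))) (fun=> u 0).
have rgE (u : nat -> K) y : (forall k, 0 < k -> u k = scons y w k) -> rg u = pre W (fun=> u 0).
  move=> H; rewrite /rg; congr pre; apply: (@eq_from_nth _ (u 0)).
    by rewrite size_map size_iota.
  move=> k; rewrite size_map size_iota => kW; rewrite (nth_map 0) ?size_iota //.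
  by rewrite nth_iota // add0n H //= /w (pre_lt (u 0)).
have rfE (u : nat -> K) y : (forall k, 0 < k -> u k = scons y w k) ->
    rf u = scons (u 0) (fun k => (nth e0 E k).2).
  by move=> H; apply/funext => -[|k] //=; rewrite H //= /w pre_size.
pose QQ Q := exists (f g : fm) (C : K -> Prop),
  [/\ isL f, CC C /\ holds (scons z (fun k => (nth e0 E k).1)) f,
      forall u, C (u 0) <-> holds (pre W u) g &
      Q = fun u => holds (rf u) f /\ holds (rg u) g].
have [||Q1 Q2|Q|v' Hv' QQv'] := @sat_directed QQ (fun k => 0 < k) (scons z w).
- move=> Q [f [g [C [Lf _ _ ->]]]].
  pose rr k := if k < size W then k.+1 else 0.
  apply: (@DefO_FO _ _ _ _ _ (fun s u => holds (scons (u 0) (fun k => u (size W + k).+1)) f /\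
     holds (fun k => u (rr k)) g)).
    apply: FO_and; last exact: (@FO_holds _ _ _ _ rr).
    by apply: (@FO_holds _ _ _ _ (fun k => if k is k'.+1 then (size W + k').+1 else 0)) => // s u [].
  move=> u; rewrite pre_nil; have -> // : rg u = (fun k => u (rr k)).
  apply/funext => k; rewrite /rg /rr; case: ltnP => kW.
    by rewrite (pre_lt (u 0)) ?size_map ?size_iota // (nth_map 0) ?size_iota // nth_iota.
  by rewrite /pre nth_default // size_map size_iota.
- have [g _ Hg] := CD _ CC0.
  exists (fun u => holds (rf u) (FEq _ 0 0) /\ holds (rg u) g), (FEq _ 0 0), g, C0.
  by split.
- move=> [f1 [g1 [C1 [L1 [CC1 h1] H1 ->]]]] [f2 [g2 [C2 [L2 [CC2 h2] H2 ->]]]].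
  have [C3 CC3 H3] := dir _ _ CC1 CC2; have [g3 _ Hg3] := CD _ CC3.
  exists (fun u => holds (rf u) (FAnd f1 f2) /\ holds (rg u) (FAnd (FAnd g1 g2) g3)); last first.
    by move=> u [[? ?] [[? ?] ?]].
  exists (FAnd f1 f2), (FAnd (FAnd g1 g2) g3), C3; split=> //=; first by rewrite L1.
  move=> u; split=> [c3|[_ /Hg3//]].
  by have [/H1 ? /H2 ?] := H3 _ c3; split=> //; apply/Hg3.
- move=> [f [g [C [Lf [CCC hf] Hg ->]]]].
  have [y Cy hy] := fsat f C Lf CCC hf; exists (scons y w); first by case.
  have Hyw k : 0 < k -> scons y w k = scons y w k by [].
  by rewrite (rfE _ _ Hyw) (rgE _ _ Hyw); split=> //; apply/(Hg (fun=> y)).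
have {}QQv' f g C : isL f -> CC C -> holds (scons z (fun k => (nth e0 E k).1)) f ->
    (forall u, C (u 0) <-> holds (pre W u) g) ->
    holds (scons (v' 0) (fun k => (nth e0 E k).2)) f /\ C (v' 0).
  move=> Lf CCC hf Hg.
  have [|h1 h2] := QQv' (fun u => holds (rf u) f /\ holds (rg u) g).
    by exists f, g, C; split.
  rewrite (rfE _ _ Hv') in h1; rewrite (rgE _ _ Hv') in h2; split=> //.
  exact/(Hg (fun=> v' 0)).
exists (v' 0) => [|C CCC]; last first.
  by have [g _ Hg] := CD _ CCC; have [] := QQv' (FEq _ 0 0) g C isT CCC erefl Hg.
apply: (elem_cons e0E) => f Lf hf.
by have [g _ Hg] := CD _ CC0; have [] := QQv' f g C0 Lf CC0 hf Hg.
Qed.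

Definition nice (E : seq (K * K)) : Prop :=
  [/\ elem true E, forall x y, (x, y) \in E -> (P x <-> P y),
      supp (doms E) `<=` doms E & supp (rans E) `<=` rans E].

Lemma nice_swap E : nice E -> nice (swap E).
Proof.
move=> [EE EP Es Er]; split; first exact: elem_swap.
- by move=> x y; rewrite mem_swap => /EP ->.
- by rewrite doms_swap.
- by rewrite rans_swap.
Qed.

Lemma nice_id (D : seq K) : supp [set` D] `<=` [set` D] -> nice [seq (x, x) | x <- D].
Proof.
have Hd : doms [seq (x, x) | x <- D] = [set` D] by rewrite /doms -map_comp map_id.
have Hr : rans [seq (x, x) | x <- D] = [set` D] by rewrite /rans -map_comp map_id.
move=> sD; split; rewrite ?Hd ?Hr //.
  move=> f Lf v vE; suff -> : (fun k => (v k).1) = (fun k => (v k).2) by [].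
  by apply/funext => k; have /mapP[x _ ->] := vE k.
by move=> x y /mapP[a _ [-> ->]].
Qed.

Lemma elem_notsmall e0 E (f : fm) : e0 \in E -> elem true E -> isL f ->
  small (fun y => holds (scons y (fun k => (nth e0 E k).1)) f) <->
  small (fun y => holds (scons y (fun k => (nth e0 E k).2)) f).
Proof.
move=> e0E EE Lf.
apply: (@elem_FO true E (fun s v => small (fun y => holds (scons y v) f)) (nth e0 E) EE).
  apply: FO_small => //.
  by apply: (@FO_holds _ _ _ _ (fun k => k)) => // s u [].
by move=> k; apply: nth_in.
Qed.

Lemma def_doms e0 (E : seq (K * K)) (f : fm) : e0 \in E -> isL f ->
  DefO true (map fst E) (fun u => holds (scons (u 0) (fun k => (nth e0 E k).1)) f).
Proof.
move=> e0E Lf.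
have H : DefO true [::] (fun u : nat -> K => holds u f) by exists f => // u; rewrite pre_nil.
apply: (@DefO_subst _ _ _ _ _ _ _ (fun u => scons (u 0) (fun k => (nth e0 E k).1)) H) => // -[|k].
  by left; exists 0.
right; exists (nth e0 E k).1 => //; exact/map_f/nth_in.
Qed.

(** The domain contains its support, so p is not in its closure and no formula of its L-type over
    the domain defines a small set. The transported set then contains an interval and meets P
    outside the finite F. *)
Lemma step_P e0 E p (F : seq K) : e0 \in E -> nice E -> P p -> ~ doms E p ->
  exists2 p', nice ((p, p') :: E) & p' \notin F.
Proof.
move=> e0E [EE EP Ed Er] Pp npE.
pose CC (C : K -> Prop) := C = fun y => P y /\ y \notin F.
have [|||f C Lf -> hf|p' Ep' /(_ _ erefl)[Pp' p'F]] := @realize e0 E p F CC e0E.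
- move=> _ ->; apply: DefO_and; first exact: DefO_P.
  apply: (@DefO_eqv _ _ _ _ _ (fun u => forall t : 'I_(size F), u 0 <> tnth (in_tuple F) t)).
    move=> u; split=> [H|H t ut]; last by move: H; rewrite ut mem_tnth.
    by apply/negP => /(@tnthP _ _ (in_tuple F))[t ut]; apply: (H t).
  apply: DefO_all_fin => t; apply: DefO_not.
  have H : DefO false [::] (fun u : nat -> K => u 0 = u 1) by apply: DefO_eq.
  apply: (@DefO_subst _ _ _ _ _ _ _ (fun u k => if k is 0 then u 0 else tnth (in_tuple F) t) H) => // -[|k].
    by left; exists 0.
  by right; exists (tnth (in_tuple F) t) => //; apply: (mem_tnth t (in_tuple F)).
- by exists (fun y => P y /\ y \notin F).
- by move=> _ _ -> ->; exists (fun y => P y /\ y \notin F).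
- have : ~ small (fun y => holds (scons y (fun k => (nth e0 E k).2)) f).
    move=> /(elem_notsmall e0E EE Lf) sX; apply: npE; apply: Ed; split=> //.
    apply: (pg_mono pg) (_ : cl (doms E) p) => [y|]; first by left.
    exists (map fst E), (fun y => holds (scons y (fun k => (nth e0 E k).1)) f); split=> //.
    exact: def_doms.
  by move=> /(notsmall_P tK F)[y [Py Xy yF]]; exists y.
exists p' => //; split=> //.
- by move=> x y; rewrite inE => /orP[/eqP[-> ->]|/EP].
- rewrite doms_cons => q /(supp_UP pg)[y ->//|/Ed|]; [by left|by right].
- rewrite rans_cons => q /(supp_UP pg)[y ->//|/Er|]; [by left|by right].
Qed.

(** For a fixed k, the points generated over W by at most k elements of P do not exhaust any set
    that is not small ([codense]). Saturation avoids all k at once. *)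
Lemma step_new e0 E z (F : seq K) : e0 \in E -> nice E -> ~ cl (doms E `|` P) z ->
  exists2 z', nice ((z, z') :: E) & ~ cl (rans E `|` [set` F] `|` P) z'.
Proof.
move=> e0E [EE EP Ed Er] nz; pose W := map snd E ++ F.
have WE : rans E `|` [set` F] = [set` W].
  by apply/seteqP; split=> y; rewrite /W /= mem_cat => /orP.
pose bad k (Y : K -> Prop) := forall y, Y y -> exists q : seq K,
  [/\ size q <= k, forall p, p \in q -> P p & cl ([set` W] `|` [set` q]) y].
pose CC (C : K -> Prop) := exists k Y, [/\ DefO false W (fun u => Y (u 0)), bad k Y & C = fun y => ~ Y y].
have [|||f C Lf [k [Y [DY bY ->]]] hf|z' Ez' Hz'] := @realize e0 E z W CC e0E.
- by move=> C [k [Y [DY _ ->]]]; apply: DefO_not.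
- exists (fun y => ~ False), 0, (fun=> False); split=> //.
  exact: DefO_cst.
- move=> _ _ [k1 [Y1 [D1 b1 ->]]] [k2 [Y2 [D2 b2 ->]]].
  exists (fun y => ~ (Y1 y \/ Y2 y)); last by move=> y nY; split=> ?; apply: nY; [left|right].
  exists (maxn k1 k2), (fun y => Y1 y \/ Y2 y); split=> //; first exact: DefO_or.
  by move=> y [/b1|/b2] [q [sq qP cq]]; exists q; split=> //; rewrite leq_max sq ?orbT.
- have : ~ small (fun y => holds (scons y (fun k => (nth e0 E k).2)) f).
    move=> /(elem_notsmall e0E EE Lf) sX; apply: nz.
    apply: (pg_mono pg) (_ : cl (doms E) z) => [y|]; first by left.
    exists (map fst E), (fun y => holds (scons y (fun k => (nth e0 E k).1)) f); split=> //.
    exact: def_doms.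
  move=> /(codense Lltf Lopf tK W k)[y Xy Hy]; exists y => // /bY[q [sq qP]].
  exact: Hy.
(* If z' were dependent, [open_rkPn] would give a definable bad set containing it, whose complement
   is one of the conditions imposed on z'. *)
have nz' : ~ cl ([set` W] `|` P) z'.
  move=> /(cl_finU pg)[q [qP cq]]; pose u := scons z' (pre W (fun=> z')).
  pose J i := 0 < i <= size W.
  have JW y : vals J (scons y (pre W (fun=> y))) = [set` W].
    apply/seteqP; split=> x; first by case=> -[|i] // /andP[_ iW] ->; rewrite /= (pre_lt y) // mem_nth.
    move=> /= xW; exists (index x W).+1; first by rewrite /J /= index_mem.
    by rewrite /= (pre_lt x) ?index_mem // nth_index.
  have [|Q FQ [Qu HQ]] := @open_rkPn _ _ _ Lltf K J [:: 0] 1 (size q) u.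
    by exists q; split=> //; rewrite JW /= asboolT.
  apply: (Hz' (fun y => ~ Q K (scons y (pre W (fun=> y))))) Qu.
  exists (size q), (fun y => Q K (scons y (pre W (fun=> y)))); split=> //.
    have H : DefO false [::] (fun u => Q K u) by apply: DefO_nil.
    apply: (@DefO_subst _ _ _ _ _ _ _ (fun u => scons (u 0) (pre W (fun=> u 0))) H) => // -[|k].
      by left; exists 0.
    case: (ltnP k (size W)) => kW; last by left; exists 0 => w; rewrite /= /pre nth_default.
    right; exists (nth z' W k); first exact: mem_nth.
    by move=> w; rewrite /= (pre_lt z').
  move=> y /HQ[q' [sq' q'P]]; rewrite JW /=; case: asboolP => // cy _.
  by exists q'; split=> //; rewrite sq'.
exists z'; last by rewrite WE.
split=> //.
- have nPz : ~ P z by move=> Pz; apply: nz; apply: (pg_ext pg); right.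
  have nPz' : ~ P z' by move=> Pz; apply: nz'; apply: (pg_ext pg); right.
  by move=> x y; rewrite inE => /orP[/eqP[-> ->]|/EP].
- by rewrite doms_cons => q /(supp_new pg nz)/Ed; left.
- rewrite rans_cons => q; have /(supp_new pg) H : ~ cl (rans E `|` P) z'.
    move=> c; apply: nz'; apply: (pg_mono pg) c => y [yE|]; [left|by right].
    by rewrite -WE; left.
  by move=> /H/Er; left.
Qed.

(** Any realization of the transported type will do. It respects P because an element of P in the
    closure of the domain or range lies in the support, hence is there already. *)
Lemma step_cl e0 E z : e0 \in E -> nice E -> cl (doms E) z ->
  exists2 z', nice ((z, z') :: E) & cl (rans E) z'.
Proof.
move=> e0E [EE EP Ed Er] cz.
have [|||f C Lf CC hf|z' Ez' _] := @realize e0 E z [::] (fun C => C = fun=> True) e0E.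
- by move=> C ->; apply: DefO_cst.
- by exists (fun=> True).
- by move=> _ _ -> ->; exists (fun=> True).
- have : exists y, holds (scons y (fun k => (nth e0 E k).1)) f by exists z.
  have FQ : FO true (fun (s : Str ar) (v : nat -> s) => exists y, holds (scons y v) f).
    apply: FO_ex; by apply: (@FO_holds _ _ _ _ (fun k => k)) => // s u [].
  move=> /(elem_FO EE FQ (fun k => nth_in k e0E))[y hy].
  by exists y => //; rewrite CC.
have cz' : cl (rans E) z'.
  pose v k := if k is k'.+1 then nth e0 E k' else (z, z').
  have vE k : v k \in (z, z') :: E.
    by case: k => [|k]; rewrite inE ?eqxx //= nth_in ?orbT.
  have H1 : cl (vals (fun i => 0 < i) (fun k => (v k).1)) (v 0).1.
    apply: (pg_mono pg) cz => x /doms_ex[y xyE].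
    by exists (index (x, y) E).+1 => //=; rewrite nth_index.
  have H2 : cl (vals (fun i => 0 < i) (fun k => (v k).2)) (v 0).2.
    exact: (elem_open Ez' (@open_cl _ _ _ Lltf K (fun i => 0 < i) 0) vE H1).
  apply: (pg_mono pg) H2 => x.
  by case=> -[|i] //= _ ->; apply/map_f/nth_in.
exists z' => //; split=> //.
- move=> x y; rewrite inE => /orP[/eqP[-> ->]|/EP//]; split=> Pz.
    have [|y' yE] := @doms_ex E z.
      by apply: Ed; split=> //; apply: (pg_mono pg) cz => w; left.
    have -> : z' = y' by apply: (elem_eq Ez' (x := z)); rewrite inE ?eqxx ?yE ?orbT.
    exact/(EP _ _ yE).
  have [|x' xE] := @rans_ex E z'.
    by apply: Er; split=> //; apply: (pg_mono pg) cz' => w; left.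
  have -> : z = x'.
    by apply: (elem_eq (elem_swap Ez') (x := z')); rewrite mem_swap inE ?eqxx ?xE ?orbT.
  exact/(EP _ _ xE).
- rewrite doms_cons => q sq; left; apply: Ed; apply: (supp_cl pg) sq => y [|->//].
  exact: (pg_ext pg).
- rewrite rans_cons => q sq; left; apply: Er; apply: (supp_cl pg) sq => y [|->//].
  exact: (pg_ext pg).
Qed.

(** If z depends on the domain and P, the finitely many elements of P involved are added first. The
    clauses on F serve [nice_extend], where the image has to be independent of prescribed
    elements. *)
Lemma extend1 e0 E z (F : seq K) : e0 \in E -> nice E -> exists E' z',
  [/\ nice E', {subset E <= E'}, (z, z') \in E',
      forall y, rans E' y -> P y -> y \in F -> rans E y &
      (~ cl (doms E `|` P) z -> ~ cl (rans E `|` [set` F] `|` P) z') /\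
      doms E' `<=` cl (doms E `|` P `|` [set z])].
Proof.
move=> e0E nE.
case: (pselect (cl (doms E `|` P) z)) => cz; last first.
  have [z' nE' nz'] := step_new F e0E nE cz.
  exists ((z, z') :: E), z'; split=> //; last split=> //.
  - by move=> e eE; rewrite inE eE orbT.
  - by rewrite inE eqxx.
  - rewrite rans_cons => y [//|->] Pz'; case: nz'; apply: (pg_ext pg); by right.
  - rewrite doms_cons => y [yE|->]; apply: (pg_ext pg); [by left; left|by right].
have [t [tP ct]] := cl_finU pg cz.
have [E1 [nE1 EE1 tE1 HF Hd]] : exists E1, [/\ nice E1, {subset E <= E1}, forall p, p \in t -> doms E1 p,
    forall y, rans E1 y -> P y -> y \in F -> rans E y & doms E1 `<=` doms E `|` P].
  elim: t tP {ct} => [|p t IH] tP; first by exists E; split=> // y; left.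
  have [|E1 [nE1 EE1 tE1 HF Hd]] := IH; first by move=> q qt; apply: tP; rewrite inE qt orbT.
  case: (pselect (doms E1 p)) => pE1.
    by exists E1; split=> // q; rewrite inE => /orP[/eqP->|/tE1].
  have Pp := tP p (mem_head _ _).
  have [p' nE2 p'F] := step_P F (EE1 _ e0E) nE1 Pp pE1.
  exists ((p, p') :: E1); split=> //.
  - by move=> e /EE1 eE; rewrite inE eE orbT.
  - by move=> q; rewrite doms_cons inE => /orP[/eqP->|/tE1]; [right|left].
  - by rewrite rans_cons => y [/HF//|-> _]; rewrite (negbTE p'F).
  - by rewrite doms_cons => y [/Hd//|->]; right.
have cz1 : cl (doms E1) z.
  by apply: (pg_mono pg) ct => y [/doms_ex[y' /EE1/mem_doms]|/tE1].
have [z' nE2 cz'] := step_cl (EE1 _ e0E) nE1 cz1.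
exists ((z, z') :: E1), z'; split=> //; last split=> //.
- by move=> e /EE1 eE; rewrite inE eE orbT.
- by rewrite inE eqxx.
- rewrite rans_cons => y [/HF//|->] Pz' zF; apply: HF => //.
  have [_ _ _ Er] := nE1; apply: Er; split=> //.
  by apply: (pg_mono pg) cz' => w; left.
- rewrite doms_cons => y [/Hd yE|->]; apply: (pg_ext pg); [by left|by right].
Qed.

(** Induction on formulas, with [extend1] at the quantifier. One implication is enough for all nice
    maps, since [swap] exchanges the two sides; the same symmetry handles negation. *)
Lemma nice_elem e0 E : e0 \in E -> nice E -> elem false E.
Proof.
suff H (f : fm) : forall e0 E, e0 \in E -> nice E -> forall v : nat -> K * K,
    (forall k, v k \in E) -> holds (fun k => (v k).1) f -> holds (fun k => (v k).2) f.
  move=> e0E nE f _ v vE; split; first exact: (H f e0 E).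
  apply: (H f (e0.2, e0.1) (swap E) _ (nice_swap nE) (fun k => ((v k).2, (v k).1))).
    by rewrite mem_swap -surjective_pairing.
  by move=> k; rewrite mem_swap -surjective_pairing.
elim: f => [[i|] vs|a b|f IH|f IHf g IHg|x f IH] {e0 E} e0 E e0E nE v vE.
- by have [EE _ _ _] := nE; move/(EE (FRel vs) isT v vE).
- have [_ EP _ _] := nE; rewrite /holds /=.
  have E1 (w : nat -> K) : map_tuple w vs = [tuple w (thead vs)].
    by apply: val_inj => /=; case: vs => -[|a []].
  rewrite !E1 => Pv; apply/(EP (v (thead vs)).1 (v (thead vs)).2) => //.
  by rewrite -surjective_pairing.
- by have [EE _ _ _] := nE; move/(EE (FEq _ a b) isT v vE).
- move=> /= nf hf; apply: nf.
  apply: (IH (e0.2, e0.1) (swap E) _ (nice_swap nE) (fun k => ((v k).2, (v k).1))) => //.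
    by rewrite mem_swap -surjective_pairing.
  by move=> k; rewrite mem_swap -surjective_pairing.
- by move=> [hf hg]; split; [apply: (IHf e0 E)|apply: (IHg e0 E)].
- move=> [a ha].
  have [E' [a' [nE' EE' aE' _ _]]] := extend1 a [::] e0E nE.
  exists a'; pose v' k := if k == x then (a, a') else v k.
  have := IH e0 E' (EE' _ e0E) nE' v'.
  have -> : (fun k => (v' k).1) = (fun k => if k == x then a else (v k).1).
    by apply/funext => k; rewrite /v'; case: eqP.
  have -> : (fun k => (v' k).2) = (fun k => if k == x then a' else (v k).2).
    by apply/funext => k; rewrite /v'; case: eqP.
  by apply=> // k; rewrite /v'; case: eqP => // _; apply: EE'.
Qed.

Lemma nice_extend e0 E (g : seq K) (F : seq K) : e0 \in E -> nice E -> exists E' (h : seq K),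
  [/\ nice E', {subset E <= E'}, size h = size g /\ forall x0 k, k < size g -> (nth x0 g k, nth x0 h k) \in E',
      forall y, rans E' y -> P y -> y \in F -> rans E y &
      rk (doms E `|` P) g <= rk (rans E `|` [set` F] `|` P) h].
Proof.
elim: g e0 E => [|z g IH] e0 E e0E nE; first by exists E, [::]; split.
have [E1 [z' [nE1 EE1 zE1 HF1 [Hn Hd1]]]] := extend1 z F e0E nE.
have [E2 [h [nE2 EE2 [sh Hh] HF2 Hrk]]] := IH e0 E1 (EE1 _ e0E) nE1.
exists E2, (z' :: h); split=> //.
- by move=> e /EE1/EE2.
- split; first by rewrite /= sh.
  by move=> x0 [|k] //= kg; [apply: EE2|apply: Hh].
- by move=> y y2 Py yF; apply: HF1 => //; apply: HF2.
- rewrite /=; apply: leq_add.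
    by case: asboolP => //= /Hn n; case: asboolP.
  apply: (@leq_trans (rk (doms E1 `|` P) g)).
    apply: (rk_anti pg) => y [/Hd1//|Py].
    by apply: (pg_ext pg); left; right.
  apply: (leq_trans Hrk); apply: (rk_mono pg) => y.
  case=> [[[yE|yF]|Py]|->]; [left; left|by left; right|by right|].
    by have [x xE] := rans_ex yE; apply: mem_rans (EE1 _ xE).
  by left; left; apply: mem_rans zE1.
Qed.

(** A nice map that fixes D has to fix z. If z were independent of D and P, [step_new] would move
    it. If z depended on a further p in P, p could be moved to a new p'; as z is fixed, exchange
    would make p' depend on p and the other parameters, so p' would be in their support. *)
Lemma dclN_cl (D : seq K) d0 (X : K -> Prop) z : d0 \in D ->
  DefO false D (fun u => X (u 0)) -> X z -> (forall y, X y -> y = z) ->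
  cl ([set` D] `|` supp [set` D]) z.
Proof.
move=> d0D DX Xz uX.
have [t Ht] := supp_list Lltf tK D; pose D' := D ++ t.
have D'E : [set` D] `|` supp [set` D] = [set` D'].
  by rewrite -Ht; apply/seteqP; split=> y; rewrite /D' /= mem_cat => /orP.
have sD' : supp [set` D'] `<=` [set` D'].
  by rewrite -D'E => p /(supp_supp pg); right.
rewrite D'E; apply: contrapT => ncz.
have keyX D1 E y : {subset D <= D1} -> {subset [seq (x, x) | x <- D1] <= E} -> nice E ->
    (z, y) \in E -> y = z.
  move=> DD1 DE nE zyE; apply: uX; have [f _ Hf] := DX.
  have dE : (d0, d0) \in E by apply: DE; apply: map_f; apply: DD1.
  have EE := nice_elem dE nE.
  pose v k := pre [seq (x, x) | x <- D] (fun=> (z, y)) k.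
  have vE k : v k \in E.
    rewrite /v; case: (ltnP k (size D)) => kD; last by rewrite /pre nth_default ?size_map.
    rewrite (pre_lt (z, y)) ?size_map // (nth_map d0) //.
    by apply: DE; apply: map_f; apply: DD1; apply: mem_nth.
  have Hp (q : K * K -> K) : (forall x, q (x, x) = x) -> (fun k => q (v k)) = pre D (fun=> q (z, y)).
    move=> qq; apply/funext => k; rewrite /v; case: (ltnP k (size D)) => kD.
      by rewrite (pre_lt (z, y)) ?size_map // (nth_map d0) // qq (pre_lt d0).
    by rewrite /pre !nth_default ?size_map.
  have := EE f isT v vE; rewrite (Hp fst) // (Hp snd) //= -!Hf /= => H.
  exact/H.
have idE D1 : doms [seq (x, x) | x <- D1] = [set` D1] /\ rans [seq (x, x) | x <- D1] = [set` D1].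
  by rewrite /doms /rans -!map_comp !map_id.
have DD' : {subset D <= D'} by move=> x xD; rewrite mem_cat xD.
have [d1 r1] := idE D'.
case: (pselect (cl ([set` D'] `|` P) z)) => czP; last first.
  rewrite -d1 in czP.
  have [z' nE' nz'] := @step_new (d0, d0) _ z [:: z] (map_f _ (DD' _ d0D)) (nice_id sD') czP.
  apply: nz'; have -> : z' = z.
    apply: (keyX D' _ z' DD' _ nE'); last by rewrite mem_head.
    by move=> e eE; rewrite inE eE orbT.
  by apply: (pg_ext pg); left; right; rewrite /= mem_head.
have [t0 [t0P ct0]] := cl_finU pg czP.
(* The moment at which z becomes dependent when the elements of [t0] are added one at a time. *)
have [t1 [p [t1P Pp nc1 cp]]] : exists t1 p, [/\ forall q, q \in t1 -> P q, P p,
    ~ cl [set` D' ++ t1] z & cl ([set` D' ++ t1] `|` [set p]) z].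
  have UE (l : seq K) : [set` D' ++ l] = [set` D'] `|` [set` l].
    by apply/seteqP; split=> y; rewrite /= mem_cat => /orP.
  elim: t0 t0P ct0 => [|p t0 IH] tP ct.
    by case: ncz; apply: (pg_mono pg) ct => y [].
  have tP' q : q \in t0 -> P q by move=> qt; apply: tP; rewrite inE qt orbT.
  case: (pselect (cl ([set` D'] `|` [set` t0]) z)) => c0; first exact: IH.
  exists t0, p; split=> //; rewrite ?UE //; first by apply: tP; rewrite mem_head.
  by move: ct; rewrite setU_cons -!setUA (setUC [set p]).
pose D1 := D' ++ t1; have [d2 r2] := idE D1.
have sD1 : supp [set` D1] `<=` [set` D1].
  have -> : [set` D1] = [set` D'] `|` [set` t1].
    by apply/seteqP; split=> y; rewrite /D1 /= mem_cat => /orP.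
  by move=> q /(supp_UP pg)[y /t1P//|/sD'|]; [left|right].
have DD1 : {subset D <= D1} by move=> x xD; rewrite mem_cat DD'.
have npD1 : ~ [set` D1] p.
  by move=> pD1; apply: nc1; apply: (pg_mono pg) cp => y [//|->].
rewrite -{1}d2 in npD1.
have [p' nE2 p'F] := @step_P (d0, d0) _ p (p :: D1) (map_f _ (DD1 _ d0D)) (nice_id sD1) Pp npD1.
have cz2 : cl (doms ((p, p') :: [seq (x, x) | x <- D1])) z by rewrite doms_cons d2.
have e2 : (d0, d0) \in (p, p') :: [seq (x, x) | x <- D1] by rewrite inE map_f ?orbT // DD1.
have [z' nE3 cz3] := step_cl e2 nE2 cz2.
have zz : z' = z.
  apply: (keyX D1 _ z' DD1 _ nE3); last by rewrite mem_head.
  by move=> e eE; rewrite !inE eE !orbT.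
rewrite zz rans_cons r2 in cz3.
have cp' := pg_exch pg cz3 nc1.
have Pp' : P p' by have [_ EP _ _] := nE2; apply/(EP p p') => //; rewrite mem_head.
move: p'F; rewrite inE negb_or => /andP[/eqP np'p /negP]; apply; apply: sD1; split=> //.
apply: (pg_trans pg) cp' => y [yD|->]; first by apply: (pg_ext pg); left.
apply: (pg_mono pg) cp => y' [|->]; [by left|right; split=> //=].
by move=> E; apply: np'p.
Qed.

End ElementaryMaps.

(** * Generic definability *)

Lemma pre_ge (T : Type) (l : seq T) (u : nat -> T) k :
  size l <= k -> pre l u k = u (k - size l).
Proof. by move=> lk; rewrite /pre nth_default. Qed.

Section Compactness.
Local Open Scope classical_set_scope.
Variables (I : Type) (ar : I -> nat) (ltf opf : formula (ar_P ar)).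
Hypotheses (Lltf : isL ltf) (Lopf : isL opf).
Variable K : Str ar.
Hypothesis tK : tame ltf opf K.
Local Notation fm := (formula (ar_P ar)).
Local Notation P := (@sP _ ar K : set K).
Local Notation cl := (@cl _ ar ltf K).
Local Notation rk := (rk cl).
Local Notation supp := (supp cl P).
Local Notation pg := (cl_pregeom Lltf tK).

Lemma DefO_allT b (D : seq K) m (B : (nat -> K) -> m.-tuple K -> Prop) :
  DefO b D (fun u => B (fun k => u (m + k)) (tk m u)) -> DefO b D (fun u => forall x, B u x).
Proof.
move=> H; apply: DefO_eqv
  (DefO_not (@DefO_exT _ _ _ b D m (fun v a => ~ B v a) (DefO_not H))) => v.
split=> [nH a|H' [a]]; last by apply.
by apply: contrapT => nB; apply: nH; exists a.
Qed.

Lemma tk_cat (T : Type) m n (u : nat -> T) :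
  tk (m + n) u = cat_tuple (tk m u) (tk n (fun k => u (m + k))).
Proof.
apply: eq_from_tnth => i; rewrite tnth_tk; case: (split_ordP i) => j ->.
  by rewrite tnth_lshift tnth_tk.
by rewrite tnth_rshift tnth_tk.
Qed.

Lemma tk_pre (T : Type) m (x : m.-tuple T) (u : nat -> T) : tk m (pre x u) = x.
Proof.
apply: eq_from_tnth => i; rewrite tnth_tk (pre_lt (u 0)) ?size_tuple //.
by rewrite -tnth_nth.
Qed.

Lemma shift_pre (T : Type) m (x : m.-tuple T) (u : nat -> T) : (fun k => pre x u (m + k)) = u.
Proof. by apply/funext => k; have := pre_size x u k; rewrite size_tuple. Qed.

Lemma pre_tk (T : Type) m (u v : nat -> T) k : k < m -> pre (tk m u) v k = u k.
Proof.
move=> km; rewrite (pre_lt (v 0)) ?size_tuple //.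
by have := tnth_nth (v 0) (tk m u) (Ordinal km); rewrite tnth_tk => <-.
Qed.

Variables (A : seq K) (a0 : K).
Hypothesis a0A : a0 \in A.

Lemma sat_tuple N (CC : (N.-tuple K -> Prop) -> Prop) :
  (forall C, CC C -> DefO false A (fun u => C (tk N u))) -> (exists C, CC C) ->
  (forall C1 C2, CC C1 -> CC C2 -> exists2 C3, CC C3 & forall x, C3 x -> C1 x /\ C2 x) ->
  (forall C, CC C -> exists x, C x) -> exists x, forall C, CC C -> C x.
Proof.
move=> CD [C0 CC0] dir ne.
pose w := pre A (fun=> a0).
pose rr k := if k < size A then N + k else if k - size A < N then k - size A else N.
have rrE (u : nat -> K) : (forall k, N <= k -> u k = w (k - N)) ->
    exists2 u', tk N u' = tk N u & (fun k => u (rr k)) = pre A u'.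
  move=> H; exists (fun k => if k < N then u k else w 0).
    by apply: eq_from_tnth => i; rewrite !tnth_tk ltn_ord.
  apply/funext => k; rewrite /rr; case: (ltnP k (size A)) => kA.
    by rewrite H ?leq_addr // addKn /w !(pre_lt a0).
  rewrite pre_ge //; case: ifP => // _.
  by rewrite H // subnn.
pose QQ (Q : (nat -> K) -> Prop) := exists (g : fm) C,
  [/\ CC C, forall u, C (tk N u) <-> holds (pre A u) g & Q = fun u => holds (fun k => u (rr k)) g].
have [||Q1 Q2|Q|v' Hv' QQv'] := @sat_directed _ _ _ _ _ tK QQ (fun k => N <= k) (fun k => w (k - N)).
- move=> Q [g [C [_ _ ->]]].
  apply: (@DefO_FO _ _ _ _ _ (fun s u => holds (fun k => u (rr k)) g)).
    exact: (@FO_holds _ _ _ _ rr).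
  by move=> u; rewrite pre_nil.
- by have [g _ Hg] := CD _ CC0; exists (fun u => holds (fun k => u (rr k)) g), g, C0.
- move=> [g1 [C1 [CC1 H1 ->]]] [g2 [C2 [CC2 H2 ->]]].
  have [C3 CC3 H3] := dir _ _ CC1 CC2; have [g3 _ Hg3] := CD _ CC3.
  exists (fun u => holds (fun k => u (rr k)) (FAnd (FAnd g1 g2) g3)); last by move=> u [[? ?] ?].
  exists (FAnd (FAnd g1 g2) g3), C3; split=> // u; split=> [c3|[_ /Hg3//]].
  by have [/H1 ? /H2 ?] := H3 _ c3; split=> //; apply/Hg3.
- move=> QQQ; have [g [C [CCC Hg EQ]]] := QQQ; have [x Cx] := ne _ CCC.
  have H k : N <= k -> pre x w k = w (k - N).
    by move=> Nk; rewrite pre_ge size_tuple.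
  exists (pre x w) => //; rewrite EQ; have [u' E ->] := rrE _ H.
  by apply/Hg; rewrite E tk_pre.
exists (tk N v') => C CCC; have [g _ Hg] := CD _ CCC.
have QQQ : QQ (fun u => holds (fun k => u (rr k)) g) by exists g, C.
have := QQv' _ QQQ; have [u' E ->] := rrE _ Hv'.
by move/Hg; rewrite E.
Qed.

Lemma open_rk_tuple N (x : N.-tuple K) d k (q : seq K) :
  size q = k -> (forall p, p \in q -> P p) -> rk ([set` A] `|` [set` q]) x < d ->
  exists Y : N.-tuple K -> Prop, [/\ DefO false A (fun u => Y (tk N u)), Y x &
    forall x', Y x' -> exists q' : seq K, [/\ size q' = k, forall p, p \in q' -> P p &
      rk ([set` A] `|` [set` q']) x' < d]].
Proof.
move=> sq qP Hq; pose w := pre A (fun=> a0).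
pose J i := N <= i < N + size A.
have E1 (y : N.-tuple K) : vals J (pre y w) = [set` A].
  apply/seteqP; split=> z.
    case=> i /andP[Ni iA] ->; rewrite /= -(subnKC Ni) /J.
    have := pre_size y w (i - N); rewrite size_tuple => ->.
    by rewrite /w (pre_lt a0) ?mem_nth // ltn_subLR.
  move=> /= zA; exists (N + index z A); first by rewrite /J leq_addr ltn_add2l index_mem.
  have := pre_size y w (index z A); rewrite size_tuple => ->.
  by rewrite /w (pre_lt a0) ?index_mem // nth_index.
have E2 (y : N.-tuple K) : map (pre y w) (iota 0 N) = y.
  apply: (@eq_from_nth _ a0); first by rewrite size_map size_iota size_tuple.
  move=> i; rewrite size_map size_iota => iN; rewrite (nth_map 0) ?size_iota //.
  by rewrite nth_iota // add0n (pre_lt a0) ?size_tuple.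
have [|Q FQ [Qu HQ]] := @open_rkPn _ _ _ Lltf K J (iota 0 N) d k (pre x w).
  by exists q; split=> //; rewrite E1 E2.
exists (fun x' => Q K (pre x' w)); split=> // [|x' /HQ[q' [sq' q'P]]]; last first.
  by rewrite E1 E2; exists q'.
have H : DefO false [::] (fun u => Q K u) by apply: DefO_nil.
apply: (@DefO_subst _ _ _ _ _ _ _ (fun u => pre (tk N u) w) H) => // i.
case: (ltnP i N) => iN; first by left; exists i => u; rewrite pre_tk.
right; exists (w (i - N)).
  rewrite /w; case: (ltnP (i - N) (size A)) => iA; first by rewrite (pre_lt a0) // mem_nth.
  by rewrite /pre nth_default.
by move=> u; rewrite pre_ge size_tuple.
Qed.

(** Rank at least d over A and P enters a compactness argument as the type that avoids all these
    sets; by [subrank_ex] this type describes it exactly. *)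
Definition subrank N d (Y : N.-tuple K -> Prop) : Prop :=
  DefO false A (fun u => Y (tk N u)) /\ forall x, Y x -> rk ([set` A] `|` P) x < d.

Lemma subrank_ex N d (x : N.-tuple K) : rk ([set` A] `|` P) x < d -> exists2 Y, subrank d Y & Y x.
Proof.
move=> /(rk_finU pg)[q [qP Hq]]; have [Y [DY Yx HY]] := open_rk_tuple erefl qP Hq.
exists Y => //; split=> // x' /HY[q' [_ q'P]]; apply: leq_ltn_trans.
by apply: (rk_mono pg) => y [|/q'P]; [left|right].
Qed.

Lemma subrankU N d (Y Y' : N.-tuple K -> Prop) : subrank d Y -> subrank d Y' ->
  subrank d (fun x => Y x \/ Y' x).
Proof. by move=> [D1 H1] [D2 H2]; split; [apply: DefO_or|move=> x [/H1|/H2]]. Qed.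

Lemma subrank0 N d : subrank d (fun _ : N.-tuple K => False).
Proof. by split=> //; apply: DefO_cst. Qed.

Lemma elem_DefO b E N (x y : N.-tuple K) (Q : N.-tuple K -> Prop) :
  elem b E -> (forall a, a \in A -> (a, a) \in E) ->
  (forall i, (tnth x i, tnth y i) \in E) ->
  DefO b A (fun u => Q (tk N u)) -> Q x <-> Q y.
Proof.
move=> EE inA inZ [f Lf Hf].
pose w k := if k < size A then (nth a0 A k, nth a0 A k)
            else if k - size A < N then nth (a0, a0) (zip x y) (k - size A) else (a0, a0).
have EN : holds (fun k => (w k).1) f <-> holds (fun k => (w k).2) f.
  apply: EE => // k; rewrite /w; case: ltnP => kA; first exact/inA/mem_nth.
  case: ltnP => kN; last exact: inA.
  by have := inZ (Ordinal kN); rewrite !(tnth_nth a0) nth_zip ?size_tuple.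
have H (q : K * K -> K) (z : N.-tuple K) : (forall x, q (x, x) = x) ->
    (forall i, q (tnth x i, tnth y i) = tnth z i) ->
    (fun k => q (w k)) = pre A (pre z (fun=> a0)).
  move=> qq qz; apply/funext => k; rewrite /w; case: ltnP => kA; first by rewrite qq (pre_lt a0).
  rewrite pre_ge //; case: ltnP => kN.
    rewrite nth_zip ?size_tuple // (pre_lt a0) ?size_tuple //.
    by have := qz (Ordinal kN); rewrite !(tnth_nth a0).
  by rewrite qq /pre nth_default // size_tuple.
by rewrite (H fst x) // (H snd y) // -!Hf !tk_pre in EN.
Qed.

Lemma elem_of_type N (x y : N.-tuple K) :
  (forall phi : N.-tuple K -> Prop, DefO true A (fun u => phi (tk N u)) -> phi x -> phi y) ->
  elem true ([seq (a, a) | a <- A] ++ zip x y).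
Proof.
move=> H f /= Lf v vE.
have Hv k : (exists2 a, a \in A & v k = (a, a)) \/ exists i : 'I_N, v k = (tnth x i, tnth y i).
  have := vE k; rewrite mem_cat => /orP[/mapP[a aA ->]|]; first by left; exists a.
  move=> /(nthP (a0, a0))[i]; rewrite size_zip !size_tuple minnn => iN <-.
  rewrite nth_zip ?size_tuple //; right; exists (Ordinal iN).
  by rewrite !(tnth_nth a0).
pose t (z : N.-tuple K) k := if pselect (exists i : 'I_N, v k = (tnth x i, tnth y i)) is left p
  then tnth z (projT1 (cid p)) else (v k).1.
have tx : t x = (fun k => (v k).1).
  by apply/funext => k; rewrite /t; case: pselect => // p; case: (cid p) => i /= ->.
have ty : t y = (fun k => (v k).2).
  apply/funext => k; rewrite /t; case: pselect => [p|np]; first by case: (cid p) => i /= ->.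
  by case: (Hv k) => [[a _ ->]|].
have Dphi : DefO true A (fun u => holds (t (tk N u)) f).
  have Hf : DefO true [::] (fun u : nat -> K => holds u f) by exists f => // u; rewrite pre_nil.
  apply: (@DefO_subst _ _ _ _ _ _ _ (fun u => t (tk N u)) Hf) => // k; rewrite /t.
  case: pselect => [p|np]; first by left; exists (projT1 (cid p)) => u; rewrite tnth_tk.
  by right; case: (Hv k) => [[a aA E]|//]; exists a; rewrite ?E.
rewrite -tx -ty; split; first exact: (H (fun z => holds (t z) f)).
move=> hy; apply: contrapT => nx.
exact: (H (fun z => ~ holds (t z) f) (DefO_not Dphi) nx).
Qed.

Hypothesis Agood : supp [set` A] `<=` [set` A].

(** The bounds on the two ranks keep the supports of A, x and of A, y inside A ([rk_supp_sub]), so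
    the identity on A extended by x -> y is a nice map. *)
Lemma elem_of_type_N N (x y : N.-tuple K) d (Q : N.-tuple K -> Prop) :
  (forall phi : N.-tuple K -> Prop, DefO true A (fun u => phi (tk N u)) -> phi x -> phi y) ->
  rk [set` A] x <= d -> d <= rk ([set` A] `|` P) x -> d <= rk ([set` A] `|` P) y ->
  DefO false A (fun u => Q (tk N u)) -> Q x -> Q y.
Proof.
move=> tp rx rPx rPy DQ Qx.
set E := [seq (a, a) | a <- A] ++ zip x y.
have EE : elem true E := elem_of_type tp.
have inA a : a \in A -> (a, a) \in E.
  by move=> aA; rewrite mem_cat map_f.
have inZ i : (tnth x i, tnth y i) \in E.
  rewrite mem_cat; apply/orP; right; apply/(nthP (a0, a0)); exists i.
    by rewrite size_zip !size_tuple minnn.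
  by rewrite nth_zip ?size_tuple // -!tnth_nth.
have dE : doms E = [set` A] `|` [set` tval x].
  apply/seteqP; rewrite /doms /E map_cat -map_comp map_id -/unzip1 unzip1_zip ?size_tuple //.
  by split=> z /=; rewrite mem_cat => /orP.
have rE : rans E = [set` A] `|` [set` tval y].
  apply/seteqP; rewrite /rans /E map_cat -map_comp map_id -/unzip2 unzip2_zip ?size_tuple //.
  by split=> z /=; rewrite mem_cat => /orP.
pose v k := if k < N then nth (a0, a0) (zip x y) k else (nth a0 A (k - N), nth a0 A (k - N)).
have vE k : v k \in E.
  rewrite /v; case: ltnP => kN; last exact/inA/nth_in.
  by have := inZ (Ordinal kN); rewrite !(tnth_nth a0) nth_zip ?size_tuple.
have ry : rk [set` A] y <= d.
  have H (q : K * K -> K) (z : N.-tuple K) : (forall x, q (x, x) = x) ->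
      (forall i, q (tnth x i, tnth y i) = tnth z i) ->
      vals (leq N) (fun k => q (v k)) = [set` A] /\ map (fun k => q (v k)) (iota 0 N) = z.
    move=> qq qz; split.
      apply/seteqP; split=> a.
        by case=> k Nk ->; rewrite /v ltnNge Nk /= qq; apply: nth_in.
      move=> /= aA; exists (N + index a A); first exact: leq_addr.
      by rewrite /v ltnNge leq_addr /= qq addKn nth_index.
    apply: (@eq_from_nth _ a0); first by rewrite size_map size_iota size_tuple.
    move=> i; rewrite size_map size_iota => iN; rewrite (nth_map 0) ?size_iota //.
    rewrite nth_iota // add0n /v iN nth_zip ?size_tuple //.
    by have := qz (Ordinal iN); rewrite !(tnth_nth a0).
  have [H1 H2] := H fst x (fun=> erefl) (fun=> erefl).
  have [H3 H4] := H snd y (fun=> erefl) (fun=> erefl).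
  have := elem_open EE (@open_rk _ _ _ Lltf K (leq N) (iota 0 N) d.+1) vE.
  by rewrite H1 H2 H3 H4 !ltnS; apply.
have sx : supp (doms E) `<=` [set` A].
  by rewrite dE => p /(rk_supp_sub pg (leq_trans rx rPx))/Agood.
have sy : supp (rans E) `<=` [set` A].
  by rewrite rE => p /(rk_supp_sub pg (leq_trans ry rPy))/Agood.
have nE : nice ltf E.
  split=> //; last 2 first.
  - by rewrite {2}dE => p /sx; left.
  - by rewrite {2}rE => p /sy; left.
  move=> z z' zE; split=> Pz.
    have zA : z \in A.
      by apply: sx; split=> //; apply: (pg_ext pg); left; apply: mem_doms zE.
    by rewrite -(elem_eq EE (inA _ zA) zE).
  have zA : z' \in A.
    by apply: sy; split=> //; apply: (pg_ext pg); left; apply: mem_rans zE.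
  have := elem_eq (elem_swap EE) (x := z') (y := z) (y' := z').
  by rewrite !mem_swap => -> //; apply: inA.
exact/(elem_DefO (nice_elem Lltf Lopf tK (inA _ a0A) nE) inA inZ DQ).
Qed.

(* For such points the L-type over A determines the N-type. *)
Lemma generic_L_definable N d (Q : N.-tuple K -> Prop) :
  DefO false A (fun u => Q (tk N u)) ->
  (forall x : N.-tuple K, d <= rk ([set` A] `|` P) x -> Q x -> rk [set` A] x <= d) ->
  exists2 phi : N.-tuple K -> Prop, DefO true A (fun u => phi (tk N u)) &
    forall x : N.-tuple K, d <= rk ([set` A] `|` P) x -> (Q x <-> phi x).
Proof.
move=> DQ HQ.
pose good (phi : N.-tuple K -> Prop) := DefO true A (fun u => phi (tk N u)) /\
  forall x : N.-tuple K, d <= rk ([set` A] `|` P) x -> phi x -> Q x.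
have notY Y (x : N.-tuple K) : subrank d Y -> d <= rk ([set` A] `|` P) x -> ~ Y x.
  by move=> [_ H] rx /H; rewrite ltnNge rx.
(* If no L-formula true at x0 implied Q on the points of rank at least d, compactness would give
   such a point with the L-type of x0 outside Q, against [elem_of_type_N]. *)
have local (x0 : N.-tuple K) : d <= rk ([set` A] `|` P) x0 -> Q x0 -> exists2 phi, good phi & phi x0.
  move=> rx0 Qx0; apply: contrapT => /forall2NP nphi.
  pose CC (C : N.-tuple K -> Prop) := exists phi Y, [/\ DefO true A (fun u => phi (tk N u)), phi x0,
    subrank d Y & C = fun x => (phi x /\ ~ Y x) /\ ~ Q x].
  have [||||x Hx] := @sat_tuple N CC.
  - move=> C [phi [Y [Dphi _ [DY _] ->]]].
    apply: DefO_and; last exact: DefO_not.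
    by apply: DefO_and; [apply: DefO_weak Dphi|apply: DefO_not].
  - exists (fun x => (True /\ ~ False) /\ ~ Q x), (fun=> True), (fun=> False); split=> //.
      exact: DefO_cst.
    exact: subrank0.
  - move=> _ _ [phi1 [Y1 [D1 p1 S1 ->]]] [phi2 [Y2 [D2 p2 S2 ->]]].
    exists (fun x => ((phi1 x /\ phi2 x) /\ ~ (Y1 x \/ Y2 x)) /\ ~ Q x); last first.
      by move=> x [[[? ?] nY] nQ]; split; split=> //; split=> // ?; apply: nY; [left|right].
    exists (fun x => phi1 x /\ phi2 x), (fun x => Y1 x \/ Y2 x); split=> //.
      exact: DefO_and.
    exact: subrankU.
  - move=> _ [phi [Y [Dphi px0 SY ->]]]; apply: contrapT => /forallNP nx.
    case: (nphi phi) => // ng; apply: ng; split=> // x rx phix; apply: contrapT => nQ.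
    by apply: (nx x); split=> //; split=> //; apply: notY rx.
  have hx phi Y : DefO true A (fun u => phi (tk N u)) -> phi x0 -> subrank d Y ->
      (phi x /\ ~ Y x) /\ ~ Q x.
    move=> Dphi p0 SY; apply: (Hx (fun x => (phi x /\ ~ Y x) /\ ~ Q x)).
    by exists phi, Y.
  have [_ nQ] := hx (fun=> True) _ (@DefO_cst _ _ K true A True) Logic.I (subrank0 N d).
  apply: nQ; apply: (@elem_of_type_N N x0 x d) => //.
  - by move=> phi Dphi p0; have [[]] := hx _ _ Dphi p0 (subrank0 N d).
  - exact: HQ.
  - rewrite leqNgt; apply/negP => /subrank_ex[Y SY Yx].
    by have [[_ /(_ Yx)]] := hx (fun=> True) _ (@DefO_cst _ _ K true A True) Logic.I SY.
(* A second use of compactness: good formulas are closed under disjunction, so if none covered Q on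
   the points of rank at least d, some such point of Q would escape all of them, contrary to
   [local]. *)
apply: contrapT => /forall2NP nphi.
pose CC (C : N.-tuple K -> Prop) := exists phi Y, [/\ good phi,
    subrank d Y & C = fun x => (Q x /\ ~ phi x) /\ ~ Y x].
have gD phi : good phi -> DefO true A (fun u => phi (tk N u)) by case.
have g0 : good (fun=> False) by split=> //; apply: DefO_cst.
have [||||x Hx] := @sat_tuple N CC.
- move=> C [phi [Y [/gD Dphi [DY _] ->]]].
  apply: DefO_and; last exact: DefO_not.
  by apply: DefO_and => //; apply: DefO_not; apply: DefO_weak Dphi.
- exists (fun x => (Q x /\ ~ False) /\ ~ False), (fun=> False), (fun=> False); split=> //.
  exact: subrank0.
- move=> _ _ [phi1 [Y1 [[D1 p1] S1 ->]]] [phi2 [Y2 [[D2 p2] S2 ->]]].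
  exists (fun x => (Q x /\ ~ (phi1 x \/ phi2 x)) /\ ~ (Y1 x \/ Y2 x)); last first.
    by move=> x [[? np] nY]; split; (split; [split=> // ?|move=> ?]);
      [apply: np; left|apply: nY; left|apply: np; right|apply: nY; right].
  exists (fun x => phi1 x \/ phi2 x), (fun x => Y1 x \/ Y2 x); split=> //; last exact: subrankU.
  by split; [apply: DefO_or|move=> x rx [/p1|/p2]; apply].
- move=> _ [phi [Y [gphi SY ->]]]; apply: contrapT => /forallNP nx.
  case: (nphi phi) => [/(_ (gD _ gphi))//|np]; apply: np => x rx; split.
    move=> Qx; apply: contrapT => nphix; apply: (nx x); split=> //.
    exact: notY rx.
  by have [_] := gphi; apply.
have hx phi Y : good phi -> subrank d Y -> (Q x /\ ~ phi x) /\ ~ Y x.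
  move=> gphi SY; apply: (Hx (fun x => (Q x /\ ~ phi x) /\ ~ Y x)).
  by exists phi, Y.
have rx : d <= rk ([set` A] `|` P) x.
  rewrite leqNgt; apply/negP => /subrank_ex[Y SY Yx].
  by have [_ /(_ Yx)] := hx _ _ g0 SY.
have [[Qx _] _] := hx _ _ g0 (subrank0 N d).
have [phi gphi phix] := local x rx Qx.
by have [[_ /(_ phix)]] := hx _ _ gphi (subrank0 N d).
Qed.

End Compactness.

(** An isomorphism described through five relations only, so that it can be expressed by one formula
    and transferred by Los's theorem. *)
Definition iso_spec (T : Type) n m (G : n.-tuple T -> Prop)
  (M : n.-tuple T -> n.-tuple T -> n.-tuple T -> Prop) (H : m.-tuple T -> Prop)
  (N : m.-tuple T -> m.-tuple T -> m.-tuple T -> Prop) (f : n.-tuple T -> m.-tuple T -> Prop) : Prop :=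
  (forall g t, f g t -> G g /\ H t) /\
  ((forall g, G g -> exists t, f g t) /\
  ((forall g t t', f g t -> f g t' -> t = t') /\
  ((forall g g' t, f g t -> f g' t -> g = g') /\
  ((forall t, H t -> exists g, f g t) /\
  ((forall t t' t'', N t t' t'' -> H t /\ (H t' /\ H t'')) /\
  (forall g h k t t' t'', M g h k -> f g t -> f h t' -> (N t t' t'' <-> f k t''))))))).

Section ParametricDefinability.
Variables (I : Type) (ar : I -> nat) (K : Str ar).

Definition Def (b : bool) (X : (nat -> K) -> Prop) : Prop := exists D, DefO b D X.

Lemma Def_eqv b (X X' : (nat -> K) -> Prop) : (forall u, X u <-> X' u) -> Def b X -> Def b X'.
Proof. by move=> E [D H]; exists D; apply: DefO_eqv E H. Qed.

Lemma Def_weak b X : Def b X -> Def false X.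
Proof. by case=> D H; exists D; apply: DefO_weak H. Qed.

Lemma Def_cst b (p : Prop) : Def b (fun=> p).
Proof. by exists [::]; apply: DefO_cst. Qed.

Lemma Def_not b X : Def b X -> Def b (fun u => ~ X u).
Proof. by case=> D H; exists D; apply: DefO_not. Qed.

Lemma Def_and b X X' : Def b X -> Def b X' -> Def b (fun u => X u /\ X' u).
Proof.
move=> [D H] [D' H']; exists (D ++ D'); apply: DefO_and.
  by apply: DefO_sub H => y yD; rewrite mem_cat yD.
by apply: DefO_sub H' => y yD; rewrite mem_cat yD orbT.
Qed.

Lemma Def_imp b X X' : Def b X -> Def b X' -> Def b (fun u => X u -> X' u).
Proof.
move=> HX HX'; apply: Def_eqv (Def_not (Def_and HX (Def_not HX'))) => u.
split=> [H q|H [q]]; last by apply; apply: H.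
by apply: contrapT => nq; apply: H.
Qed.

Lemma Def_exT b m (B : (nat -> K) -> m.-tuple K -> Prop) :
  Def b (fun u => B (fun k => u (m + k)) (tk m u)) -> Def b (fun u => exists x, B u x).
Proof. by case=> D H; exists D; apply: DefO_exT. Qed.

Lemma Def_all_fin b (T : finType) (Q : T -> (nat -> K) -> Prop) :
  (forall t, Def b (Q t)) -> Def b (fun v => forall t, Q t v).
Proof.
move=> /choice[D HD]; exists (flatten [seq D t | t <- enum T]).
apply: DefO_all_fin => t; apply: DefO_sub (HD t) => y yD.
by apply/flattenP; exists (D t) => //; apply: map_f; rewrite mem_enum.
Qed.

Lemma Def_ex_fin b (T : finType) (Q : T -> (nat -> K) -> Prop) :
  (forall t, Def b (Q t)) -> Def b (fun v => exists t, Q t v).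
Proof.
move=> H; apply: Def_eqv (Def_not (Def_all_fin (fun t => Def_not (H t)))) => v.
by split=> [/existsNP[t /contrapT]|[t Ht] /(_ t)//]; exists t.
Qed.

Lemma Def_eqc b j c : Def b (fun u : nat -> K => u j = c).
Proof.
exists [:: c]; have H : DefO b [::] (fun u : nat -> K => u 0 = u 1) by apply: DefO_eq.
apply: (@DefO_subst _ _ _ _ _ _ _ (fun u k => if k is 0 then u j else c) H) => // -[|k].
  by left; exists j.
by right; exists c; rewrite ?mem_head.
Qed.

End ParametricDefinability.

(** * Generic group law and charts *)

Section Group.
Local Open Scope classical_set_scope.
Variables (I : Type) (ar : I -> nat) (ltf opf : formula (ar_P ar)).
Hypotheses (Lltf : isL ltf) (Lopf : isL opf).
Variable K : Str ar.
Hypothesis tK : tame ltf opf K.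
Local Notation fm := (formula (ar_P ar)).
Local Notation P := (@sP _ ar K : set K).
Local Notation cl := (@cl _ ar ltf K).
Local Notation rk := (rk cl).
Local Notation supp := (supp cl P).
Local Notation pg := (cl_pregeom Lltf tK).

(** Membership in the support is carried along by maps elementary for the structure with P; this is
    how [supp_gen] copies a support. *)
Lemma open_supp (J : nat -> Prop) : isopen false (fun u : nat -> K => supp (vals J u) (u 0)).
Proof.
move=> u [Pu /(cl_finU pg)[q [qP cq]]]; pose k := size q.
pose R (w : nat -> K) := rk (vals (shiftJ k J) w) (map w [:: k]) < 1 /\
  forall j : 'I_k, w j <> w k.
have OR : isopen true R.
  apply: open_and; first exact: (@open_rk _ _ _ Lltf K (shiftJ k J) [:: k] 1).
  apply: (@open_FO _ _ _ _ (fun s w => forall j : 'I_k, w j <> w k)).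
  by apply: FO_all_fin => j; apply: FO_not; apply: FO_eq.
have pk (q' : seq K) (w : nat -> K) : size q' = k -> pre q' w k = w 0.
  by move=> <-; have := pre_size q' w 0; rewrite addn0.
have [|Q FQ [Qu HQ]] := @open_exPn _ _ _ true R k OR u.
  exists q; split=> // [p /qP[]//|]; split=> [|j].
    by rewrite vals_pre /= pk // asboolT.
  rewrite pk // (pre_lt (u 0)) // => E.
  by have [_] := qP _ (mem_nth (u 0) (ltn_ord j)); apply.
exists (fun s w => sP (w 0) /\ Q s w); first by apply: FO_and => //; apply: FO_P.
split=> // w [Pw /HQ[q' [sq' q'P [H1 H2]]]]; split=> //.
move: H1; rewrite /= -{1}sq' vals_pre pk //; case: asboolP => // cw _.
apply: (pg_mono pg) cw => y [|yq]; [by left|right; split; first exact: q'P].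
move=> /= E; have ik : index y q' < k by rewrite -sq' index_mem.
apply: (H2 (Ordinal ik)); rewrite pk //= (pre_lt y) ?index_mem //.
by rewrite nth_index.
Qed.

Variables (A : seq K) (a0 : K).
Hypothesis a0A : a0 \in A.
Hypothesis Agood : supp [set` A] `<=` [set` A].

Variables (n : nat) (G : n.-tuple K -> Prop).
Variables (mul : n.-tuple K -> n.-tuple K -> n.-tuple K) (e : n.-tuple K) (inv : n.-tuple K -> n.-tuple K).
Hypothesis Ge : G e.
Hypothesis Gmul : forall x y, G x -> G y -> G (mul x y).
Hypothesis Ginv : forall x, G x -> G (inv x).
Hypothesis mulA : forall x y z, G x -> G y -> G z -> mul (mul x y) z = mul x (mul y z).
Hypothesis mul1 : forall x, G x -> mul e x = x /\ mul x e = x.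
Hypothesis mulV : forall x, G x -> mul (inv x) x = e /\ mul x (inv x) = e.

Definition GM x y z := G x /\ (G y /\ mul x y = z).

Definition blocks (R : n.-tuple K -> n.-tuple K -> n.-tuple K -> Prop) (u : nat -> K) : Prop :=
  R (tk n u) (tk n (fun k => u (n + k))) (tk n (fun k => u (n + (n + k)))).

Hypothesis DG : DefO false A (fun u => G (tk n u)).
Hypothesis DM : DefO false A (blocks GM).

Local Notation AP := ([set` A] `|` P).
Local Notation st x := [set` tval x].

Lemma mulKl x y : G x -> G y -> mul (inv x) (mul x y) = y.
Proof.
move=> Gx Gy; rewrite -mulA //; last exact: Ginv.
by have [-> _] := mulV Gx; have [] := mul1 Gy.
Qed.

Lemma mulKr x y : G x -> G y -> mul (mul x y) (inv y) = x.
Proof.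
move=> Gx Gy; rewrite mulA //; last exact: Ginv.
by have [_ ->] := mulV Gy; have [] := mul1 Gx.
Qed.

Lemma mul_injl x y y' : G x -> G y -> G y' -> mul x y = mul x y' -> y = y'.
Proof. by move=> Gx Gy Gy' E; rewrite -(mulKl Gx Gy) E mulKl. Qed.

Lemma mul_injr x x' y : G x -> G x' -> G y -> mul x y = mul x' y -> x = x'.
Proof. by move=> Gx Gx' Gy E; rewrite -(mulKr Gx Gy) E mulKr. Qed.

Lemma blocks_cl R a b c : DefO false A (blocks R) -> R a b c -> (forall c', R a b c' -> c' = c) ->
  forall z, z \in tval c ->
  cl ([set` A] `|` st a `|` st b `|` supp ([set` A] `|` st a `|` st b)) z.
Proof.
move=> DR Rc uc z /(@tnthP _ _ c)[i zi]; pose D := A ++ a ++ b.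
have DE : [set` A] `|` st a `|` st b = [set` D].
  by apply/seteqP; split=> y; rewrite /D /= !mem_cat;
    [move=> [[|]|] ->; rewrite ?orbT|move=> /orP[|/orP[|]]; [left; left|left; right|right]].
rewrite DE; apply: (@dclN_cl _ _ _ _ Lltf Lopf K tK D a0 (fun y => exists w, R a b w /\ tnth w i = y)).
- by rewrite mem_cat a0A.
- apply: (@DefO_exT _ _ _ _ _ _ (fun u w => R a b w /\ tnth w i = u 0)); apply: DefO_and.
    apply: (@DefO_eqv _ _ _ _ _ (fun u => blocks R (pre a (pre b u)))).
      by move=> u; rewrite /blocks tk_pre !shift_pre tk_pre
        (_ : (fun k => pre a (pre b u) (n + (n + k))) = u) //;
        apply/funext => k; rewrite !pre_ge ?size_tuple ?leq_addr ?addKn ?leq_addr // addKn.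
    apply: (@DefO_subst _ _ _ _ _ _ _ (fun u => pre a (pre b u)) DR) => [y yA|k].
      by rewrite mem_cat yA.
    case: (ltnP k n) => kn.
      right; exists (nth a0 a k); first by rewrite !mem_cat mem_nth ?orbT // size_tuple.
      by move=> u; rewrite (pre_lt a0) // size_tuple.
    case: (ltnP (k - n) n) => kn2.
      right; exists (nth a0 b (k - n)); first by rewrite !mem_cat mem_nth ?orbT // size_tuple.
      by move=> u; rewrite pre_ge ?size_tuple // (pre_lt a0) // size_tuple.
    by left; exists (k - n - n) => u; rewrite !pre_ge ?size_tuple.
  apply: (@DefO_eqv _ _ _ _ _ (fun u => u i = u (n + 0))); first by move=> u; rewrite tnth_tk.
  exact: DefO_eq.
- by exists c; split=> //; rewrite zi.
- by move=> y [w [/uc -> <-]]; rewrite zi.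
Qed.

Definition span (B : set K) (x : n.-tuple K) : Prop := forall z, z \in tval x -> cl B z.

Definition perm3 (f : nat -> nat) (k : nat) : nat :=
  if k < n then f 0 * n + k else if k - n < n then f 1 * n + (k - n)
  else if k - n - n < n then f 2 * n + (k - n - n) else k.

Lemma blocks_perm R f : DefO false A (blocks R) ->
  DefO false A (fun u => R (tk n (fun k => u (f 0 * n + k))) (tk n (fun k => u (f 1 * n + k)))
     (tk n (fun k => u (f 2 * n + k)))).
Proof.
move=> H; apply: DefO_eqv (DefO_rename (perm3 f) H) => u; rewrite /blocks.
have -> : tk n (fun k => u (perm3 f k)) = tk n (fun k => u (f 0 * n + k)).
  by apply: eq_from_tnth => i; rewrite !tnth_tk /perm3 ltn_ord.
have -> : tk n (fun k => u (perm3 f (n + k))) = tk n (fun k => u (f 1 * n + k)).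
  by apply: eq_from_tnth => i; rewrite !tnth_tk /perm3 ltnNge leq_addr /= addKn ltn_ord.
have -> // : tk n (fun k => u (perm3 f (n + (n + k)))) = tk n (fun k => u (f 2 * n + k)).
apply: eq_from_tnth => i; rewrite !tnth_tk /perm3 ltnNge leq_addr /= addKn.
by rewrite ltnNge leq_addr /= addKn ltn_ord.
Qed.

Lemma blocksE R u : blocks R u <-> R (tk n (fun k => u (0 * n + k))) (tk n (fun k => u (1 * n + k)))
  (tk n (fun k => u (2 * n + k))).
Proof.
rewrite /blocks mul0n mul1n mul2n -addnn.
have -> // : (fun k => u (n + n + k)) = (fun k => u (n + (n + k))).
by apply/funext => k; rewrite addnA.
Qed.

(** In a group any two of x, y and xy determine the third, and [blocks_cl] turns this definability
    with P into dependence over the support. *)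
Lemma mul_cl x y : G x -> G y ->
  [/\ forall z, z \in tval (mul x y) ->
        cl ([set` A] `|` st x `|` st y `|` supp ([set` A] `|` st x `|` st y)) z,
      forall z, z \in tval y ->
        cl ([set` A] `|` st x `|` st (mul x y) `|` supp ([set` A] `|` st x `|` st (mul x y))) z &
      forall z, z \in tval x ->
        cl ([set` A] `|` st y `|` st (mul x y) `|` supp ([set` A] `|` st y `|` st (mul x y))) z].
Proof.
move=> Gx Gy; split.
- by apply: blocks_cl DM _ _ => [|c [_ [_ <-]]].
- apply: (@blocks_cl (fun a b c => GM a c b)) => [||c [_ [Gc Ec]]].
  + apply: DefO_eqv (@blocks_perm GM (fun i => nth 0 [:: 0; 2; 1] i) DM) => u.
    by rewrite (blocksE (fun a b c => GM a c b)).
  + by split.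
  + exact: (@mul_injl x).
- apply: (@blocks_cl (fun a b c => GM c a b)) => [||c [Gc [_ Ec]]].
  + apply: DefO_eqv (@blocks_perm GM (fun i => nth 0 [:: 2; 0; 1] i) DM) => u.
    by rewrite (blocksE (fun a b c => GM c a b)).
  + by split.
  + exact: (@mul_injr _ _ y).
Qed.

Lemma span_tri B a b c : AP `<=` B -> span B a -> span B b ->
  (forall z, z \in tval c ->
  cl ([set` A] `|` st a `|` st b `|` supp ([set` A] `|` st a `|` st b)) z) -> span B c.
Proof.
move=> AB sa sb H z /H; apply: (pg_trans pg) => y [[[yA|/sa//]|/sb//]|[Py _]].
  by apply: (pg_ext pg); apply: AB; left.
by apply: (pg_ext pg); apply: AB; right.
Qed.

Lemma span_mul B x y : AP `<=` B -> G x -> G y -> span B x -> span B y -> span B (mul x y).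
Proof. by move=> AB Gx Gy sx sy; have [H _ _] := mul_cl Gx Gy; apply: span_tri H. Qed.

Lemma span_divl B x y : AP `<=` B -> G x -> G y -> span B x -> span B (mul x y) -> span B y.
Proof. by move=> AB Gx Gy sx sy; have [_ H _] := mul_cl Gx Gy; apply: span_tri H. Qed.

Lemma span_divr B x y : AP `<=` B -> G x -> G y -> span B y -> span B (mul x y) -> span B x.
Proof. by move=> AB Gx Gy sx sy; have [_ _ H] := mul_cl Gx Gy; apply: span_tri H. Qed.

Lemma span_inv B x : AP `<=` B -> G x -> span B x -> span B (inv x).
Proof.
move=> AB Gx sx; apply: (@span_divl B x) => //; first exact: Ginv.
have [_ ->] := mulV Gx; apply: (@span_divl B x) => //.
by have [_ ->] := mul1 Gx.
Qed.

Lemma span_st B x : st x `<=` B -> span B x.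
Proof. by move=> H z zx; apply: (pg_ext pg); apply: H. Qed.

Variable r : nat.
Hypothesis rmax : forall x, G x -> rk AP x <= r.
Hypothesis rex : exists2 x, G x & r <= rk AP x.

Definition gen (B : set K) (x : n.-tuple K) : Prop := G x /\ r <= rk (AP `|` B) x.

Lemma gen_sub B B' x : B `<=` AP `|` B' -> gen B' x -> gen B x.
Proof.
move=> BB' [Gx rx]; split=> //; apply: (leq_trans rx); apply: (rk_mono pg) => y [|/BB'//].
by left.
Qed.

Lemma gen0 B x : gen B x -> gen set0 x.
Proof. exact: gen_sub. Qed.

Lemma gen_mull B g x : gen B x -> G g -> span (AP `|` B) g -> gen B (mul g x).
Proof.
move=> [Gx rx] Gg sg; split; first exact: Gmul.
apply: (leq_trans rx); apply: (rk_sub pg); apply: (@span_divl _ g) => //.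
- by move=> y yA; left; left.
- by move=> z /sg; apply: (pg_mono pg) => y; left.
- by apply: span_st => y; right.
Qed.

Lemma gen_mulr B g x : gen B x -> G g -> span (AP `|` B) g -> gen B (mul x g).
Proof.
move=> [Gx rx] Gg sg; split; first exact: Gmul.
apply: (leq_trans rx); apply: (rk_sub pg); apply: (@span_divr _ _ g) => //.
- by move=> y yA; left; left.
- by move=> z /sg; apply: (pg_mono pg) => y; left.
- by apply: span_st => y; right.
Qed.

(** The pair has rank 2 r in one order, hence in the other, where the first term is at most r. *)
Lemma gen_sym x y : gen set0 x -> gen (st x) y -> gen (st y) x.
Proof.
move=> [Gx rx] [Gy ry]; split=> //; rewrite setU0 in rx.
have := rk_addC pg AP x y; have := rmax Gx; have := rmax Gy => ry' rx' E.
have : r + r <= rk AP y + rk (AP `|` st y) x by rewrite -E leq_add.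
by move=> H; rewrite -(leq_add2l r); apply: (leq_trans H); rewrite leq_add2r.
Qed.

(** As E is elementary with P, h is a conjugate of x0 over A. The last two clauses keep the elements
    of P in the range away from F outside A, and let h lose no rank over F. *)
Lemma copy (x0 : n.-tuple K) (F : seq K) : exists E (h : n.-tuple K),
  [/\ nice ltf E, forall a, a \in A -> (a, a) \in E, forall i, (tnth x0 i, tnth h i) \in E,
      forall y, rans E y -> P y -> y \in F -> y \in A &
      rk AP x0 <= rk ([set` A] `|` [set` F] `|` P) h].
Proof.
have a0E : (a0, a0) \in [seq (a, a) | a <- A] by apply: map_f.
have [E [h [nE EE [sh Hh] HF Hrk]]] := nice_extend Lltf Lopf tK x0 F a0E (nice_id Agood).
have sz : size h == n by rewrite sh size_tuple.
have d1 : doms [seq (x, x) | x <- A] = [set` A] by rewrite /doms -map_comp map_id.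
have r1 : rans [seq (x, x) | x <- A] = [set` A] by rewrite /rans -map_comp map_id.
rewrite d1 r1 in Hrk; exists E, (Tuple sz); split=> //.
- by move=> a aA; apply: EE; apply: map_f.
- by move=> i; rewrite !(tnth_nth a0) /=; apply: Hh; rewrite size_tuple.
- by move=> y yE Py yF; have := HF y yE Py yF; rewrite r1.
Qed.

Lemma copy_G (x0 h : n.-tuple K) E : nice ltf E -> (forall a, a \in A -> (a, a) \in E) ->
  (forall i, (tnth x0 i, tnth h i) \in E) -> G x0 -> G h.
Proof.
move=> nE inA inZ.
by have [] := elem_DefO a0A (nice_elem Lltf Lopf tK (inA _ a0A) nE) inA inZ DG.
Qed.

Lemma gen_ex (D : seq K) : exists x, gen [set` D] x.
Proof.
have [x0 Gx0 rx0] := rex; have [E [h [nE inA inZ _ Hrk]]] := copy x0 D.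
exists h; split; first exact: copy_G nE inA inZ Gx0.
apply: (leq_trans rx0); apply: (leq_trans Hrk); apply: (rk_mono pg) => y.
by move=> [[|]|]; [left; left|right|left; right].
Qed.

(** For each x finitely many elements of P suffice by [rk_finU]; compactness bounds their number,
    and with it the support of generic elements. *)
Lemma small_base_bound : exists k, forall x, G x -> exists q : seq K,
  [/\ size q <= k, forall p, p \in q -> P p & rk ([set` A] `|` [set` q]) x < r.+1].
Proof.
apply: contrapT => /forallNP nk.
pose W k (x : n.-tuple K) := exists q : seq K,
  [/\ size q <= k, forall p, p \in q -> P p & rk ([set` A] `|` [set` q]) x < r.+1].
pose CC (C : n.-tuple K -> Prop) := exists k Y, [/\ DefO false A (fun u => Y (tk n u)),
  forall x, Y x -> W k x & C = fun x => G x /\ ~ Y x].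
have [||||x Hx] := @sat_tuple _ _ _ _ K tK A a0 n CC.
- by move=> C [k [Y [DY _ ->]]]; apply: DefO_and => //; apply: DefO_not.
- exists (fun x => G x /\ ~ False), 0, (fun=> False); split=> //; exact: DefO_cst.
- move=> _ _ [k1 [Y1 [D1 H1 ->]]] [k2 [Y2 [D2 H2 ->]]].
  exists (fun x => G x /\ ~ (Y1 x \/ Y2 x)); last first.
    by move=> x [Gx nY]; split; split=> // ?; apply: nY; [left|right].
  exists (maxn k1 k2), (fun x => Y1 x \/ Y2 x); split=> //; first exact: DefO_or.
  by move=> x [/H1|/H2] [q [sq qP Hq]]; exists q; split=> //; rewrite leq_max sq ?orbT.
- move=> _ [k [Y [DY HY ->]]]; apply: contrapT => /forallNP nx; apply: (nk k) => x Gx.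
  by apply: contrapT => nW; apply: (nx x); split=> // /HY.
have hx k Y : DefO false A (fun u => Y (tk n u)) -> (forall x, Y x -> W k x) -> G x /\ ~ Y x.
  by move=> DY HY; apply: (Hx (fun x => G x /\ ~ Y x)); exists k, Y.
have [Gx _] := hx 0 (fun=> False) (@DefO_cst _ _ K false A False) (fun _ => False_ind _).
have /(rk_finU pg)[q [qP Hq]] : rk AP x < r.+1 by rewrite ltnS rmax.
have [Y [DY Yx HY]] := open_rk_tuple Lltf a0A erefl qP Hq.
have [|_ /(_ Yx)//] := hx (size q) Y DY.
by move=> x' /HY[q' [sq' q'P Hq']]; exists q'; split=> //; rewrite sq'.
Qed.

(** Each of g and h depends on the other, on gh and on their common support ([mul_cl]). As gh is
    independent of g and of h, [supp_union] splits that support, so what lies in the support of one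
    factor lies in that of gh or of the other factor. *)
Lemma supp_mul g h : gen set0 g -> gen (st g) h ->
  supp ([set` A] `|` st g) `|` supp ([set` A] `|` st h) `<=`
  supp ([set` A] `|` st (mul g h)) `|` (supp ([set` A] `|` st g) `&` supp ([set` A] `|` st h)).
Proof.
move=> gg gh; have hg := gen_sym gg gh.
have [[Gg _] [Gh _]] := (gg, gh); pose m := mul g h.
have [_ Hh Hg] := mul_cl Gg Gh.
have mg : gen (st g) m by apply: gen_mull => //; apply: span_st => y; right.
have mh : gen (st h) m by apply: gen_mulr => //; apply: span_st => y; right.
have Gm : G m by apply: Gmul.
have U (x : n.-tuple K) : gen (st x) m ->
    supp ([set` A] `|` st x `|` st m) `<=` supp ([set` A] `|` st x) `|` supp ([set` A] `|` st m).
  move=> [_ rm]; apply: (supp_union pg); apply: (leq_trans (rmax Gm)); apply: (leq_trans rm).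
  by apply: (rk_mono pg) => y [[|]|]; [left; left|right|left; right].
have S (x y : n.-tuple K) : (forall z, z \in tval y ->
    cl ([set` A] `|` st x `|` st m `|` supp ([set` A] `|` st x `|` st m)) z) -> gen (st x) m ->
    supp ([set` A] `|` st y) `<=` supp ([set` A] `|` st x) `|` supp ([set` A] `|` st m).
  move=> H xm p sp; apply: U => //; apply: (supp_supp pg); apply: (supp_cl pg) sp => z.
  by case=> [zA|/H//]; apply: (pg_ext pg); left; left; left.
move=> p [pg_|ph].
  by case: (S h g Hg mh _ pg_) => [ph|pm]; [right|left].
by case: (S g h Hh mg _ ph) => [pg_|pm]; [right|left].
Qed.

(* The support of a generic element doubles under multiplication with an
   independent copy, while it has bounded size. *)
Lemma supp_gen x : gen set0 x -> supp ([set` A] `|` st x) `<=` [set` A].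
Proof.
pose pk k := exists g t, [/\ gen set0 g, uniq t, size t = k &
   forall p, p \in t -> supp ([set` A] `|` st g) p /\ p \notin A].
have [k0 Hk0] := small_base_bound.
have bnd k : `[< pk k >] -> k <= k0.
  move=> /asboolP[g [t [[Gg rg] ut <- Ht]]]; rewrite setU0 in rg.
  (* Over A and q the rank of g is at most r, its rank over P; so g adds no support there and t is
     contained in q. *)
  have [q [sq qP Hq]] := Hk0 g Gg; apply: (leq_trans _ sq); apply: uniq_leq_size => // p pt.
  have [sp pA] := Ht p pt.
  have H : supp ([set` A] `|` [set` q] `|` st g) `<=` supp ([set` A] `|` [set` q]).
    apply: (rk_supp_sub pg); rewrite ltnS in Hq; apply: (leq_trans Hq); apply: (leq_trans rg).
    apply: (rk_anti pg) => y; case=> [[yA|/= /qP Py]|Py]; apply: (pg_ext pg); by [left|right].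
  have : supp ([set` A] `|` [set` q]) p.
    by apply: H; apply: (supp_mono pg) sp => y [yA|yg]; [left; left|right].
  by case/(supp_UP pg) => [y /= /qP//|/Agood /= pA'|//]; rewrite pA' in pA.
have ex0 : exists k, `[< pk k >].
  have [x0 Gx0 rx0] := rex; exists 0; apply/asboolP; exists x0, [::]; split=> //.
  by split=> //; rewrite setU0.
have [k /asboolP[g [t [gg ut st_ Ht]]] kmax] := ex_maxnP ex0 bnd.
suff k_0 : k = 0.
  move=> gx p sp; apply: contrapT => /negP pA; have : 1 <= k.
    by apply: kmax; apply/asboolP; exists x, [:: p]; split=> // q; rewrite inE => /eqP->.
  by rewrite k_0.
have [tg Htg] := supp_list Lltf tK (A ++ g).
have AgE : [set` A ++ g] = [set` A] `|` st g.
  by apply/seteqP; split=> y /=; rewrite mem_cat => /orP.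
rewrite AgE in Htg; have [Gg rg] := gg; rewrite setU0 in rg.
(* Avoiding [tg] makes the supports of g and h disjoint outside A; including the coordinates of g
   makes h independent of g. *)
have [E [h [nE inA inZ HF Hrk]]] := copy g (tg ++ g).
have gh : gen (st g) h.
  split; first exact: copy_G nE inA inZ Gg.
  apply: (leq_trans rg); apply: (leq_trans Hrk); apply: (rk_mono pg) => y.
  by move=> [[|]|/= yg]; [left; left|right|left; right; rewrite /= mem_cat yg orbT].
have [EE EP Ed Er] := nE.
have disj p : supp ([set` A] `|` st g) p -> supp ([set` A] `|` st h) p -> p \in A.
  move=> pg_ ph; apply: HF; last 2 first.
  - by case: pg_.
  - by rewrite mem_cat; apply/orP; left; move: pg_; rewrite -Htg.
  apply: Er; apply: (supp_mono pg) ph => y [/= /inA/mem_rans//|].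
  by case/(@tnthP _ _ h) => i ->; apply: mem_rans (inZ i).
have image p : supp ([set` A] `|` st g) p -> p \notin A ->
    exists p', [/\ (p, p') \in E, supp ([set` A] `|` st h) p' & p' \notin A].
  move=> sp pA; have [p' pE] : exists p', (p, p') \in E.
    apply: doms_ex; apply: Ed; apply: (supp_mono pg) sp => y [/= /inA/mem_doms//|].
    by case/(@tnthP _ _ g) => i ->; apply: mem_doms (inZ i).
  exists p'; split=> //; last first.
    apply: contraNN pA => pA; have := elem_eq (elem_swap EE) (x := p') (y := p) (y' := p').
    by rewrite !mem_swap => -> //; apply: inA.
  pose v k := if k is j.+1 then (if j < size A then (nth a0 A j, nth a0 A j)
     else if j - size A < n then nth (a0, a0) (zip g h) (j - size A) else (a0, a0)) else (p, p').
  have vE j : v j \in E.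
    case: j => [//|j] /=; case: ltnP => jA; first exact/inA/mem_nth.
    case: ltnP => jn; last exact: inA.
    by have := inZ (Ordinal jn); rewrite !(tnth_nth a0) nth_zip ?size_tuple.
  have H (q : K * K -> K) (z : n.-tuple K) : (forall x, q (x, x) = x) ->
      (forall i, q (tnth g i, tnth h i) = tnth z i) ->
      vals (leq 1) (fun k => q (v k)) = [set` A] `|` st z.
    move=> qq qz; apply/seteqP; split=> y.
      case=> -[|j] //= _ ->; case: ltnP => jA; first by left; rewrite qq /= mem_nth.
      case: ltnP => jn; last by left; rewrite qq.
      have := qz (Ordinal jn); rewrite !(tnth_nth a0) nth_zip ?size_tuple //= => ->.
      by right; rewrite /= mem_nth // size_tuple.
    case=> [/= yA|/(@tnthP _ _ z)[i ->]].
      by exists (index y A).+1 => //=; rewrite index_mem yA qq nth_index.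
    exists (size A + i).+1 => //=; rewrite ltnNge leq_addr /= addKn ltn_ord.
    by rewrite nth_zip ?size_tuple // -!tnth_nth qz.
  have := elem_open (nice_elem Lltf Lopf tK (inA _ a0A) nE) (@open_supp (leq 1)) vE.
  by rewrite (H fst g) // (H snd h) //; apply.
have [t' [ut' st' Ht']] : exists t', [/\ uniq t', size t' = size t & forall y, y \in t' ->
    exists2 p, p \in t & [/\ (p, y) \in E, supp ([set` A] `|` st h) y & y \notin A]].
  elim: (t) ut Ht => [|p t0 IH] /= ut Ht; first by exists [::].
  have /andP[pt0 ut0] := ut.
  have [|t' [ut' st' Ht']] := IH ut0; first by move=> q qt; apply: Ht; rewrite inE qt orbT.
  have [sp pA] := Ht p (mem_head _ _); have [p' [pE sp' p'A]] := image p sp pA.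
  exists (p' :: t'); split=> /=; last 2 first.
  - by rewrite st'.
  - move=> y; rewrite inE => /orP[/eqP->|/Ht'[q qt Hq]]; first by exists p; rewrite ?mem_head.
    by exists q => //; rewrite inE qt orbT.
  rewrite ut' andbT; apply/negP => /Ht'[q qt [qE _ _]].
  have := elem_eq (elem_swap EE) (x := p') (y := p) (y' := q).
  by rewrite !mem_swap => /(_ pE qE) pq; rewrite pq qt in pt0.
have : size (t ++ t') <= k.
  apply: kmax; apply/asboolP; exists (mul g h), (t ++ t'); split=> //.
  - apply: (@gen0 (st g)); apply: gen_mull => //.
    by apply: span_st => y; right.
  - rewrite cat_uniq ut ut' /= andbT; apply/hasPn => y /Ht'[q qt [_ sy yA]].
    by apply: contra yA => yt; apply: disj => //; have [] := Ht y yt.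
  - move=> p; rewrite mem_cat => pt.
    have [sp pA] : (supp ([set` A] `|` st g) `|` supp ([set` A] `|` st h)) p /\ p \notin A.
      by case/orP: pt => [/Ht[? ?]|/Ht'[q _ []]]; split=> //; [left|right].
    split=> //; case: (supp_mul gg gh sp) => [//|[s1 s2]].
    by rewrite (disj _ s1 s2) in pA.
rewrite size_cat st' st_ -{3}[k]addn0 leq_add2l leqn0 => /eqP; exact.
Qed.

Lemma rk_gen_L x : gen set0 x -> rk [set` A] x <= r.
Proof. by move=> gx; rewrite -(rk_good pg (supp_gen gx)); apply: rmax; case: gx. Qed.

Lemma rk_GM x y z : GM x y z -> rk AP (x ++ y ++ z) = rk AP (x ++ y).
Proof.
move=> [Gx [Gy <-]].
have H : span (AP `|` [set` tval x ++ tval y]) (mul x y).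
  apply: span_mul => //; apply: span_st => w wx;
    by right; rewrite /= mem_cat wx ?orbT.
by rewrite catA rk_cat (rk_eq0 pg H) addn0.
Qed.

Lemma gen_pair (x y : n.-tuple K) : G x -> G y -> r + r <= rk AP (x ++ y) -> gen set0 x /\ gen (st x) y.
Proof.
move=> Gx Gy; rewrite rk_cat => H; split; split=> //; rewrite ?setU0.
  rewrite -(leq_add2r r); apply: (leq_trans H); rewrite leq_add2l; apply: leq_trans (rmax Gy).
  by apply: (rk_mono pg) => z; left.
by rewrite -(leq_add2l r); apply: (leq_trans H); rewrite leq_add2r rmax.
Qed.

(** For a generic pair all support lies in A, so the product depends on A, x and y alone. This is
    the bound that [generic_L_definable] demands. *)
Lemma GM_rk_L (x y z : n.-tuple K) : r + r <= rk AP (x ++ y ++ z) -> GM x y z -> rk [set` A] (x ++ y ++ z) <= r + r.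
Proof.
move=> rxyz M; rewrite (rk_GM M) in rxyz; have [Gx [Gy Ez]] := M.
have [gx gy] := gen_pair Gx Gy rxyz; have gy0 := gen0 gy.
have sxy : supp ([set` A] `|` st x `|` st y) `<=` [set` A].
  move=> p sp; have : (supp ([set` A] `|` st x) `|` supp ([set` A] `|` st y)) p.
    apply: (supp_union pg) sp; apply: (leq_trans (rmax Gy)); have [_ ry] := gy.
    by apply: (leq_trans ry); apply: (rk_mono pg) => w [[|]|]; [left; left|right|left; right].
  by case=> [/(supp_gen gx)|/(supp_gen gy0)].
rewrite rk_cat; apply: leq_add; first exact: rk_gen_L.
rewrite rk_cat (rk_eq0 pg (s := z)) ?addn0.
  by apply: leq_trans (rk_gen_L gy0); apply: (rk_mono pg) => w; left.
have [H _ _] := mul_cl Gx Gy; rewrite -Ez => w /H; apply: (pg_mono pg) => w'.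
by case=> [//|/sxy wA]; left; left.
Qed.

Lemma chunk_ex : exists2 F : n.-tuple K -> n.-tuple K -> n.-tuple K -> Prop,
  DefO true A (blocks F) & [/\ forall x y z z', F x y z -> F x y z' -> z = z',
    forall x y y' z, F x y z -> F x y' z -> y = y',
    forall x x' y z, F x y z -> F x' y z -> x = x' &
    forall x y z : n.-tuple K, r + r <= rk AP (x ++ y ++ z) -> (F x y z <-> GM x y z)].
Proof.
pose c3 (x y z : n.-tuple K) := cat_tuple x (cat_tuple y z).
have c3_inj x y z x' y' z' : c3 x y z = c3 x' y' z' -> [/\ x = x', y = y' & z = z'].
  move=> /(congr1 val) /= /eqP; rewrite eqseq_cat ?size_tuple //.
  by rewrite eqseq_cat ?size_tuple // => /and3P[/eqP/val_inj-> /eqP/val_inj-> /eqP/val_inj->].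
pose Q (t : (n + (n + n)).-tuple K) := exists x y z, t = c3 x y z /\ GM x y z.
have QE x y z : Q (c3 x y z) <-> GM x y z.
  by split=> [[x' [y' [z' [/c3_inj[-> -> ->]]]]]|M] //; exists x, y, z.
have tE (u : nat -> K) : tk (n + (n + n)) u =
    c3 (tk n u) (tk n (fun k => u (n + k))) (tk n (fun k => u (n + (n + k)))).
  by rewrite !tk_cat.
have [||phi Dphi Hphi] := @generic_L_definable _ _ _ _ Lltf Lopf K tK A a0 a0A Agood _ (r + r) Q.
- by apply: DefO_eqv DM => u; rewrite tE QE.
- by move=> t rt [x [y [z [Et M]]]]; rewrite Et in rt *; apply: GM_rk_L.
pose F0 x y z := phi (c3 x y z).
have DF0 : DefO true A (blocks F0) by apply: DefO_eqv Dphi => u; rewrite tE.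
have HF0 (x y z : n.-tuple K) : r + r <= rk AP (x ++ y ++ z) -> (F0 x y z <-> GM x y z).
  by move=> rxyz; rewrite -QE; symmetry; apply: Hphi.
(* Away from generic triples F0 is arbitrary, so it is cut down to triples in which any two entries
   determine the third. Triples of rank 2 r in [GM] survive: a competitor such as (x, y', z)
   generates x and y, so it has rank at least 2 r too, and there F0 is the group law. *)
pose F x y z := F0 x y z /\ ((forall z', F0 x y z' -> z' = z) /\
  ((forall y', F0 x y' z -> y' = y) /\ forall x', F0 x' y z -> x' = x)).
exists F; last split.
- have tkeq j l (u : nat -> K) : tk n (fun k => u (j + k)) = tk n (fun k => u (l + k)) <->
      forall i : 'I_n, u (j + i) = u (l + i).
    split=> [/(congr1 (fun t => tnth t)) E i|H].
      by have := congr1 (fun f => f i) E; rewrite !tnth_tk.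
    by apply: eq_from_tnth => i; rewrite !tnth_tk.
  have Deq j l : DefO true A (fun u : nat -> K => tk n (fun k => u (j + k)) = tk n (fun k => u (l + k))).
    have H : DefO true A (fun u : nat -> K => forall i : 'I_n, u (j + i) = u (l + i)).
      by apply: DefO_all_fin => i; apply: DefO_eq.
    by apply: DefO_eqv H => u; rewrite tkeq.
  have D3 a b c : DefO true A (fun u : nat -> K => F0 (tk n (fun k => u (a * n + k)))
      (tk n (fun k => u (b * n + k))) (tk n (fun k => u (c * n + k)))).
    apply: DefO_eqv (DefO_rename (perm3 (fun i => nth 0 [:: a; b; c] i)) DF0) => u; rewrite /blocks.
    have -> : tk n (fun k => u (perm3 (fun i => nth 0 [:: a; b; c] i) k)) = tk n (fun k => u (a * n + k)).
      by apply: eq_from_tnth => i; rewrite !tnth_tk /perm3 ltn_ord.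
    have -> : tk n (fun k => u (perm3 (fun i => nth 0 [:: a; b; c] i) (n + k))) = tk n (fun k => u (b * n + k)).
      by apply: eq_from_tnth => i; rewrite !tnth_tk /perm3 ltnNge leq_addr /= addKn ltn_ord.
    have -> // : tk n (fun k => u (perm3 (fun i => nth 0 [:: a; b; c] i) (n + (n + k)))) =
                 tk n (fun k => u (c * n + k)).
    apply: eq_from_tnth => i; rewrite !tnth_tk /perm3 ltnNge leq_addr /= addKn.
    by rewrite ltnNge leq_addr /= addKn ltn_ord.
  have sh (u : nat -> K) a : (fun k => u (n + (a * n + k))) = (fun k => u (a.+1 * n + k)).
    by apply/funext => k; rewrite mulSn addnA.
  have s0 (u : nat -> K) : tk n u = tk n (fun k => u (0 * n + k)) by rewrite mul0n.
  apply: (@DefO_eqv _ _ _ _ _ (fun u => F (tk n (fun k => u (0 * n + k)))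
      (tk n (fun k => u (1 * n + k))) (tk n (fun k => u (2 * n + k))))).
    by move=> u; rewrite blocksE.
  apply: DefO_and; first exact: D3.
  apply: DefO_and.
    apply: DefO_allT; apply: DefO_imp.
      by apply: DefO_eqv (D3 1 2 0) => u; rewrite !sh -s0.
    by apply: DefO_eqv (Deq (0 * n) (3 * n)) => u; rewrite !sh -s0.
  apply: DefO_and.
    apply: DefO_allT; apply: DefO_imp.
      by apply: DefO_eqv (D3 1 0 3) => u; rewrite !sh -s0.
    by apply: DefO_eqv (Deq (0 * n) (2 * n)) => u; rewrite !sh -s0.
  apply: DefO_allT; apply: DefO_imp.
    by apply: DefO_eqv (D3 0 2 3) => u; rewrite !sh -s0.
  by apply: DefO_eqv (Deq (0 * n) (1 * n)) => u; rewrite !sh -s0.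
- by move=> x y z z' [Fz _] [_ [H _]]; apply: H.
- by move=> x y y' z [Fz _] [_ [_ [H _]]]; apply: H.
- by move=> x x' y z [Fz _] [_ [_ [_ H]]]; apply: H.
move=> x y z rxyz; split=> [[/(HF0 _ _ _ rxyz)]//|M].
have rxy : r + r <= rk AP (x ++ y) by rewrite -(rk_GM M).
have [Gx [Gy Ez]] := M; split; first exact/HF0.
split; last split.
- move=> z' Fz'; have [|H _] := HF0 x y z'.
    by rewrite catA rk_cat; apply: (leq_trans rxy); rewrite leq_addr.
  by have [_ [_ <-]] := H Fz'.
- move=> y' Fy'; have [|H _] := HF0 x y' z.
    apply: (leq_trans rxy); apply: (rk_sub pg) => w; rewrite mem_cat => /orP[wx|].
      by apply: (pg_ext pg); right; rewrite /= mem_cat wx.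
    have H : span (AP `|` [set` tval x ++ tval y' ++ tval z]) y; last exact: H.
    by apply: (@span_divl _ x y) => //; rewrite ?Ez; apply: span_st => w' ww;
      right; rewrite /= !mem_cat ww ?orbT.
  by have [_ [Gy' Ey']] := H Fy'; apply: (@mul_injl x) => //; rewrite Ey'.
- move=> x' Fx'; have [|H _] := HF0 x' y z.
    apply: (leq_trans rxy); apply: (rk_sub pg) => w; rewrite mem_cat => /orP[|wy]; last first.
      by apply: (pg_ext pg); right; rewrite /= !mem_cat wy orbT.
    have H : span (AP `|` [set` tval x' ++ tval y ++ tval z]) x; last exact: H.
    by apply: (@span_divr _ x y) => //; rewrite ?Ez; apply: span_st => w' ww;
      right; rewrite /= !mem_cat ww ?orbT.
  by have [Gx' [_ Ex']] := H Fx'; apply: (@mul_injr _ _ y) => //; rewrite Ex'.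
Qed.


(** * Independent sequences of generic elements *)

Section Chunk.
Variable F : n.-tuple K -> n.-tuple K -> n.-tuple K -> Prop.
Hypothesis DF : DefO true A (blocks F).
Hypothesis F3 : forall x y z z', F x y z -> F x y z' -> z = z'.
Hypothesis F2 : forall x y y' z, F x y z -> F x y' z -> y = y'.
Hypothesis F1 : forall x x' y z, F x y z -> F x' y z -> x = x'.
Hypothesis FG : forall x y z : n.-tuple K, r + r <= rk AP (x ++ y ++ z) -> (F x y z <-> GM x y z).

Lemma F_of_rk (x y z : n.-tuple K) : r + r <= rk AP (x ++ y) -> (F x y z <-> GM x y z).
Proof. by move=> H; apply: FG; rewrite catA rk_cat; apply: (leq_trans H); rewrite leq_addr. Qed.

Lemma F_span B x y z : AP `<=` B -> F x y z ->
  [/\ span B x -> span B y -> span B z, span B x -> span B z -> span B y &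
      span B y -> span B z -> span B x].
Proof.
move=> AB Fxyz; have DF' := DefO_weak DF; split=> s1 s2; apply: (span_tri AB s1 s2).
- by apply: (blocks_cl DF') => // c /F3; apply.
- apply: (@blocks_cl (fun a b c => F a c b)) => [||c Fc]; last exact: F2 Fxyz.
    apply: DefO_eqv (@blocks_perm F (fun i => nth 0 [:: 0; 2; 1] i) DF') => u.
    by rewrite (blocksE (fun a b c => F a c b)).
  by [].
- apply: (@blocks_cl (fun a b c => F c a b)) => [||c Fc]; last exact: F1 Fxyz.
    apply: DefO_eqv (@blocks_perm F (fun i => nth 0 [:: 2; 0; 1] i) DF') => u.
    by rewrite (blocksE (fun a b c => F c a b)).
  by [].
Qed.

Fixpoint indep_seq (B : set K) (L : seq (n.-tuple K)) : Prop :=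
  if L is x :: L' then gen B x /\ indep_seq (B `|` st x) L' else True.

Lemma gen_cl B B' x : B `<=` cl (AP `|` B') -> gen B' x -> gen B x.
Proof.
move=> BB' [Gx rx]; split=> //; apply: (leq_trans rx); apply: (rk_anti pg) => y [yA|/BB'//].
by apply: (pg_ext pg); left.
Qed.

Lemma indep_seq_cl B B' L : B `<=` cl (AP `|` B') -> indep_seq B' L -> indep_seq B L.
Proof.
elim: L B B' => //= x L IH B B' BB' [gx HL]; split; first exact: gen_cl gx.
apply: IH HL => y [/BB'|yx]; first by apply: (pg_mono pg) => z [|]; [left|right; left].
by apply: (pg_ext pg); right; right.
Qed.

Lemma indep_seq_ex k (D : seq K) : exists L : k.-tuple (n.-tuple K), indep_seq [set` D] L.
Proof.
elim: k D => [|k IH] D; first by exists [tuple].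
have [x gx] := gen_ex D; have [L HL] := IH (D ++ x).
exists [tuple of x :: L]; split=> //; apply: indep_seq_cl HL => y yD; apply: (pg_ext pg); right.
by case: yD => /= yD; rewrite mem_cat yD ?orbT.
Qed.

Lemma indep_seq_sub B L L' : subseq L' L -> indep_seq B L -> indep_seq B L'.
Proof.
elim: L B L' => [|x L IH] B [|y L'] //= sub [gx HL].
have sB : B `<=` cl (AP `|` (B `|` st x)) by move=> z Bz; apply: (pg_ext pg); right; left.
case: eqP sub => [->|_] sub; first by split=> //; apply: IH HL.
by have := IH _ (y :: L') sub HL; apply: indep_seq_cl.
Qed.

(** Only the first entry at which y becomes dependent has to go. Later entries are independent over
    a base whose closure contains y, and earlier ones keep their rank over y, since y stays
    independent of them. *)
Lemma indep_seq_drop1 (J : eqType) (a : J -> n.-tuple K) (s : seq J) B y :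
  indep_seq B (map a s) -> exists s', [/\ subseq s' s, size s <= (size s').+1 &
    indep_seq (B `|` [set y]) (map a s')].
Proof.
elim: s B => [|i s IH] B /=; first by exists [::].
move=> [gi Hs]; case: (pselect (cl (AP `|` (B `|` st (a i))) y)) => cy.
  exists s; split=> //; first exact: subseq_cons.
  by apply: indep_seq_cl Hs => z [Bz|->//]; apply: (pg_ext pg); right; left.
have [s' [ss' sz Hs']] := IH _ Hs; exists (i :: s'); split=> /=; first by rewrite eqxx.
  by rewrite ltnS.
split; last first.
  apply: indep_seq_cl Hs' => z Hz; apply: (pg_ext pg); right.
  by case: Hz => [[|]|]; [left; left|right|left; right].
have [Gi ri] := gi; split=> //; rewrite setUA in cy *.
have := rk_addC pg (AP `|` B) [:: y] (a i).
have -> : rk (AP `|` B `|` st (a i)) [:: y] = 1 by rewrite /= asboolF.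
have -> : [set` [:: y]] = [set y].
  by apply/seteqP; split=> z; rewrite /= inE => /eqP.
by have := rk_size cl (AP `|` B) [:: y]; rewrite [size _]/= setUA; lia.
Qed.

Lemma indep_seq_drop (J : eqType) (a : J -> n.-tuple K) (s : seq J) B (D : seq K) :
  indep_seq B (map a s) -> exists s', [/\ subseq s' s, size s <= size s' + size D &
    indep_seq (B `|` [set` D]) (map a s')].
Proof.
elim: D B s => [|y D IH] B s Hs.
  exists s; split=> //; first by rewrite addn0.
  by apply: indep_seq_cl Hs => z [Bz|//]; apply: (pg_ext pg); right.
have [s1 [ss1 sz1 Hs1]] := indep_seq_drop1 y Hs; have [s2 [ss2 sz2 Hs2]] := IH _ _ Hs1.
exists s2; split; first exact: subseq_trans ss1.
  by apply: (leq_trans sz1); rewrite /= addnS ltnS.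
by rewrite setU_cons.
Qed.

Lemma indep_seq_rk B (L : seq (n.-tuple K)) : indep_seq B L ->
  r * size L <= rk (AP `|` B) (flatten (map val L)).
Proof.
elim: L B => [|x L IH] B /=; first by rewrite muln0.
move=> [[_ rx] /IH HL]; rewrite mulnS rk_cat leq_add // -setUA.
exact: HL.
Qed.

Lemma generic_almost (k : nat) (L : k.-tuple (n.-tuple K)) B (D : seq K) : indep_seq B L ->
  exists2 S : {set 'I_k}, k <= #|S| + size D & forall l : seq 'I_k, uniq l -> {subset l <= S} ->
    r * size l <= rk (AP `|` (B `|` [set` D])) (flatten [seq val (tnth L i) | i <- l]).
Proof.
move=> HL; have EL : [seq tnth L i | i <- enum 'I_k] = L by rewrite -[RHS](map_tnth_enum L).
have [|s [ss sz Hs]] := @indep_seq_drop _ (tnth L) (enum 'I_k) B D; first by rewrite EL.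
have us : uniq s by apply: subseq_uniq ss (enum_uniq _).
exists (finset (fun i => i \in s)).
  by move: sz; rewrite size_enum_ord cardsE (card_uniqP us).
move=> l ul ls; pose l0 := [seq i <- s | i \in l].
have pl : perm_eq l l0.
  apply: uniq_perm => //; first exact: filter_uniq.
  move=> i; rewrite mem_filter; case: (boolP (i \in l)) => //= il.
  by have := ls _ il; rewrite inE.
have H0 : indep_seq (B `|` [set` D]) (map (tnth L) l0).
  by apply: indep_seq_sub Hs; apply: map_subseq; apply: filter_subseq.
rewrite (perm_size pl); have := indep_seq_rk H0; rewrite size_map => /leq_trans; apply.
rewrite -map_comp leq_eqVlt; apply/orP; left; apply/eqP; apply: (rk_perm pg).
by apply: perm_flatten; apply: perm_map; rewrite perm_sym.
Qed.

Lemma card_almostI (k N N' : nat) (S S' : {set 'I_k}) :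
  k <= #|S| + N -> k <= #|S'| + N' -> k <= #|S :&: S'| + (N + N').
Proof.
move=> H H'; have := cardsUI S S'; have U : #|S :|: S'| <= k.
  by apply: leq_trans (max_card _) _; rewrite card_ord.
by move=> E; lia.
Qed.

(** Generic pairs are recognized by recovering two independent test points u and v from them over
    X. *)
Lemma rk_pair_le X (u v u' v' : n.-tuple K) : AP `<=` X -> r + r <= rk X (u ++ v) ->
  span (X `|` st u' `|` st v') u -> span (X `|` st u' `|` st v') v ->
  r + r <= rk AP (u' ++ v').
Proof.
move=> AX H su sv; apply: (leq_trans H); apply: (@leq_trans (rk X (u' ++ v'))); last first.
  exact: (rk_mono pg).
have E : X `|` [set` tval u' ++ tval v'] = X `|` st u' `|` st v'.
  rewrite -setUA; congr (_ `|` _).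
  by apply/seteqP; split=> y /=; rewrite mem_cat => /orP.
by apply: (rk_sub pg) => z; rewrite mem_cat E => /orP[/su|/sv].
Qed.

Lemma span_mono B B' x : B `<=` B' -> span B x -> span B' x.
Proof. by move=> BB' sx z /sx; apply: (pg_mono pg). Qed.

Lemma span_inv' B x : AP `<=` B -> G x -> span B (inv x) -> span B x.
Proof.
move=> AB Gx sx; apply: (@span_divl B (inv x)) => //; first exact: Ginv.
have [-> _] := mulV Gx; apply: (@span_divl B (inv x)) => //; first exact: Ginv.
by have [_ ->] := mul1 (Ginv Gx).
Qed.

(** * Charts from translations and test points *)

Section Charts.
(** The n coordinates of an element spoil at most n of n + 1 translations, so one stays generic over
    it. Two sets of test points that omit at most 9 n indices each must share three, for p, q and s
    in [MUL], whence 18 n + 3. *)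
Variables (a : ((18 * n).+3).-tuple (n.-tuple K)) (e_ : (n.+1).-tuple (n.-tuple K)).
Local Notation m := (18 * n).+3.
Local Notation Ce := [set` flatten (map val e_)].
Hypothesis ind_e : indep_seq set0 e_.
Hypothesis ind_a : indep_seq Ce a.
Local Notation a_ p := (tnth a p).

Lemma indep_seq_G B L x : indep_seq B L -> x \in L -> G x.
Proof.
elim: L B => //= y L IH B [[Gy _] HL]; rewrite inE => /orP[/eqP->//|].
exact: IH HL.
Qed.

Lemma Ga p : G (a_ p).
Proof. exact: indep_seq_G ind_a (mem_tnth _ _). Qed.

Lemma Gch i : G (tnth e_ i).
Proof. exact: indep_seq_G ind_e (mem_tnth _ _). Qed.

Ltac inG := repeat first [apply: Gmul | apply: Ginv | apply: Ga | apply: Gch | assumption].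

Lemma span_ch B i : Ce `<=` B -> span B (tnth e_ i).
Proof.
move=> CB; apply: span_st => y yx; apply: CB; apply/flattenP.
by exists (val (tnth e_ i)) => //; apply/map_f/mem_tnth.
Qed.

Lemma generic_a (D : seq K) : exists2 S : {set 'I_m}, m <= #|S| + size D &
  forall l : seq 'I_m, uniq l -> {subset l <= S} ->
    r * size l <= rk (AP `|` (Ce `|` [set` D])) (flatten [seq val (a_ i) | i <- l]).
Proof. exact: generic_almost. Qed.

Lemma rk_two X (S : {set 'I_m}) p q :
  (forall l : seq 'I_m, uniq l -> {subset l <= S} ->
    r * size l <= rk X (flatten [seq val (a_ i) | i <- l])) ->
  p \in S -> q \in S -> p != q -> r + r <= rk X (a_ p ++ a_ q).
Proof.
move=> Hl pS qS pq; have := Hl [:: p; q]; rewrite /= inE pq /= cats0 muln2 addnn; apply=> // j.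
by rewrite !inE => /orP[]/eqP->.
Qed.

Lemma cover g : G g -> exists i, gen set0 (mul g (tnth e_ i)).
Proof.
move=> Gg; have [S] := generic_almost g ind_e; rewrite size_tuple => HS Hl.
have /card_gt0P[i iS] : 0 < #|S| by move: HS; lia.
exists i; have := Hl [:: i] isT; rewrite muln1 /= cats0 => H.
apply: (@gen0 (st g)); apply: gen_mull => //; last by apply: span_st => y; right.
split; first exact: Gch.
have -> : AP `|` st g = AP `|` (set0 `|` [set` g]) by rewrite set0U.
by apply: H => j; rewrite inE => /eqP->.
Qed.

Definition xpq p q := mul (inv (a_ p)) (a_ q).

(* Being large in 'I_m replaces genericity of the test points a_ p over y, which
   is not a definable condition: y is charted if F y (a_ p) is the image of a_ p
   under left translation by one and the same element for almost all p. *)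
Definition charted y := exists S : {set 'I_m}, m <= #|S| + n /\
  forall p q, p \in S -> q \in S -> p != q ->
  exists c d, F y (a_ p) c /\ (F y (a_ q) d /\ F c (xpq p q) d).

(** The element g is the one by which y acts on almost all test points; y itself need not lie in G.
    Of the 2 n exceptions, n are those allowed in [charted] and n are test points not generic over
    y. *)
Definition Rep y g := G g /\ exists S : {set 'I_m}, m <= #|S| + 2 * n /\
  forall p, p \in S -> F y (a_ p) (mul g (a_ p)).

Lemma Rep_common y g y' g' : Rep y g -> Rep y' g' ->
  exists p, F y (a_ p) (mul g (a_ p)) /\ F y' (a_ p) (mul g' (a_ p)).
Proof.
move=> [_ [S [HS H]]] [_ [S' [HS' H']]].
have HI := card_almostI HS HS'.
have /card_gt0P[p] : 0 < #|S :&: S'| by move: HI; lia.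
by rewrite inE => /andP[pS pS']; exists p; split; [apply: H|apply: H'].
Qed.

Lemma Rep_uniq y g g' : Rep y g -> Rep y g' -> g = g'.
Proof.
move=> Hg Hg'; have [p [H H']] := Rep_common Hg Hg'.
have [[Gg _] [Gg' _]] := (Hg, Hg').
by apply: (@mul_injr _ _ (a_ p)) => //; [apply: Ga|apply: F3 H H'].
Qed.

Lemma Rep_inj y y' g : Rep y g -> Rep y' g -> y = y'.
Proof. by move=> H H'; have [p [Fy Fy']] := Rep_common H H'; apply: F1 Fy Fy'. Qed.

Lemma rk_xpq X (y c : n.-tuple K) p q : AP `<=` X -> st y `<=` X ->
  r + r <= rk X (a_ p ++ a_ q) -> (span (X `|` st c) (a_ p)) ->
  r + r <= rk AP (c ++ xpq p q).
Proof.
move=> AX yX H sp; apply: (rk_pair_le AX H).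
  by apply: span_mono sp => z; left.
have sub : AP `<=` X `|` st c `|` st (xpq p q) by move=> z /AX; left; left.
apply: (@span_divl _ (inv (a_ p))) => //; [by inG|by inG| |].
  by apply: span_inv => //; [inG|apply: span_mono sp => z; left].
by apply: span_st => z; right.
Qed.

(** The element is c a_p^-1, where F y (a_p) c. On test points generic over y, F recovers a_p from y
    and c, so c and a_p^-1 a_q form a pair of rank 2 r, where F is the group law. Hence c lies in G,
    and c a_p^-1 a_q is the F-image of a_q for almost all q. *)
Lemma Rep_of_charted y : charted y -> exists g, Rep y g.
Proof.
move=> [S [HS H]]; have [S' HS' Hl] := generic_a y; rewrite size_tuple in HS'.
have HI := card_almostI HS HS'; set T := S :&: S' in HI.
pose X := AP `|` (Ce `|` [set` y]).
have AX : AP `<=` X by left.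
have yX : st y `<=` X by move=> z zy; right; right.
have TG p q c d : p \in T -> q \in T -> p != q -> F y (a_ p) c -> F c (xpq p q) d ->
    GM c (xpq p q) d.
  rewrite !inE => /andP[pS pS'] /andP[qS qS'] pq Fc Fd.
  apply/F_of_rk => //; apply: (@rk_xpq X y) => //.
    exact: rk_two Hl pS' qS' pq.
  have [_ H2 _] := @F_span (X `|` st c) _ _ _ (subset_trans AX (@subsetUl _ _ _)) Fc.
  by apply: H2; apply: span_st => z zz; [left; apply: yX|right].
have /card_gt1P[p0 [q0 [p0T q0T pq0]]] : 1 < #|T| by move: HI; lia.
have [pS0 qS0] : p0 \in S /\ q0 \in S by move: p0T q0T; rewrite !inE => /andP[-> _] /andP[-> _].
have [c0 [d0 [Fc0 [Fd0 FF0]]]] := H p0 q0 pS0 qS0 pq0.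
have [Gc0 _] := TG _ _ _ _ p0T q0T pq0 Fc0 FF0.
exists (mul c0 (inv (a_ p0))); split; first by inG.
exists T; split; first by move: HI; rewrite mul2n addnn.
move=> q qT; have qS : q \in S by move: qT; rewrite inE => /andP[].
have gE x : G x -> mul (mul c0 (inv (a_ p0))) x = mul c0 (mul (inv (a_ p0)) x).
  by move=> Gx; rewrite mulA //; inG.
rewrite gE; last exact: Ga.
case: (eqVneq p0 q) => [<-|pq].
  by have [-> _] := mulV (Ga p0); have [_ ->] := mul1 Gc0.
have [c [d [Fc [Fd FF]]]] := H p0 q pS0 qS pq.
have cc : c = c0 by apply: F3 Fc Fc0.
rewrite cc in Fc FF; have [_ [_ Ed]] := TG _ _ _ _ p0T qT pq Fc FF.
by rewrite Ed.
Qed.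

Lemma charted_gen y : gen set0 y -> charted y /\ Rep y y.
Proof.
move=> gy; have [Gy ry] := gy; rewrite setU0 in ry.
have [S HS Hl] := generic_a y; rewrite size_tuple in HS.
pose X := AP `|` (Ce `|` [set` y]).
have AX : AP `<=` X by left.
have yX : st y `<=` X by move=> z zy; right; right.
have Fy p : p \in S -> F y (a_ p) (mul y (a_ p)).
  move=> pS; apply/F_of_rk; last by split=> //; split=> //; apply: Ga.
  rewrite rk_cat leq_add //; have := Hl [:: p] isT; rewrite muln1 /= cats0 => /(_ _)/leq_trans; apply.
    by move=> j; rewrite inE => /eqP->.
  by apply: (rk_mono pg) => z [zA|zy]; [left|right; right].
have Sn : m <= #|S| + 2 * n by apply: (leq_trans HS); lia.
split; last by split=> //; exists S; split.
exists S; split=> // p q pS qS pq; exists (mul y (a_ p)), (mul y (a_ q)).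
split; first exact: Fy.
split; first exact: Fy.
apply/F_of_rk; last first.
  split; first by inG.
  split; first by rewrite /xpq; inG.
  rewrite mulA //; [|by inG|by rewrite /xpq; inG].
  by rewrite /xpq -[mul (a_ p) _]mulA ?(proj2 (mulV (Ga p))) ?(proj1 (mul1 (Ga q))) //; inG.
apply: (@rk_xpq X y) => //.
  exact: rk_two Hl pS qS pq.
apply: (@span_divl _ y) => //; first by move=> z zA; left; apply: AX.
- exact: Ga.
- by apply: span_st => z zy; left; apply: yX.
- by apply: span_st => z; right.
Qed.

Definition kap1 s i := mul (inv (a_ s)) (inv (tnth e_ i)).
Definition kap2 p q j k := mul (mul (inv (a_ p)) (inv (tnth e_ j))) (mul (tnth e_ k) (a_ q)).

(* With c = g_y a_s, b = g_z a_p, d = g_w a_q the last three relations read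
   b2 = g_y e_i^-1 g_z a_p and d = b2 a_p^-1 e_j^-1 e_k a_q. *)
Definition MUL i j k y z w := exists S : {set 'I_m}, m <= #|S| + 9 * n /\
  forall p q s, p \in S -> q \in S -> s \in S -> uniq [:: p; q; s] ->
  exists c b d b1 b2, F y (a_ s) c /\ (F z (a_ p) b /\ (F w (a_ q) d /\
    (F (kap1 s i) b b1 /\ (F c b1 b2 /\ F b2 (kap2 p q j k) d)))).

(** The elements gy, gz and gw are arbitrary, so F cannot be applied to them directly. The test
    points inserted into the factors make each of the three products one of a generic pair, where F
    is the group law, and they cancel in the end. *)
Lemma MUL_E i j k y z w gy gz gw : Rep y gy -> Rep z gz -> Rep w gw ->
  MUL i j k y z w <-> mul gw (inv (tnth e_ k)) = mul (mul gy (inv (tnth e_ i))) (mul gz (inv (tnth e_ j))).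
Proof.
move=> [Gy [Sy [HSy Hy]]] [Gz [Sz [HSz Hz]]] [Gw [Sw [HSw Hw]]].
pose D := gy ++ gz ++ gw.
have [S0 HS0 Hl] := generic_a D; rewrite !size_cat !size_tuple in HS0.
have HI := card_almostI HS0 (card_almostI HSy (card_almostI HSz HSw)).
set T := S0 :&: (Sy :&: (Sz :&: Sw)) in HI.
(* 3 n test points may fail to be generic over the coordinates of D, and 2 n are lost for each of
   the three [Rep]. *)
have {}HI : m <= #|T| + 9 * n by move: HI; lia.
pose X := AP `|` (Ce `|` [set` D]).
have AX : AP `<=` X by left.
have CX : Ce `<=` X by right; left.
have sX Z g : g \in [:: gy; gz; gw] -> X `<=` Z -> span Z g.
  move=> gD XZ; apply: span_st => x xg; apply: XZ; right; right; rewrite /= !mem_cat.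
  by move: gD; rewrite !inE => /or3P[]/eqP E; move: xg; rewrite E => ->; rewrite ?orbT.
have syX Z : X `<=` Z -> span Z gy by apply: sX; rewrite mem_head.
have szX Z : X `<=` Z -> span Z gz by apply: sX; rewrite !inE eqxx orbT.
have chX Z i' : X `<=` Z -> span Z (tnth e_ i').
  by move=> XZ; apply: span_ch => x /CX/XZ.
pose hh := mul (mul gy (inv (tnth e_ i))) (mul gz (inv (tnth e_ j))).
have Ghh : G hh by rewrite /hh; inG.
have key p q s : p \in T -> q \in T -> s \in T -> uniq [:: p; q; s] ->
  [/\ F y (a_ s) (mul gy (a_ s)), F z (a_ p) (mul gz (a_ p)), F w (a_ q) (mul gw (a_ q)) &
    forall c b d b1 b2, c = mul gy (a_ s) -> b = mul gz (a_ p) ->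
     (F (kap1 s i) b b1 /\ (F c b1 b2 /\ F b2 (kap2 p q j k) d)) <->
     [/\ b1 = mul (kap1 s i) b, b2 = mul c b1 & d = mul (mul hh (tnth e_ k)) (a_ q)]].
  rewrite !inE => /and4P[p0 py pz pw] /and4P[q0 qy qz qw] /and4P[s0 sy sz sw] u3.
  split; [exact: Hy|exact: Hz|exact: Hw|].
  move=> c b d b1 b2 -> -> {c b}.
  set c := mul gy (a_ s); set b := mul gz (a_ p).
  have Gc : G c by rewrite /c; inG.
  have Gb : G b by rewrite /b; inG.
  have Gk1 : G (kap1 s i) by rewrite /kap1; inG.
  have Gk2 : G (kap2 p q j k) by rewrite /kap2; inG.
  have pair p' q' : p' \in S0 -> q' \in S0 -> p' != q' -> r + r <= rk X (a_ p' ++ a_ q').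
    exact: rk_two Hl.
  have [pq ps qs] : [/\ p != q, p != s & q != s].
    by move: u3; rewrite /= !inE negb_or => /andP[/andP[-> ->] /andP[-> _]].
  have sp : s != p by rewrite eq_sym.
  have b_ap Z : AP `<=` Z -> X `<=` Z -> span Z b -> span Z (a_ p).
    by move=> AZ XZ; apply: span_divl => //; [inG|apply: szX].
  have k1_as Z : AP `<=` Z -> X `<=` Z -> span Z (kap1 s i) -> span Z (a_ s).
    move=> AZ XZ sk; apply: span_inv' => //; first by inG.
    apply: (@span_divr _ _ (inv (tnth e_ i))) => //; [by inG|by inG|].
    by apply: span_inv => //; [inG|apply: chX].
  have c_as Z : AP `<=` Z -> X `<=` Z -> span Z c -> span Z (a_ s).
    by move=> AZ XZ; apply: span_divl => //; [inG|apply: syX].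
  have XU (u v : n.-tuple K) : X `<=` X `|` st u `|` st v by move=> x Xx; left; left.
  have AU (u v : n.-tuple K) : AP `<=` X `|` st u `|` st v by move=> x Xx; left; left; left.
  have U1 (u v : n.-tuple K) : span (X `|` st u `|` st v) u by apply: span_st => x xu; left; right.
  have U2 (u v : n.-tuple K) : span (X `|` st u `|` st v) v by apply: span_st => x xu; right.
  have as_k1 Z : AP `<=` Z -> X `<=` Z -> span Z (a_ s) -> span Z (kap1 s i).
    move=> AZ XZ sa; apply: span_mul => //; [by inG|by inG| |]; apply: span_inv => //; try by inG.
    exact: chX.
  have R1 : r + r <= rk AP (kap1 s i ++ b).
    apply: (rk_pair_le AX (pair s p s0 p0 sp)); first exact: k1_as.
    exact: b_ap.
  set b1' := mul (kap1 s i) b.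
  have Gb1 : G b1' by rewrite /b1'; inG.
  have R2 : r + r <= rk AP (c ++ b1').
    apply: (rk_pair_le AX (pair s p s0 p0 sp)); first exact: c_as.
    apply: b_ap => //; apply: (@span_divl _ (kap1 s i)) => //.
    by apply: as_k1 => //; apply: c_as.
  set b2' := mul c b1'.
  have Gb2 : G b2' by rewrite /b2'; inG.
  (* The test point a_s has cancelled; it was there to make c and b1' a generic pair. *)
  have Eb2 : b2' = mul (mul gy (inv (tnth e_ i))) b.
    rewrite /b2' /b1' /c /kap1 [mul (mul (inv _) _) b]mulA; [|by inG|by inG|by []].
    rewrite [mul (mul gy (a_ s)) _]mulA; [|by []|by inG|by inG].
    by rewrite -[mul (a_ s) _]mulA ?(proj2 (mulV (Ga s))) ?(proj1 (mul1 _)) -?mulA //; inG.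
  have R3 : r + r <= rk AP (b2' ++ kap2 p q j k).
    have sap : span (X `|` st b2' `|` st (kap2 p q j k)) (a_ p).
      apply: b_ap => //; apply: (@span_divl _ (mul gy (inv (tnth e_ i)))) => //; first by inG.
      - by apply: span_mul => //; [inG|apply: syX|apply: span_inv => //; [inG|apply: chX]].
      - by rewrite -Eb2.
    apply: (rk_pair_le AX (pair p q p0 q0 pq)) => //.
    apply: (@span_divl _ (tnth e_ k)) => //; [by inG|by inG|exact: chX|].
    apply: (@span_divl _ (mul (inv (a_ p)) (inv (tnth e_ j)))) => //; [by inG|by inG|].
    apply: span_mul => //; [by inG|by inG| |]; apply: span_inv => //; try by inG.
    exact: chX.
  have Ed : mul b2' (kap2 p q j k) = mul (mul hh (tnth e_ k)) (a_ q).
    rewrite Eb2 /b /kap2 /hh.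
    rewrite !mulA; try by inG.
    by rewrite -[mul (a_ p) (mul (inv (a_ p)) _)]mulA ?(proj2 (mulV (Ga p))) ?(proj1 (mul1 _)) //; inG.
  split=> [[/(F_of_rk _ R1)[_ [_ E1]] [H2 H3]]|[-> -> ->]].
    rewrite -E1 in H2; move/(F_of_rk _ R2): H2 => [_ [_ E2]].
    rewrite -E2 in H3; move/(F_of_rk _ R3): H3 => [_ [_ E3]].
    by split; rewrite -?E1 -?E2 -?E3 -?Ed.
  split; first by apply/(F_of_rk _ R1); split.
  split; first by apply/(F_of_rk _ R2); split.
  by apply/(F_of_rk _ R3); rewrite -Ed; split.
have fin p : mul gw (a_ p) = mul (mul hh (tnth e_ k)) (a_ p) <-> mul gw (inv (tnth e_ k)) = hh.
  split=> [/mul_injr-> //|<-]; try by inG.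
    by rewrite mulKr //; inG.
  by rewrite [mul (mul gw _) (tnth e_ k)]mulA ?(proj1 (mulV (Gch k))) ?(proj2 (mul1 _)) //; inG.
split=> [[S [HS H]]|E].
  have HJ := card_almostI HS HI.
  have /card_gt2P[p [q [s [[pT qT sT] [pq qs sp]]]]] : 2 < #|S :&: T| by move: HJ; lia.
  move: pT qT sT; rewrite !(@finset.in_setI _ _ S T) => /andP[pS pT] /andP[qS qT] /andP[sS sT].
  have u3 : uniq [:: p; q; s] by rewrite /= !inE negb_or pq qs (eq_sym p s) sp.
  have [Ky Kz Kw K3] := key p q s pT qT sT u3.
  have [c [b [d [b1 [b2 [Fc [Fb [Fd HF]]]]]]]] := H p q s pS qS sS u3.
  have [_ _ Ed] := (K3 _ _ _ _ _ (F3 Fc Ky) (F3 Fb Kz)).1 HF.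
  by apply/(fin q); rewrite -Ed; apply: F3 Kw Fd.
exists T; split=> // p q s pT qT sT u3; have [Ky Kz Kw K3] := key p q s pT qT sT u3.
exists (mul gy (a_ s)), (mul gz (a_ p)), (mul gw (a_ q)), (mul (kap1 s i) (mul gz (a_ p))),
  (mul (mul gy (a_ s)) (mul (kap1 s i) (mul gz (a_ p)))).
do 3!split=> //; apply/K3 => //; split=> //.
exact/fin.
Qed.


Definition term (t : (nat -> K) -> n.-tuple K) : Prop := forall i,
  (exists j, forall u, tnth (t u) i = u j) \/ (exists c, forall u, tnth (t u) i = c).

Lemma term_cst c : term (fun=> c).
Proof. by move=> i; right; exists (tnth c i). Qed.

Lemma term_tk0 : term (tk n).
Proof. by move=> i; left; exists i => u; rewrite tnth_tk. Qed.

Lemma term_shift t : term t -> term (fun u => t (fun k => u (n + k))).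
Proof.
move=> H i; case: (H i) => [[j Hj]|[c Hc]]; first by left; exists (n + j) => u; rewrite Hj.
by right; exists c.
Qed.

Lemma Def_blocks b R t1 t2 t3 : DefO b A (blocks R) -> term t1 -> term t2 -> term t3 ->
  Def b (fun u => R (t1 u) (t2 u) (t3 u)).
Proof.
move=> DR T1 T2 T3.
have tl t : term t -> exists D : seq K, forall i, (exists j, forall u, tnth (t u) i = u j) \/
    (exists2 c, c \in D & forall u, tnth (t u) i = c).
  move=> T; have /choice[c Hc] : forall i, exists c, (exists j, forall u, tnth (t u) i = u j) \/
      forall u, tnth (t u) i = c.
    by move=> i; case: (T i) => [H|[c Hc]]; [exists a0; left|exists c; right].
  exists (map c (enum 'I_n)) => i; case: (Hc i) => [H|H]; [by left|right; exists (c i) => //].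
  by apply: map_f; rewrite mem_enum.
have [D1 H1] := tl _ T1; have [D2 H2] := tl _ T2; have [D3 H3] := tl _ T3.
exists (A ++ D1 ++ D2 ++ D3).
pose V u := pre (t1 u) (pre (t2 u) (pre (t3 u) u)).
have E u : blocks R (V u) <-> R (t1 u) (t2 u) (t3 u).
  have -> : V u = pre (t1 u) (pre (t2 u) (pre (t3 u) u)) by [].
  rewrite /blocks tk_pre shift_pre tk_pre.
  have -> // : tk n (fun k => pre (t1 u) (pre (t2 u) (pre (t3 u) u)) (n + (n + k))) = t3 u.
  rewrite -[RHS](tk_pre (t3 u) u); apply: eq_from_tnth => i; rewrite !tnth_tk.
  by do 2!rewrite pre_ge ?size_tuple ?leq_addr // addKn.
apply: DefO_eqv E _; apply: (@DefO_subst _ _ _ _ _ _ _ V DR) => [y yA|k].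
  by rewrite mem_cat yA.
have lem (t : (nat -> K) -> n.-tuple K) (D : seq K) (rest : (nat -> K) -> nat -> K) k' :
    {subset D <= A ++ D1 ++ D2 ++ D3} ->
    (forall i, (exists j, forall u, tnth (t u) i = u j) \/ (exists2 c, c \in D & forall u, tnth (t u) i = c)) ->
    (n <= k' -> (exists j, forall u, rest u (k' - n) = u j) \/
       (exists2 c, c \in A ++ D1 ++ D2 ++ D3 & forall u, rest u (k' - n) = c)) ->
    (exists j, forall u, pre (t u) (rest u) k' = u j) \/
       (exists2 c, c \in A ++ D1 ++ D2 ++ D3 & forall u, pre (t u) (rest u) k' = c).
  move=> sD Ht Hr; case: (ltnP k' n) => kn.
    have Ek u : pre (t u) (rest u) k' = tnth (t u) (Ordinal kn).
      by rewrite (pre_lt a0) ?size_tuple // (tnth_nth a0).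
    case: (Ht (Ordinal kn)) => [[j Hj]|[c cD Hc]]; [left; exists j|right; exists c] => [u||u].
    - by rewrite Ek Hj.
    - exact: sD.
    - by rewrite Ek Hc.
  have Ek u : pre (t u) (rest u) k' = rest u (k' - n) by rewrite pre_ge size_tuple.
  case: (Hr kn) => [[j Hj]|[c cD Hc]]; [left; exists j|right; exists c] => // u;
    by rewrite Ek.
apply: (lem t1 D1) => //; first by move=> y yD; rewrite !mem_cat yD orbT.
move=> kn; apply: (lem t2 D2) => //; first by move=> y yD; rewrite !mem_cat yD !orbT.
move=> kn2; apply: (lem t3 D3) => //; first by move=> y yD; rewrite !mem_cat yD !orbT.
by move=> kn3; left; exists (k - n - n - n).
Qed.

Lemma Def_F t1 t2 t3 : term t1 -> term t2 -> term t3 -> Def true (fun u => F (t1 u) (t2 u) (t3 u)).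
Proof. exact: Def_blocks. Qed.

Lemma Def_charted t : term t -> Def true (fun u => charted (t u)).
Proof.
move=> T; apply: Def_ex_fin => S; apply: Def_and; first exact: Def_cst.
apply: Def_all_fin => p; apply: Def_all_fin => q; do 3!(apply: Def_imp; first exact: Def_cst).
do 2!apply: Def_exT; apply: Def_and.
  apply: Def_F; [exact: (term_shift (term_shift T))|exact: term_cst|exact: (term_shift term_tk0)].
apply: Def_and; apply: Def_F.
- exact: (term_shift (term_shift T)).
- exact: term_cst.
- exact: term_tk0.
- exact: (term_shift term_tk0).
- exact: term_cst.
- exact: term_tk0.
Qed.

Lemma Def_MUL i j k t1 t2 t3 : term t1 -> term t2 -> term t3 ->
  Def true (fun u => MUL i j k (t1 u) (t2 u) (t3 u)).
Proof.
move=> T1 T2 T3; apply: Def_ex_fin => S; apply: Def_and; first exact: Def_cst.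
apply: Def_all_fin => p; apply: Def_all_fin => q; apply: Def_all_fin => s.
do 4!(apply: Def_imp; first exact: Def_cst).
have sh t : term t -> term (fun u => t (fun k => u (n + (n + (n + (n + (n + k))))))).
  by move=> T; exact: (term_shift (term_shift (term_shift (term_shift (term_shift T))))).
do 5!apply: Def_exT.
have B0 := term_tk0; have B1 := term_shift B0; have B2 := term_shift B1.
have B3 := term_shift B2; have B4 := term_shift B3.
do 5?[apply: Def_and]; apply: Def_F; try exact: term_cst; by [|apply: sh].
Qed.

Variable kap : 'I_n.+1 -> K.
Hypothesis kap_inj : injective kap.

Local Notation e0 := (tnth e_ ord0).
Local Notation bh T := (behead_tuple T : n.-tuple K).

Definition cH (T : n.+1.-tuple K) : Prop := exists i, thead T = kap i /\ (charted (bh T) /\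
  forall j : 'I_n.+1, j < i -> ~ exists v, charted v /\ MUL i ord0 j (bh T) e0 v).

Definition cM (T T' T'' : n.+1.-tuple K) : Prop := (cH T /\ (cH T' /\ cH T'')) /\
  exists i j k, thead T = kap i /\ (thead T' = kap j /\ (thead T'' = kap k /\
    MUL i j k (bh T) (bh T') (bh T''))).

(** [Rep] is spelled out through the graph [GM], whose definability is known; [cfE] folds it
    back. *)
Definition cf (g : n.-tuple K) (T : n.+1.-tuple K) : Prop := G g /\ (cH T /\
  exists i, thead T = kap i /\ exists S : {set 'I_m}, m <= #|S| + 2 * n /\
   forall p, p \in S -> exists c, GM g (mul (tnth e_ i) (a_ p)) c /\ F (bh T) (a_ p) c).

Lemma cfE g T : cf g T <-> [/\ G g, cH T & exists2 i, thead T = kap i & Rep (bh T) (mul g (tnth e_ i))].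
Proof.
split=> [[Gg [HT [i [Ti [S [HS H]]]]]]|[Gg HT [i Ti [_ [S [HS H]]]]]].
  split=> //; exists i => //; split; first by inG.
  exists S; split=> // p /H[c [[_ [_ <-]]]]; rewrite mulA //; inG.
split=> //; split=> //; exists i; split=> //; exists S; split=> // p /H Fp.
exists (mul g (mul (tnth e_ i) (a_ p))); split; first by split=> //; split=> //; inG.
by rewrite -mulA //; inG.
Qed.

Lemma Rep_e0 : Rep e0 e0.
Proof.
have [] // := @charted_gen e0; case: (e_) ind_e => -[|x L] // sz /= [gx _].
by rewrite /tnth /=.
Qed.

Lemma EQ_E i j y v gy gv : Rep y gy -> Rep v gv ->
  MUL i ord0 j y e0 v <-> mul gv (inv (tnth e_ j)) = mul gy (inv (tnth e_ i)).
Proof.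
move=> Ry Rv; rewrite (MUL_E i ord0 j Ry Rep_e0 Rv).
have [Gy _] := Ry.
by have [_ ->] := mulV (Gch ord0); have [_ ->] := mul1 (Gmul Gy (Ginv (Gch i))).
Qed.

Lemma div_eq g x i : G g -> G x -> mul x (inv (tnth e_ i)) = g <-> x = mul g (tnth e_ i).
Proof.
move=> Gg Gx; split=> [<-|->]; last by rewrite mulKr //; inG.
by rewrite mulA ?(proj1 (mulV (Gch i))) ?(proj2 (mul1 _)) //; inG.
Qed.

Lemma chart_iso : iso_spec G GM cH cM cf.
Proof.
have Hfun g T T' : cf g T -> cf g T' -> T = T'.
  move=> /cfE[Gg HT [i Ti RT]] /cfE[_ HT' [j Tj RT']].
  have lt_absurd (i' j' : 'I_n.+1) (T1 T2 : n.+1.-tuple K) : cH T1 -> cH T2 -> thead T1 = kap i' ->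
      thead T2 = kap j' -> Rep (bh T1) (mul g (tnth e_ i')) -> Rep (bh T2) (mul g (tnth e_ j')) -> ~ i' < j'.
    move=> [i1 [E1 [ch1 _]]] [j1 [E2 [_ min2]]] F1' F2' R1 R2 ij.
    have Ej : j1 = j' by apply: kap_inj; rewrite -E2.
    rewrite Ej in min2; apply: (min2 i' ij); exists (bh T1); split=> //.
    apply/(EQ_E _ _ R2 R1); have [_ H1] := div_eq i' Gg (proj1 R1); have [_ H2] := div_eq j' Gg (proj1 R2).
    by rewrite H1 // H2.
  have ij : i = j.
    apply/val_inj; case: (ltngtP (val i) (val j)) => // lt_; exfalso.
      exact: (lt_absurd i j T T').
    exact: (lt_absurd j i T' T).
  rewrite -ij in Tj RT'; have Eb : bh T = bh T' := Rep_inj RT RT'.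
  by rewrite (tuple_eta T) (tuple_eta T') Ti Tj; apply: val_inj => /=; rewrite -[behead T]/(val (bh T)) Eb.
have Hsur T : cH T -> exists g, cf g T.
  move=> HT; have [i [Ti [/Rep_of_charted[gy Ry] _]]] := HT; have [Gy _] := Ry.
  exists (mul gy (inv (tnth e_ i))); apply/cfE; split=> //; first by inG.
  exists i => //; rewrite mulA ?(proj1 (mulV (Gch i))) ?(proj2 (mul1 Gy)) //; inG.
have Hmul g h T T' T'' g'' : cf g T -> cf h T' -> cf g'' T'' -> cM T T' T'' <-> g'' = mul g h.
  move=> /cfE[Gg HT [i Ti RT]] /cfE[Gh HT' [j Tj RT']] /cfE[Gk HT'' [k Tk RT'']].
  have E := MUL_E i j k RT RT' RT''; rewrite !mulKr in E; try by inG.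
  split=> [[_ [i' [j' [k' [Ti' [Tj' [Tk' HM]]]]]]]|gE].
    apply/E; have -> : i = i' by apply: kap_inj; rewrite -Ti.
    have -> : j = j' by apply: kap_inj; rewrite -Tj.
    by have -> : k = k' by apply: kap_inj; rewrite -Tk.
  by split=> //; exists i, j, k; do 3!split=> //; apply/E.
split; first by move=> g T /cfE[].
split; last split=> //; last split; last split=> //; last split.
- move=> g Gg.
  (* [cover] provides an index for which g e_i is generic, but a smaller one may have a charted
     tuple that is not generic, and the least one is the one [cH] admits. *)
  have ex : exists k, `[< exists i : 'I_n.+1, val i = k /\ exists y, charted y /\ Rep y (mul g (tnth e_ i)) >].
    have [i gi] := cover Gg; exists (val i); apply/asboolP; exists i; split=> //.
    by exists (mul g (tnth e_ i)); apply: charted_gen.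
  have [k /asboolP[i [ik [y [cy Ry]]]] kmin] := ex_minnP ex.
  exists [tuple of kap i :: y].
  have Eb : bh [tuple of kap i :: y] = y by apply: val_inj.
  apply/cfE; split=> //; last by exists i; rewrite ?theadE // Eb.
  exists i; split; first by rewrite theadE.
  rewrite Eb; split=> // j ji [v [cv HM]].
  have [gv Rv] := Rep_of_charted cv.
  move/(EQ_E _ _ Ry Rv): HM; rewrite mulKr //; last exact: Gch.
  move/(div_eq j Gg (proj1 Rv)) => Egv; rewrite Egv in Rv.
  have : k <= j by apply: kmin; apply/asboolP; exists j; split=> //; exists v.
  by rewrite -ik leqNgt ji.
- move=> g g' T /cfE[Gg _ [i Ti R]] /cfE[Gg' _ [j Tj R']].
  have ij : i = j by apply: kap_inj; rewrite -Ti.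
  rewrite -ij in R'; apply: (@mul_injr _ _ (tnth e_ i)) => //; first exact: Gch.
  exact: Rep_uniq R R'.
- by move=> T T' T'' [].
- move=> g h k T T' T'' [Gg [Gh <-]] fT fT'; split=> [HM|fT''].
    have [[_ [_ HT'']] _] := HM; have [g'' fT''] := Hsur _ HT''.
    by have E := (Hmul _ _ _ _ _ _ fT fT' fT'').1 HM; rewrite -E.
  exact/(Hmul _ _ _ _ _ _ fT fT' fT'').
Qed.

Lemma term_bh j : term (fun u => bh (tk n.+1 (fun k => u (j + k)))).
Proof.
move=> i; left; exists (j + i.+1) => u; rewrite (tnth_nth (u 0)) /= nth_behead.
by have := tnth_tk (fun k => u (j + k)) (lift ord0 i); rewrite (tnth_nth (u 0)) => ->; rewrite lift0.
Qed.

Lemma thead_tk j (u : nat -> K) : thead (tk n.+1 (fun k => u (j + k))) = u j.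
Proof. by rewrite /thead tnth_tk addn0. Qed.

Lemma Def_cH j : Def true (fun u => cH (tk n.+1 (fun k => u (j + k)))).
Proof.
have T := term_bh j; apply: Def_ex_fin => i; apply: Def_and.
  by apply: Def_eqv (Def_eqc true j (kap i)) => u; rewrite thead_tk.
apply: Def_and; first exact: Def_charted.
apply: Def_all_fin => l; apply: Def_imp; first exact: Def_cst.
apply: Def_not; apply: Def_exT; apply: Def_and; first exact: (Def_charted term_tk0).
apply: Def_MUL; [exact: (term_shift T)|exact: term_cst|exact: term_tk0].
Qed.

Lemma Def_cM : Def true (fun u => cM (tk n.+1 u) (tk n.+1 (fun k => u (n.+1 + k)))
  (tk n.+1 (fun k => u (n.+1 + n.+1 + k)))).
Proof.
apply: Def_and; first by apply: Def_and; [exact: (Def_cH 0)|apply: Def_and; exact: Def_cH].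
apply: Def_ex_fin => i; apply: Def_ex_fin => j; apply: Def_ex_fin => k.
apply: Def_and; first by apply: Def_eqv (Def_eqc true 0 (kap i)) => u; rewrite (thead_tk 0).
apply: Def_and; first by apply: Def_eqv (Def_eqc true n.+1 (kap j)) => u; rewrite thead_tk.
apply: Def_and; first by apply: Def_eqv (Def_eqc true (n.+1 + n.+1) (kap k)) => u; rewrite thead_tk.
by apply: Def_MUL; [exact: (term_bh 0)| |]; apply: term_bh.
Qed.

Lemma Def_cf : Def false (fun u => cf (tk n u) (tk n.+1 (fun k => u (n + k)))).
Proof.
apply: Def_and; first by exists A.
apply: Def_and; first exact: Def_weak (Def_cH n).
apply: Def_ex_fin => i; apply: Def_and.
  by apply: Def_eqv (Def_eqc false n (kap i)) => u; rewrite thead_tk.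
apply: Def_ex_fin => S; apply: Def_and; first exact: Def_cst.
apply: Def_all_fin => p; apply: Def_imp; first exact: Def_cst.
apply: Def_exT; apply: Def_and.
  by apply: (Def_blocks DM); [exact: (term_shift term_tk0)|exact: term_cst|exact: term_tk0].
apply: Def_weak (Def_F _ _ _); [exact: (term_shift (term_bh n))|exact: term_cst|exact: term_tk0].
Qed.

End Charts.
End Chunk.
End Group.

(** * Groups definable in tame structures *)

Section TameGroup.
Local Open Scope classical_set_scope.
Variables (I : Type) (ar : I -> nat) (ltf opf : formula (ar_P ar)).
Hypotheses (Lltf : isL ltf) (Lopf : isL opf).
Variable K : Str ar.
Hypothesis tK : tame ltf opf K.
Local Notation P := (@sP _ ar K : set K).
Local Notation cl := (@cl _ ar ltf K).
Local Notation supp := (supp cl P).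
Local Notation pg := (cl_pregeom Lltf tK).

Lemma tame_injection k : exists kap : 'I_k -> K, injective kap.
Proof.
have [x [y xy]] := tame_nontriv tK.
have [s us ss] : exists2 s : seq K, uniq s & size s = k.
  elim: k => [|k [s us ss]]; first by exists [::].
  have [p [_ _ _ ps]] := dense_P_avoid tK s xy.
  by exists (p :: s); rewrite /= ?ps ?us ?ss.
exists (fun i => nth x s i) => i j /eqP.
by rewrite nth_uniq ?ss // => /eqP/val_inj.
Qed.

Theorem tame_group n (G : n.-tuple K -> Prop) (mul : n.-tuple K -> n.-tuple K -> n.-tuple K) :
  is_group_on G mul -> Def false (fun u => G (tk n u)) -> Def false (blocks (GM G mul)) ->
  exists (H : n.+1.-tuple K -> Prop) (N : n.+1.-tuple K -> n.+1.-tuple K -> n.+1.-tuple K -> Prop)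
    (f : n.-tuple K -> n.+1.-tuple K -> Prop),
  [/\ Def true (fun u => H (tk n.+1 u)),
      Def true (fun u => N (tk n.+1 u) (tk n.+1 (fun k => u (n.+1 + k))) (tk n.+1 (fun k => u (n.+1 + n.+1 + k)))),
      Def false (fun u => f (tk n u) (tk n.+1 (fun k => u (n + k)))) &
      iso_spec G (GM G mul) H N f].
Proof.
move=> [e [inv [Ge [Gmul [Ginv [mulA [mul1 mulV]]]]]]] [D1 DG] [D2 DM].
have [a0 _] := tame_nontriv tK.
have [A0 [aA0 D1A0 D2A0]] : exists A0 : seq K, [/\ a0 \in A0, {subset D1 <= A0} & {subset D2 <= A0}].
  by exists (a0 :: D1 ++ D2); split=> [|y yD|y yD]; rewrite !(mem_cat, inE) ?eqxx ?yD ?orbT.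
have [t Ht] := supp_list Lltf tK A0.
(* The support is finite and, by [supp_supp], adding it creates no new support, so A contains its
   own. *)
pose A := A0 ++ t.
have AE : [set` A] = [set` A0] `|` supp [set` A0].
  by rewrite -Ht; apply/seteqP; split=> y; rewrite /A /= mem_cat => /orP.
have Agood : supp [set` A] `<=` [set` A] by rewrite AE => p /(supp_supp pg); right.
have a0A : a0 \in A by rewrite mem_cat aA0.
have {}DG : DefO false A (fun u => G (tk n u)).
  by apply: DefO_sub DG => y /D1A0 yD; rewrite mem_cat yD.
have {}DM : DefO false A (blocks (GM G mul)).
  by apply: DefO_sub DM => y /D2A0 yD; rewrite mem_cat yD.
pose rkA (x : n.-tuple K) := rk cl ([set` A] `|` P) x.
have ex0 : exists k, `[< exists2 x, G x & k <= rkA x >] by exists 0; apply/asboolP; exists e.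
have bnd k : `[< exists2 x, G x & k <= rkA x >] -> k <= n.
  move=> /asboolP[x _ kx]; apply: (leq_trans kx).
  by have := rk_size cl ([set` A] `|` P) x; rewrite size_tuple.
have [r /asboolP rex rmax0] := ex_maxnP ex0 bnd.
have rmax x : G x -> rkA x <= r by move=> Gx; apply: rmax0; apply/asboolP; exists x.
have [F DF [F3 F2 F1 FG]] :=
  chunk_ex Lltf Lopf tK a0A Agood Gmul Ginv mulA mul1 mulV DG DM rmax rex.
have [e_ ind_e] := indep_seq_ex Lltf Lopf tK a0A Agood DG rex n.+1 [::].
have {}ind_e : indep_seq ltf A G r set0 e_.
  by apply: (indep_seq_cl Lltf tK _ ind_e).
have [a ind_a] := indep_seq_ex Lltf Lopf tK a0A Agood DG rex (18 * n).+3 (flatten (map val e_)).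
have [kap kap_inj] := tame_injection n.+1.
exists (cH mul inv F a e_ kap), (cM mul inv F a e_ kap), (cf G mul inv F a e_ kap); split.
- exact: (@Def_cH _ _ _ A a0 _ _ _ _ DF _ _ _ 0).
- by eapply Def_cM; eassumption.
- by eapply Def_cf; eassumption.
- by eapply (chart_iso Lltf Lopf tK); eassumption.
Qed.

End TameGroup.

(** * The ultrapower of the base model is tame *)

Section Embedding.
Variables (I : Type) (ar : I -> nat).

Fixpoint emb (f : formula ar) : formula (ar_P ar) :=
  match f with
  | FRel i vs => @FRel _ (ar_P ar) (Some i) vs
  | FEq a b => FEq _ a b
  | FNot g => FNot (emb g)
  | FAnd g h => FAnd (emb g) (emb h)
  | FEx x g => FEx x (emb g)
  end.

Lemma isL_emb f : isL (emb f).
Proof. by elim: f => //= f -> g ->. Qed.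

Lemma emb_surj (f : formula (ar_P ar)) : isL f -> exists g, emb g = f.
Proof.
elim: f => [[i|] vs|a b|f IH|f IHf g IHg|x f IH] //=.
- by exists (@FRel _ ar i vs).
- by exists (FEq _ a b).
- by move=> /IH[g <-]; exists (FNot g).
- by move=> /andP[/IHf[f' <-] /IHg[g' <-]]; exists (FAnd f' g').
- by move=> /IH[g <-]; exists (FEx x g).
Qed.

Variables (M : Type) (rel : forall i : I, (ar i).-tuple M -> Prop) (P : M -> Prop).

Lemma sat_emb v f : sat (rel_P rel P) v (emb f) <-> sat rel v f.
Proof.
elim: f v => [i vs|a b|f IH|f IHf g IHg|x f IH] v //=.
- by have := IH v; tauto.
- by have := IHf v; have := IHg v; tauto.
- by split=> -[a /IH]; exists a.
Qed.

Definition base : Str ar := @MkStr _ ar {classic M} (rel_P rel P).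

End Embedding.

(** Parameters at the first d positions, then the argument at all later ones. Unlike [pre] with a
    list, this only needs a valuation, so it can occur under [FO]. *)
Definition V1 (T : Type) (d : nat) (v : nat -> T) (y : T) (k : nat) : T :=
  if k < d then v k else y.
Definition V2 (T : Type) (d : nat) (v : nat -> T) (c y : T) (k : nat) : T :=
  if k < d then v k else if k == d then c else y.

Lemma V1_pre (T : eqType) (D : seq T) m y : V1 (size D) (pre D (fun=> m)) y = pre D (fun=> y).
Proof.
apply/funext => k; rewrite /V1; case: ltnP => kD; first by rewrite !(pre_lt m).
by rewrite pre_ge.
Qed.

Lemma V2_pre (T : eqType) (D : seq T) m c y :
  V2 (size D) (pre D (fun=> m)) c y = pre D (scons c (fun=> y)).
Proof.
apply/funext => k; rewrite /V2; case: ltnP => kD; first by rewrite !(pre_lt m).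
rewrite pre_ge //; case: eqP => [->|/eqP nk]; first by rewrite subnn.
have : 0 < k - size D by rewrite subn_gt0 ltn_neqAle eq_sym nk.
by case: (k - size D).
Qed.

Lemma FO_V1 (I : Type) (ar : I -> nat) b d (f : formula (ar_P ar)) : b ==> isL f -> FO b (fun s u => holds (V1 d (fun k => u k.+1) (u 0)) f).
Proof.
move=> Lf; apply: (@FO_holds _ _ _ _ (fun k => if k < d then k.+1 else 0)) => // s u k.
by rewrite /V1; case: ifP.
Qed.

Lemma FO_V2 (I : Type) (ar : I -> nat) b d (f : formula (ar_P ar)) : b ==> isL f ->
  FO b (fun s u => holds (V2 d (fun k => u k.+2) (u 0) (u 1)) f).
Proof.
move=> Lf.
apply: (@FO_holds _ _ _ _ (fun k => if k < d then k.+2 else if k == d then 0 else 1)) => // s u k.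
by rewrite /V2; case: ifP => // _; case: ifP.
Qed.

Lemma FO_V2' (I : Type) (ar : I -> nat) b d (f : formula (ar_P ar)) : b ==> isL f ->
  FO b (fun s u => holds (V2 d (fun k => u k.+2) (u 1) (u 0)) f).
Proof.
move=> Lf.
apply: (@FO_holds _ _ _ _ (fun k => if k < d then k.+2 else if k == d then 1 else 0)) => // s u k.
by rewrite /V2; case: ifP => // _; case: ifP.
Qed.

Section BaseModel.
Local Open Scope classical_set_scope.
Variables (M : Type) (I : Type) (ar : I -> nat) (rel : forall i : I, (ar i).-tuple M -> Prop).
Variables (lt : M -> M -> Prop) (op : M -> M -> M) (e : M) (inv : M -> M).
Hypothesis Hog : ordered_group lt op e inv.
Variables (flt fop : formula ar).
Hypothesis Hlt : forall (x : 2.-tuple M) (w : nat -> M),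
  lt (tnth x ord0) (tnth x ord_max) <-> sat rel (extend x w) flt.
Hypothesis Hop : forall (t : 3.-tuple M) (w : nat -> M),
  op (tnth t ord0) (tnth t (Ordinal (isT : 1 < 3))) = tnth t ord_max <-> sat rel (extend t w) fop.
Hypothesis Hom : o_minimal rel lt.
Variable P : M -> Prop.
Hypotheses (Hdense : dense_in lt P) (Hind : dcl_independent rel P).
Variable one : M.
Hypothesis one_gt0 : lt e one.

Local Notation S := (base rel P).
Local Notation ltf := (emb flt).
Local Notation opf := (emb fop).

Lemma base_lt (x y : S) : slt ltf x y <-> lt x y.
Proof.
rewrite /slt /holds sat_emb; have := @Hlt [tuple x; y] (fun=> y).
rewrite [tnth _ ord0]/= [tnth _ ord_max]/= => ->.
suff -> : extend [tuple x; y] (fun=> y) = scons x (fun=> y) by [].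
by apply/funext => -[|[|k]] //; rewrite /extend /= nth_nil.
Qed.

Lemma base_op (x y z : S) : sop opf x y z <-> op x y = z.
Proof.
rewrite /sop /holds sat_emb; have := @Hop [tuple x; y; z] (fun=> z).
rewrite [tnth _ ord0]/= [tnth _ (Ordinal _)]/= [tnth _ ord_max]/= => ->.
suff -> : extend [tuple x; y; z] (fun=> z) = scons x (scons y (fun=> z)) by [].
by apply/funext => -[|[|[|k]]] //; rewrite /extend /= nth_nil.
Qed.

Lemma base_ltE : @slt _ ar ltf S = lt.
Proof. by apply/funext => x; apply/funext => y; apply/propext; apply: base_lt. Qed.

Lemma base_opA (x y z : S) : op (op x y) z = op x (op y z).
Proof. by case: Hog. Qed.

Lemma base_op1 (x : S) : op e x = x /\ op x e = x.
Proof. by case: Hog => _ []. Qed.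

Lemma base_opV (x : S) : op (inv x) x = e /\ op x (inv x) = e.
Proof. by case: Hog => _ [_ []]. Qed.

Lemma base_irr (x : S) : ~ slt ltf x x.
Proof. by rewrite base_lt; case: Hog => _ [_ [_ []]]. Qed.

Lemma base_trans (x y z : S) : slt ltf x y -> slt ltf y z -> slt ltf x z.
Proof. by rewrite !base_lt; case: Hog => _ [_ [_ [_ [H _]]]]; apply: H. Qed.

Lemma base_total (x y : S) : slt ltf x y \/ x = y \/ slt ltf y x.
Proof. by rewrite !base_lt; case: Hog => _ [_ [_ [_ [_ [H _]]]]]. Qed.

Lemma base_opl (x y z : S) : slt ltf x y -> slt ltf (op z x : S) (op z y : S).
Proof. by rewrite !base_lt; case: Hog => _ [_ [_ [_ [_ [_ H]]]]] /H-/(_ z)[]. Qed.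

Lemma base_opr (x y z : S) : slt ltf x y -> slt ltf (op x z : S) (op y z : S).
Proof. by rewrite !base_lt; case: Hog => _ [_ [_ [_ [_ [_ H]]]]] /H-/(_ z)[]. Qed.

Lemma base_denseP (x y : S) : slt ltf x y -> exists p : S, sP p /\ (slt ltf x p /\ slt ltf p y).
Proof. by move=> /base_lt/Hdense[p [Pp [xp py]]]; exists p; rewrite !base_lt. Qed.

Lemma base_dense (x y : S) : slt ltf x y -> exists z : S, slt ltf x z /\ slt ltf z y.
Proof. by move=> /base_denseP[p [_ H]]; exists p. Qed.

Lemma base_one : slt ltf (e : S) (one : S).
Proof. exact/base_lt. Qed.

Lemma base_omin (X : S -> Prop) : defL X -> exists ps, forall y, X y <-> inps ltf ps y.
Proof.
move=> [f Lf [v Hf]]; have [g gf] := emb_surj Lf.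
have [|ps Hps] := @Hom (fun t : 1.-tuple M => X (thead t)).
  exists g, (fun k => if k is k'.+1 then v k' else v 0) => x.
  rewrite Hf -gf /holds sat_emb.
  suff -> : scons (thead x) v = extend x (fun k => if k is k'.+1 then v k' else v 0) by [].
  by apply/funext => -[|k]; case/tupleP: x => y t; rewrite /extend (tuple0 t) //= nth_nil.
exists ps => y; have -> : X y <-> X (thead [tuple y]) by [].
rewrite Hps; elim: ps {Hps} => [|p ps IH] /=; first by split=> [[]|].
rewrite base_ltE; split=> [[[|k] kp Hk]|[Hp|/IH[k kp Hk]]].
- by left.
- by right; apply/IH; exists k.
- by exists 0.
- by exists k.+1.
Qed.

Lemma base_small_fin (X : S -> Prop) : defL X -> small ltf X ->
  exists l : seq S, forall x, X x -> x \in l.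
Proof.
exact: (@small_fin _ _ ltf S op e (fun x => proj2 (base_op1 x)) base_trans base_opl one base_one base_omin).
Qed.

Lemma base_small_bigcup (Y : S -> Prop) (X : S -> S -> Prop) :
  defL Y -> (forall c, defL (X c)) -> small ltf Y -> (forall c, Y c -> small ltf (X c)) ->
  small ltf (fun y => exists c, Y c /\ X c y).
Proof.
exact: (@small_bigcup _ _ ltf S op e (fun x => proj2 (base_op1 x)) base_irr base_trans base_total
  base_opl base_dense one base_one base_omin).
Qed.

Lemma base_small_swap f (v : nat -> S) : isL f ->
  (forall x, small ltf (fun y => holds (scons x (scons y v)) f)) ->
  small ltf (fun y => ~ small ltf (fun x => holds (scons x (scons y v)) f)).
Proof.
exact: (@small_swap _ _ ltf opf (isL_emb flt) (isL_emb fop) S op e inv base_op base_opA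
  (fun x => proj1 (base_op1 x)) (fun x => proj2 (base_op1 x)) (fun x => proj1 (base_opV x))
  (fun x => proj2 (base_opV x)) base_irr base_trans base_total base_opl base_opr base_dense
  one base_one base_omin).
Qed.

(** The order turns finiteness into definability: the least point of a finite definable set is
    definable, and if p is not the least, that point is deleted. The condition on w says that R uses
    only the first d values as parameters. *)
Lemma base_fin_dcl d (v : nat -> S) (l : seq S) (R : forall s : Str ar, (nat -> s) -> s -> Prop) p :
  FO true (fun s u => R s (fun k => u k.+1) (u 0)) ->
  (forall (w : nat -> S) y, (forall k, k < d -> w k = v k) -> (R S w y <-> R S v y)) ->
  (forall y, R S v y -> y \in l) -> R S v p -> (forall k, k < d -> P (v k) /\ v k <> p) ->
  in_dcl rel (fun q => P q /\ q <> p) p.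
Proof.
move=> FR locR Rl Rp Hv.
elim: {l}(size l) {-2}l (leqnn (size l)) R FR locR Rl Rp => [|k IH] l lk R FR locR Rl Rp.
  by have := Rl p Rp; case: (l) lk.
have [m Rm mmin] := fin_min base_irr base_trans Rl Rp.
have FR2 : FO true (fun s u => exists z, R s (fun k => u k.+1) z /\ slt ltf z (u 0)).
  apply: FO_ex; apply: FO_and; last exact: (FO_lt (isL_emb flt) _ 0 1).
  by apply: (@FO_subst _ _ _ _ (fun k => if k is j.+1 then j.+2 else 0)
    (fun s u k => if k is j.+1 then u j.+2 else u 0) _ FR) => s u [].
case: (pselect (p = m)) => [pm|npm]; last first.
  apply: (IH [seq x <- l | x != m] _ (fun s w y => R s w y /\ exists z, R s w z /\ slt ltf z y)).
  - rewrite -ltnS; apply: leq_trans lk; rewrite size_filter -(count_predC (pred1 m) l).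
    rewrite -{1}[count _ l]add0n ltn_add2r -has_count has_pred1; exact: Rl.
  - by apply: FO_and.
  - move=> w y Hw; rewrite (locR w y Hw); split=> -[? [z [Rz zy]]]; split=> //; exists z;
      by split=> //; apply/(locR w z Hw).
  - move=> y [Ry [z [Rz zy]]]; rewrite mem_filter Rl // andbT; apply/eqP => ym.
    by apply: (mmin z Rz); rewrite -ym.
  - split=> //; exists m; split=> //.
    by case: (base_total m p) => [//|[mp|/(mmin p Rp)//]]; case: npm.
have FR' : FO true (fun s u => R s (fun k => u k.+1) (u 0) /\
    ~ exists z, R s (fun k => u k.+1) z /\ slt ltf z (u 0)).
  by apply: FO_and => //; apply: FO_not.
case: FR' => f Lf Hf; have [g gf] := emb_surj Lf.
exists g, d, [tuple v i | i < d]; split; first by move=> j; rewrite tnth_mktuple; apply: Hv.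
move=> y w; rewrite -(sat_emb rel P) gf -[sat _ _ f]/(@holds _ _ S _ f) -Hf.
set w' := fun k => _.
have Hw k' : k' < d -> w' k' = v k'.
  move=> kd; rewrite /w' /extend /= (nth_map (Ordinal kd)) ?size_enum_ord //.
  by rewrite (nth_enum_ord (Ordinal kd) kd).
have -> : extend [tuple of y :: [tuple v i | i < d]] w 0 = y by [].
rewrite (locR w' y Hw); split=> [[Ry ny]|->].
  rewrite pm; case: (base_total m y) => [my|[//|/(mmin y Ry)//]].
  by case: ny; exists m; split=> //; apply/(locR w' m Hw).
split=> // -[z [/(locR w' z Hw) Rz zp]].
by apply: (mmin z Rz); rewrite -pm.
Qed.

Section Power.
Variables (m0 : S) (U : set_system nat).
Context {UF : UltraFilter U}.
Hypothesis Uoo : eventually `<=` U.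
Variable code : formula (ar_P ar) -> nat.
Hypothesis code_inj : injective code.
Local Notation K := (upower m0 U).
Local Notation up := (@transfer_up _ _ S m0 U UF _ _).

Lemma tame_upower : tame ltf opf K.
Proof.
have Lt := isL_emb flt; have Lo := isL_emb fop; have kd : K by exact: (@ucls _ _ S m0 U UF (fun=> m0)).
have FOlt := @FO_lt _ _ _ Lt true; have FOop := @FO_op _ _ _ Lo true.
have FOlt' := @FO_lt _ _ _ Lt false; have FOop' := @FO_op _ _ _ Lo false.
split.
- have F : FO true (fun s v => forall x : s, ~ slt ltf x x).
    by apply: FO_all; apply: FO_not; apply: FOlt.
  exact: (up F (fun=> base_irr) (fun=> kd)).
- have F : FO true (fun s v => forall x y z : s, slt ltf x y -> slt ltf y z -> slt ltf x z).
    do 3!apply: FO_all; apply: FO_imp; first exact: (FOlt 2 1).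
    by apply: FO_imp; [exact: (FOlt 1 0)|exact: (FOlt 2 0)].
  exact: (up F (fun=> base_trans) (fun=> kd)).
- have F : FO false (fun (s : Str ar) v => forall x y : s, slt ltf x y ->
      exists p : s, sP p /\ (slt ltf x p /\ slt ltf p y)).
    do 2!apply: FO_all; apply: FO_imp; first exact: (FOlt' 1 0).
    apply: FO_ex; apply: FO_and; first exact: FO_P.
    by apply: FO_and; [exact: (FOlt' 2 0)|exact: (FOlt' 0 1)].
  move=> x y /(up F (fun=> base_denseP) (fun=> kd))[p [? []]].
  by exists p.
- have F : FO true (fun (s : Str ar) v => exists x y : s, slt ltf x y).
    by do 2!apply: FO_ex; exact: (FOlt 1 0).
  apply: (up F _ (fun=> kd)) => _; exists (e : S), (one : S).
  exact: base_one.
- have F : FO true (fun (s : Str ar) v => forall c x y : s, slt ltf x y -> exists x' y', slt ltf x' y' /\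
    forall z, slt ltf x' z -> slt ltf z y' -> exists w, sop opf c z w /\ (slt ltf x w /\ slt ltf w y)).
    do 3!apply: FO_all; apply: FO_imp; first exact: (FOlt 1 0).
    do 2!apply: FO_ex; apply: FO_and; first exact: (FOlt 1 0).
    apply: FO_all; apply: FO_imp; first exact: (FOlt 2 0).
    apply: FO_imp; first exact: (FOlt 0 1).
    apply: FO_ex; apply: FO_and; first exact: (FOop 6 1 0).
    by apply: FO_and; [exact: (FOlt 5 0)|exact: (FOlt 0 4)].
  move=> c x y xy; have [|x' [y' [xy' H]]] := up F _ (fun=> kd) c x y xy; last first.
    exists x', y'; split=> // z xz zy; have [w [? []]] := H z xz zy.
    by exists w.
  move=> _ {c x y xy} c x y xy; exists (op (inv c) x), (op (inv c) y).
  split=> [|z xz zy]; first exact: base_opl.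
  have H t : op c (op (inv c) t) = t.
    by rewrite -base_opA (proj2 (base_opV c)) (proj1 (base_op1 t)).
  exists (op c z); split; first exact/base_op.
  by split; [rewrite -(H x)|rewrite -(H y)]; apply: base_opl.
- have F : FO true (fun (s : Str ar) v => forall x y z z' : s, sop opf x y z -> sop opf x y z' -> z = z').
    do 4!apply: FO_all; apply: FO_imp; first exact: (FOop 3 2 1).
    by apply: FO_imp; [exact: (FOop 3 2 0)|exact: (FO_eq ar true 1 0)].
  by apply: (up F _ (fun=> kd)) => _ x y z z' /base_op<- /base_op<-.
- have F : FO true (fun (s : Str ar) v => forall x y y' z : s, sop opf x y z -> sop opf x y' z -> y = y').
    do 4!apply: FO_all; apply: FO_imp; first exact: (FOop 3 2 0).
    by apply: FO_imp; [exact: (FOop 3 1 0)|exact: (FO_eq ar true 2 1)].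
  apply: (up F _ (fun=> kd)) => _ x y y' z /base_op<- /base_op E.
  rewrite -(proj1 (base_op1 y)) -(proj1 (base_opV x)) base_opA -E.
  by rewrite -base_opA (proj1 (base_opV x)) (proj1 (base_op1 y')).
- have F : FO true (fun (s : Str ar) v => forall x x' y z : s, sop opf x y z -> sop opf x' y z -> x = x').
    do 4!apply: FO_all; apply: FO_imp; first exact: (FOop 3 1 0).
    by apply: FO_imp; [exact: (FOop 2 1 0)|exact: (FO_eq ar true 3 2)].
  apply: (up F _ (fun=> kd)) => _ x x' y z /base_op<- /base_op E.
  rewrite -(proj2 (base_op1 x)) -(proj2 (base_opV y)) -base_opA -E.
  by rewrite base_opA (proj2 (base_opV y)) (proj2 (base_op1 x')).
- move=> D Y X [g Lg HY] [f Lf HX] sY sX; pose d := size D.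
  have F : FO true (fun s v => small ltf (fun c => holds (V1 d v c) g) ->
      (forall c, holds (V1 d v c) g -> small ltf (fun y => holds (V2 d v c y) f)) ->
      small ltf (fun y => exists c, holds (V1 d v c) g /\ holds (V2 d v c y) f)).
    apply: FO_imp; first by apply: FO_small => //; apply: FO_V1.
    apply: FO_imp.
      apply: FO_all; apply: FO_imp; first exact: FO_V1.
      by apply: FO_small => //; apply: FO_V2'.
    apply: FO_small => //; apply: FO_ex; apply: FO_and; last exact: FO_V2.
    by apply: (@FO_subst _ _ _ _ (fun k => if k is j.+1 then j.+2 else 0)
      (fun s u k => if k is j.+1 then u j.+2 else u 0) _ (FO_V1 d Lg)) => s u [].
  have EY y : Y y <-> holds (V1 d (pre D (fun=> kd)) y) g by rewrite V1_pre (HY (fun=> y)).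
  have EX c y : X c y <-> holds (V2 d (pre D (fun=> kd)) c y) f.
    by rewrite V2_pre (HX (scons c (fun=> y))).
  have := up F _ (pre D (fun=> kd)).
  have -> : (fun c => holds (V1 d (pre D (fun=> kd)) c) g) = Y.
    by apply/funext => y; apply/propext; rewrite EY.
  have -> : (fun y => exists c, holds (V1 d (pre D (fun=> kd)) c) g /\
      holds (V2 d (pre D (fun=> kd)) c y) f) = (fun y => exists c, Y c /\ X c y).
    by apply/funext => y; apply/propext; split=> -[c [/EY ? /EX ?]]; exists c.
  apply=> //.
    move=> v; apply: base_small_bigcup.
      by apply: (@defL_FO _ _ S _ _ v (FO_V1 d Lg)) => y.
    move=> c; apply: (@defL_FO _ _ S _ _ (scons c v) (FO_V2' d Lf)) => y.
    by [].
  move=> c /EY/sX; have -> // : (fun y => holds (V2 d (pre D (fun=> kd)) c y) f) = X c.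
  by apply/funext => y; apply/propext; rewrite EX.
- move=> D R [f Lf HR] sR; pose d := size D.
  have F : FO true (fun s v => (forall x, small ltf (fun y => holds (V2 d v x y) f)) ->
      small ltf (fun y => ~ small ltf (fun x => holds (V2 d v x y) f))).
    apply: FO_imp; first by apply: FO_all; apply: FO_small => //; apply: FO_V2'.
    by apply: FO_small => //; apply: FO_not; apply: FO_small => //; apply: FO_V2.
  have ER x y : R x y <-> holds (V2 d (pre D (fun=> kd)) x y) f.
    by rewrite V2_pre (HR (scons x (fun=> y))).
  have := up F _ (pre D (fun=> kd)).
  have -> : (fun y => ~ small ltf (fun x => holds (V2 d (pre D (fun=> kd)) x y) f)) =
      (fun y => ~ small ltf (fun x => R x y)).
    apply/funext => y; congr (~ small _ _); apply/funext => x; apply/propext.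
    by rewrite ER.
  apply; last first.
    move=> x; have -> // : (fun y => holds (V2 d (pre D (fun=> kd)) x y) f) = R x.
    by apply/funext => y; apply/propext; rewrite ER.
  move=> v; pose rr k := if k < d then k.+2 else if k == d then 0 else 1.
  have E x y : holds (V2 d v x y) f <-> holds (scons x (scons y v)) (ren rr f).
    rewrite holds_ren; suff -> : V2 d v x y = (fun k => scons x (scons y v) (rr k)) by [].
    by apply/funext => k; rewrite /V2 /rr; case: ifP => // _; case: ifP.
  have -> : (fun y => ~ small ltf (fun x => holds (V2 d v x y) f)) =
      (fun y => ~ small ltf (fun x => holds (scons x (scons y v)) (ren rr f))).
    apply/funext => y; congr (~ small _ _); apply/funext => x; apply/propext.
    exact: E.
  move=> H; apply: base_small_swap; first by rewrite isL_ren.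
  move=> x; have := H x.
  by have -> : (fun y => holds (V2 d v x y) f) = (fun y => holds (scons x (scons y v)) (ren rr f))
    by apply/funext => y; apply/propext.
- move=> D p X DP Pp pD [f Lf HX] sX; pose d := size D.
  have F : FO false (fun (s : Str ar) v => forall q : s, sP q -> (forall k : 'I_d, sP (v k) /\ v k <> q) ->
      small ltf (fun y => holds (V1 d v y) f) -> ~ holds (V1 d v q) f).
    apply: FO_all; apply: FO_imp; first exact: FO_P.
    apply: FO_imp.
      apply: FO_all_fin => k; apply: FO_and; first exact: FO_P.
      exact: FO_not (FO_eq _ _ _ _).
    apply: FO_imp; last by apply: FO_not; apply: FO_V1.
    apply: FO_small => //.
    by apply: (@FO_subst _ _ _ _ (fun k => if k is j.+1 then j.+2 else 0)
      (fun s u k => if k is j.+1 then u j.+2 else u 0) _ (@FO_V1 _ _ false d f isT)) => s u [].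
  have EX y : X y <-> holds (V1 d (pre D (fun=> kd)) y) f by rewrite V1_pre (HX (fun=> y)).
  move=> /EX; apply: (up F _ (pre D (fun=> kd))) => //; last 2 first.
  - move=> k; rewrite (pre_lt kd) //; split; first by apply: DP; rewrite mem_nth.
    by move=> E; move: pD; rewrite -E mem_nth.
  - by apply: small_subset sX => y /EX.
  move=> v q Pq Hv sv hq.
  have [|l Hl] := @base_small_fin (fun y => holds (V1 d v y) f) _ sv.
    by apply: (@defL_FO _ _ S _ _ v (FO_V1 d Lf)) => y.
  apply: (Hind Pq); apply: (@base_fin_dcl d v l (fun s w y => holds (V1 d w y) f)) => //.
  - exact: FO_V1.
  - move=> w y Hw; suff -> : V1 d w y = V1 d v y by [].
    by apply/funext => k; rewrite /V1; case: ifP => // /Hw.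
  - by move=> k kd'; apply: (Hv (Ordinal kd')).
- by move=> Sg fx v H; exact: (saturation Uoo code_inj H).
Qed.

End Power.
End BaseModel.

(** * Transfer to the base model *)

Section Coding.
Variables (I : countType) (ar : I -> nat).

Fixpoint fcode (f : formula (ar_P ar)) : nat :=
  CodeSeq.code (match f with
  | FRel o vs => [:: 0, pickle o & vs]
  | FEq a b => [:: 1; a; b]
  | FNot g => [:: 2; fcode g]
  | FAnd g h => [:: 3; fcode g; fcode h]
  | FEx x g => [:: 4; x; fcode g]
  end).

Lemma fcode_inj : injective fcode.
Proof.
have cI := can_inj CodeSeq.codeK.
elim=> [o vs|a b|f IH|f IHf g IHg|x f IH] [o' vs'|a' b'|f'|f' g'|x' f'];
  rewrite /fcode -/fcode => /cI //.
- case=> /(pcan_inj pickleK) oo; case: o' / oo vs' => vs' E.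
  by congr FRel; apply: val_inj.
- by case=> -> ->.
- by case=> /IH->.
- by case=> /IHf-> /IHg->.
- by case=> -> /IH->.
Qed.

End Coding.

Section Atoms.
Variables (I : Type) (ar : I -> nat).
Local Notation fm := (formula (ar_P ar)).

(* The parameters of the i-th of five formulas sit at the positions 5 k + i. *)
Definition At (s : Str ar) (f : fm) (d i : nat) (v : nat -> s) (x : seq s) : Prop :=
  holds (fun k => if k < d then v (5 * k + i) else nth (v 0) x (k - d)) f.

Lemma At_ext (s : Str ar) f d i (v v' : nat -> s) x :
  (forall k, v (5 * k + i) = v' (5 * k + i)) -> v 0 = v' 0 -> At f d i v x <-> At f d i v' x.
Proof.
move=> E E0; rewrite /At E0.
suff -> : (fun k => if k < d then v (5 * k + i) else nth (v' 0) x (k - d)) =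
  (fun k => if k < d then v' (5 * k + i) else nth (v' 0) x (k - d)) by [].
by apply/funext => k; case: ifP => // _.
Qed.

Lemma FO_At b f d i (iota_ : nat -> nat) (js : seq nat) : b ==> isL f ->
  FO b (fun (s : Str ar) u => At f d i (fun k => u (iota_ k)) (map u js)).
Proof.
move=> Lf; apply: (@FO_holds _ _ _ _
  (fun k => if k < d then iota_ (5 * k + i) else nth (iota_ 0) js (k - d))) => // s u k.
case: ifP => // _; case: (ltnP (k - d) (size js)) => kj; first by rewrite (nth_map (iota_ 0)).
by rewrite !nth_default ?size_map.
Qed.

Lemma tval_tk (T : Type) n (u : nat -> T) (tau : nat -> nat) :
  tval (tk n (fun k => u (tau k))) = map u (map tau (iota 0 n)).
Proof.
rewrite /tk /= -map_comp -val_enum_ord -[in RHS]map_comp.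
by rewrite enumT.
Qed.

Lemma FO_At1 b f d i (io t1 : nat -> nat) n : b ==> isL f ->
  FO b (fun (s : Str ar) u => At f d i (fun k => u (io k)) (tk n (fun k => u (t1 k)))).
Proof.
move=> /(FO_At d i io (map t1 (iota 0 n))); apply: FO_ext => s u.
by rewrite tval_tk.
Qed.

Lemma FO_At2 b f d i (io t1 t2 : nat -> nat) n m : b ==> isL f ->
  FO b (fun (s : Str ar) u => At f d i (fun k => u (io k))
    (tk n (fun k => u (t1 k)) ++ tk m (fun k => u (t2 k)))).
Proof.
move=> /(FO_At d i io (map t1 (iota 0 n) ++ map t2 (iota 0 m))); apply: FO_ext => s u.
by rewrite !tval_tk map_cat.
Qed.

Lemma FO_At3 b f d i (io t1 t2 t3 : nat -> nat) n : b ==> isL f ->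
  FO b (fun (s : Str ar) u => At f d i (fun k => u (io k))
    (tk n (fun k => u (t1 k)) ++ tk n (fun k => u (t2 k)) ++ tk n (fun k => u (t3 k)))).
Proof.
move=> /(FO_At d i io (map t1 (iota 0 n) ++ map t2 (iota 0 n) ++ map t3 (iota 0 n))).
by apply: FO_ext => s u; rewrite !tval_tk !map_cat.
Qed.

Lemma FO_eqT b (t1 t2 : nat -> nat) n :
  FO b (fun (s : Str ar) u => tk n (fun k => u (t1 k)) = tk n (fun k => u (t2 k))).
Proof.
have H : FO b (fun (s : Str ar) u => forall i : 'I_n, u (t1 i) = u (t2 i)).
  by apply: FO_all_fin => i; apply: FO_eq.
apply: FO_ext H => s u; split=> [H|E i]; first by apply: eq_from_tnth => i; rewrite !tnth_tk.
by have := congr1 (fun t => tnth t i) E; rewrite !tnth_tk.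
Qed.

Lemma FO_iso_spec n m (fG fM fH fN ff : fm) (dG dM dH dN df : nat) :
  FO false (fun (s : Str ar) v => iso_spec (fun g : n.-tuple s => At fG dG 0 v g)
    (fun x y z => At fM dM 1 v (x ++ y ++ z)) (fun t : m.-tuple s => At fH dH 2 v t)
    (fun x y z => At fN dN 3 v (x ++ y ++ z)) (fun g t => At ff df 4 v (g ++ t))).
Proof.
apply: FO_and.
  do 2!apply: FO_allT; apply: FO_imp; first exact: FO_At2.
  by apply: FO_and; apply: FO_At1.
apply: FO_and.
  apply: FO_allT; apply: FO_imp; first exact: FO_At1.
  by apply: FO_exT; apply: FO_At2.
apply: FO_and.
  do 3!apply: FO_allT; do 2!(apply: FO_imp; first exact: FO_At2).
  exact: FO_eqT.
apply: FO_and.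
  do 3!apply: FO_allT; do 2!(apply: FO_imp; first exact: FO_At2).
  exact: FO_eqT.
apply: FO_and.
  apply: FO_allT; apply: FO_imp; first exact: FO_At1.
  by apply: FO_exT; apply: FO_At2.
apply: FO_and.
  do 3!apply: FO_allT; apply: FO_imp; first exact: FO_At3.
  by apply: FO_and; [|apply: FO_and]; apply: FO_At1.
do 6!apply: FO_allT; apply: FO_imp; first exact: FO_At3.
do 2!(apply: FO_imp; first exact: FO_At2).
by apply: FO_iff; [apply: FO_At3|apply: FO_At2].
Qed.

Definition group_spec (T : Type) n (G : n.-tuple T -> Prop)
  (M : n.-tuple T -> n.-tuple T -> n.-tuple T -> Prop) : Prop :=
  (forall x y, G x -> G y -> exists z, M x y z) /\
  ((forall x y z, M x y z -> G x /\ (G y /\ G z)) /\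
  ((forall x y z z', M x y z -> M x y z' -> z = z') /\
  ((forall x y z a b c, M x y a -> M a z b -> M y z c -> M x c b) /\
  (exists e, G e /\ forall x, G x -> M e x x /\ (M x e x /\
     exists y, G y /\ (M y x e /\ M x y e)))))).

Lemma FO_group_spec n (fG fM : fm) (dG dM : nat) :
  FO false (fun (s : Str ar) v => group_spec (fun g : n.-tuple s => At fG dG 0 v g)
    (fun x y z => At fM dM 1 v (x ++ y ++ z))).
Proof.
apply: FO_and.
  do 2!apply: FO_allT; do 2!(apply: FO_imp; first exact: FO_At1).
  by apply: FO_exT; apply: FO_At3.
apply: FO_and.
  do 3!apply: FO_allT; apply: FO_imp; first exact: FO_At3.
  by apply: FO_and; [|apply: FO_and]; apply: FO_At1.
apply: FO_and.
  do 4!apply: FO_allT; do 2!(apply: FO_imp; first exact: FO_At3).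
  exact: FO_eqT.
apply: FO_and.
  do 6!apply: FO_allT; do 3!(apply: FO_imp; first exact: FO_At3).
  exact: FO_At3.
apply: FO_exT; apply: FO_and; first exact: FO_At1.
apply: FO_allT; apply: FO_imp; first exact: FO_At1.
apply: FO_and; first exact: FO_At3.
apply: FO_and; first exact: FO_At3.
apply: FO_exT; apply: FO_and; first exact: FO_At1.
by apply: FO_and; apply: FO_At3.
Qed.

End Atoms.

Lemma group_of_spec (T : Type) n (G : n.-tuple T -> Prop) M : group_spec G M ->
  exists2 mul, is_group_on G mul & forall x y z, M x y z <-> G x /\ (G y /\ mul x y = z).
Proof.
move=> [ex [dom [fn [assoc [e [Ge He]]]]]].
have /choice[mul0 Hmul0] : forall p : n.-tuple T * n.-tuple T, exists z, G p.1 -> G p.2 -> M p.1 p.2 z.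
  move=> p; case: (pselect (G p.1 /\ G p.2)) => [[G1 G2]|nG].
    by have [z Hz] := ex _ _ G1 G2; exists z.
  by exists p.1 => G1 G2; case: nG.
pose mul x y := mul0 (x, y).
have Hm x y : G x -> G y -> M x y (mul x y) := Hmul0 (x, y).
have HM x y z : M x y z <-> G x /\ (G y /\ mul x y = z).
  split=> [Mz|[Gx [Gy <-]]]; last exact: Hm.
  have [Gx [Gy _]] := dom _ _ _ Mz; split=> //; split=> //.
  exact: fn (Hm _ _ Gx Gy) Mz.
have /choice[inv Hinv] : forall x, exists y, G x -> G y /\ (M y x e /\ M x y e).
  move=> x; case: (pselect (G x)) => [Gx|nG]; last by exists x.
  by have [_ [_ [y Hy]]] := He x Gx; exists y.
have Gm x y : G x -> G y -> G (mul x y).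
  by move=> Gx Gy; have [_ [_ ]] := dom _ _ _ (Hm _ _ Gx Gy).
exists mul => //; exists e, inv; split=> //; split=> //.
split; first by move=> x Gx; have [] := Hinv x Gx.
split.
  move=> x y z Gx Gy Gz.
  have := assoc _ _ _ _ _ _ (Hm x y Gx Gy) (Hm _ z (Gm _ _ Gx Gy) Gz) (Hm y z Gy Gz).
  by move=> /HM[_ [_ E]].
split=> x Gx; first by have [/HM[_ [_ E1]] [/HM[_ [_ E2]] _]] := He x Gx.
by have [_ [/HM[_ [_ V1]] /HM[_ [_ V2]]]] := Hinv x Gx.
Qed.

Lemma spec_of_group (T : Type) n (G : n.-tuple T -> Prop) mul : is_group_on G mul ->
  group_spec G (fun x y z => G x /\ (G y /\ mul x y = z)).
Proof.
move=> [e [inv [Ge [Gm [Gi [A [m1 mV]]]]]]].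
split; first by move=> x y Gx Gy; exists (mul x y).
split; first by move=> x y z [Gx [Gy <-]]; split=> //; split=> //; apply: Gm.
split; first by move=> x y z z' [_ [_ <-]] [_ [_ <-]].
split.
  move=> x y z a b c [Gx [Gy <-]] [_ [Gz <-]] [_ [_ <-]]; split=> //; split; first exact: Gm.
  by rewrite A.
exists e; split=> // x Gx; have [E1 E2] := m1 x Gx; have [V1_ V2_] := mV x Gx.
have Gix := Gi x Gx; do 2!(split; first by []).
by exists (inv x).
Qed.

(** The group axioms of H are not part of [iso_spec]; they are carried over from G along the
    bijection. *)
Lemma iso_group (T : Type) n m (G : n.-tuple T -> Prop) mul (H : m.-tuple T -> Prop) N fr (x0 : T) :
  is_group_on G mul -> iso_spec G (fun x y z => G x /\ (G y /\ mul x y = z)) H N fr ->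
  exists mulH f, [/\ is_group_on H mulH,
    forall t t' t'', N t t' t'' <-> H t /\ (H t' /\ mulH t t' = t''),
    forall g t, fr g t <-> G g /\ f g = t &
    [/\ forall x, G x -> H (f x), forall x y, G x -> G y -> f x = f y -> x = y,
      forall z, H z -> exists x, G x /\ f x = z &
      forall x y, G x -> G y -> f (mul x y) = mulH (f x) (f y)]].
Proof.
move=> [e [inv [Ge [Gm [Gi [A [m1 mV]]]]]]] [dom [ex [fn [inj [sur [domN HN]]]]]].
have /choice[f Hf] : forall g, exists t, G g -> fr g t.
  move=> g; case: (pselect (G g)) => [/ex[t Ht]|nG]; first by exists t.
  by exists [tuple x0 | i < m].
have frE g t : fr g t <-> G g /\ f g = t.
  split=> [Fg|[Gg <-]]; last exact: Hf.
  by have [Gg _] := dom _ _ Fg; split=> //; apply: fn (Hf _ Gg) Fg.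
have surf t : H t -> exists2 g, G g & f g = t by move=> /sur[g /frE[]]; exists g.
have NE g h t'' : G g -> G h -> N (f g) (f h) t'' <-> f (mul g h) = t''.
  move=> Gg Gh; rewrite (HN g h (mul g h)); [|by split|exact: Hf|exact: Hf].
  by rewrite frE; split=> [[]|] //; split=> //; apply: Gm.
have /choice[mulp Hmulp] : forall p : m.-tuple T * m.-tuple T, exists t'', H p.1 -> H p.2 -> N p.1 p.2 t''.
  move=> [t t'] /=; case: (pselect (H t /\ H t')) => [[/surf[g Gg <-] /surf[h Gh <-]]|nH].
    by exists (f (mul g h)) => _ _; apply/NE.
  by exists t => Ht Ht'; case: nH.
pose mulH t t' := mulp (t, t').
have fH g : G g -> H (f g) by move=> /Hf/dom[].
have mE g h : G g -> G h -> mulH (f g) (f h) = f (mul g h).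
  move=> Gg Gh; apply/esym/NE => //; exact: (Hmulp (f g, f h) (fH _ Gg) (fH _ Gh)).
have /choice[fi Hfi] : forall t, exists g, H t -> G g /\ f g = t.
  by move=> t; case: (pselect (H t)) => [/surf[g Gg E]|nH]; [exists g|exists e].
exists mulH, f; split=> //.
- exists (f e), (fun t => f (inv (fi t))); split; first exact: fH.
  split; first by move=> _ _ /surf[g Gg <-] /surf[h Gh <-]; rewrite mE //; apply/fH/Gm.
  split; first by move=> t /Hfi[G1 _]; apply/fH/Gi.
  split.
    move=> _ _ _ /surf[g Gg <-] /surf[h Gh <-] /surf[k Gk <-].
    by rewrite !mE ?A //; apply: Gm.
  split=> [_ /surf[g Gg <-]|t Ht]; first by rewrite !mE // (proj1 (m1 _ Gg)) (proj2 (m1 _ Gg)).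
  have [G1 E1] := Hfi t Ht; have Gi1 := Gi _ G1.
  by rewrite -{2 3}E1 !mE // (proj1 (mV _ G1)) (proj2 (mV _ G1)).
- move=> t t' t''; split=> [Nt|[/surf[g Gg <-] [/surf[h Gh <-] <-]]]; last by apply/NE => //; rewrite mE.
  have [Ht [Ht' _]] := domN _ _ _ Nt; split=> //; split=> //.
  move: Nt; have [g Gg <-] := surf _ Ht; have [h Gh <-] := surf _ Ht'.
  by move=> /NE<- //; rewrite mE.
- split=> //.
  + by move=> x y Gx Gy E; apply: (inj _ _ (f x)); apply/frE.
  + by move=> z /surf[g Gg E]; exists g.
  + by move=> x y Gx Gy; rewrite mE.
Qed.

Lemma definable_ext (M I : Type) (ar : I -> nat) (rel : forall i : I, (ar i).-tuple M -> Prop) N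
  (X Y : N.-tuple M -> Prop) : (forall x, X x <-> Y x) -> definable rel X -> definable rel Y.
Proof. by move=> E [f [w H]]; exists f, w => x; rewrite -E. Qed.

Lemma cat_tuple_inj (T : Type) n m (x x' : n.-tuple T) (y y' : m.-tuple T) :
  cat_tuple x y = cat_tuple x' y' -> x = x' /\ y = y'.
Proof.
move=> /(congr1 val) /= E; have E1 := congr1 (take n) E; have E2 := congr1 (drop n) E.
by split; apply: val_inj; move: E1 E2; rewrite !take_size_cat ?drop_size_cat ?size_tuple.
Qed.

Lemma cat_tupleP (T : Type) n m (t : (n + m).-tuple T) : exists x y, t = cat_tuple x y.
Proof.
have s1 : size (take n t) == n by rewrite size_takel // size_tuple leq_addr.
have s2 : size (drop n t) == m by rewrite size_drop size_tuple addKn.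
by exists (Tuple s1), (Tuple s2); apply: val_inj; rewrite /= cat_take_drop.
Qed.

Lemma tk_nth (T : Type) (a : T) m (x : m.-tuple T) (u : nat -> T) :
  (forall k, k < m -> u k = nth a x k) -> tk m u = x.
Proof. by move=> E; apply: eq_from_tnth => i; rewrite tnth_tk E // (tnth_nth a). Qed.

Section Params.
Variables (I : Type) (ar : I -> nat).

Section Base.
Variables (M : Type) (rel : forall i : I, (ar i).-tuple M -> Prop) (P : M -> Prop).
Local Notation S := (base rel P).

Lemma definable_At N (X : N.-tuple M -> Prop) : definable (rel_P rel P) X ->
  exists f d (q : nat -> M), forall (v : nat -> S) i, (forall k, k < d -> v (5 * k + i) = q k) ->
  forall x, X x <-> @At _ _ S f d i v (tval x).
Proof.
move=> [f [w Hf]]; pose r k := if k < N then vmax f + k else k - N.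
exists (ren r f), (vmax f), (fun k => w (N + k)) => v i Hv x.
rewrite Hf /At holds_ren; apply: (@holds_ext _ _ S) => k kf; rewrite /extend /r.
case: (ltnP k N) => kN; first by rewrite ltnNge leq_addr /= addKn; apply: set_nth_default; rewrite size_tuple.
rewrite nth_default ?size_tuple // ltn_subLR //.
by rewrite ltn_addl // Hv ?subnKC // ltn_subLR // ltn_addl.
Qed.

Lemma At_definable N f d i (v : nat -> S) :
  definable (rel_P rel P) (fun x : N.-tuple M => @At _ _ S f d i v (tval x)) /\
  (isL f -> definable rel (fun x : N.-tuple M => @At _ _ S f d i v (tval x))).
Proof.
pose r k := if k < d then N + k else if k - d < N then k - d else N + d.
pose w k := if k - N < d then v (5 * (k - N) + i) else v 0.
have H (x : N.-tuple M) : @At _ _ S f d i v x <-> @holds _ _ S (extend x w) (ren r f).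
  rewrite /At holds_ren; apply: (@holds_ext _ _ S) => k _; rewrite /extend /r /w.
  case: (ltnP k d) => kd.
    by rewrite nth_default ?size_tuple ?leq_addr // addKn kd.
  case: (ltnP (k - d) N) => kN; first by apply: set_nth_default; rewrite size_tuple.
  by rewrite !nth_default ?size_tuple ?leq_addr // addKn ltnn.
split=> [|Lf]; first by exists (ren r f), w.
have [g gf] : exists g, emb g = ren r f by apply: emb_surj; rewrite isL_ren.
by exists g, w => x; rewrite H -gf /holds sat_emb.
Qed.

End Base.

Variable K : Str ar.

Lemma Def_At (kd : K) b (X : (nat -> K) -> Prop) : Def b X ->
  exists f d (q : nat -> K), b ==> isL f /\ forall v i, (forall k, k < d -> v (5 * k + i) = q k) ->
  forall x, X (nth (v 0) x) <-> At f d i v x.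
Proof.
move=> [D [f Lf H]]; exists f, (size D), (nth kd D); split=> // v i Hv x.
rewrite H /At; apply: holds_ext => k _; case: ltnP => kD; first by rewrite (pre_lt kd) // Hv.
by rewrite pre_ge.
Qed.

Lemma At_Def f d i (v : nat -> K) (js : seq nat) :
  Def false (fun u => At f d i v (map u js)).
Proof.
pose D := rcons [seq v (5 * k + i) | k <- iota 0 d] (v 0).
have sD : size D = d.+1 by rewrite size_rcons size_map size_iota.
pose r k := if k < d then k else nth d [seq d.+1 + j | j <- js] (k - d).
exists D, (ren r f) => // u; rewrite /At holds_ren; apply: holds_ext => k _; rewrite /r.
have Dd w : pre D w d = v 0.
  by rewrite (pre_lt (v 0)) ?sD // nth_rcons size_map size_iota ltnn eqxx.
case: ltnP => kd.
  rewrite (pre_lt (v 0)) ?sD ?ltnS 1?ltnW // nth_rcons size_map size_iota kd.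
  by rewrite (nth_map 0) ?size_iota // nth_iota.
case: (ltnP (k - d) (size js)) => kj; last by rewrite !nth_default ?size_map ?Dd.
by rewrite !(nth_map 0) // -sD pre_size.
Qed.

End Params.

Section Countable.
Local Open Scope classical_set_scope.
Variables (M : Type) (I : countType) (ar : I -> nat).
Variable rel : forall i : I, (ar i).-tuple M -> Prop.
Variables (lt : M -> M -> Prop) (op : M -> M -> M) (e : M) (inv : M -> M).
Hypothesis Hog : ordered_group lt op e inv.
Hypothesis Hlt : definable0 rel (fun t : 2.-tuple M => lt (tnth t ord0) (tnth t ord_max)).
Hypothesis Hop : definable0 rel (fun t : 3.-tuple M =>
  op (tnth t ord0) (tnth t (Ordinal (isT : 1 < 3))) = tnth t ord_max).
Hypothesis Hom : o_minimal rel lt.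
Variable P : M -> Prop.
Hypotheses (Hdense : dense_in lt P) (Hind : dcl_independent rel P).
Variable one : M.
Hypothesis one_gt0 : lt e one.
Variables (n : nat) (G : n.-tuple M -> Prop) (mulG : n.-tuple M -> n.-tuple M -> n.-tuple M).
Hypothesis HG : definable_group (rel_P rel P) G mulG.
Local Notation S := (base rel P).

Lemma graph_opE (G' : n.-tuple M -> Prop) mul x y z :
  graph_op G' mul (cat_tuple x (cat_tuple y z)) <-> G' x /\ (G' y /\ mul x y = z).
Proof.
split=> [[x' [y' [Gx [Gy /cat_tuple_inj[-> /cat_tuple_inj[-> ->]]]]]] //|[Gx [Gy <-]]].
by exists x, y.
Qed.

Let rem5 i k : i < 5 -> (5 * k + i) %% 5 = i.
Proof. by move=> i5; rewrite mulnC modnMDl modn_small. Qed.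

Let quo5 i k : i < 5 -> (5 * k + i) %/ 5 = k.
Proof. by move=> i5; rewrite mulnC divnMDl // divn_small // addn0. Qed.

Lemma definable_group_iso_countable :
  exists (m : nat) (H : m.-tuple M -> Prop) (mulH : m.-tuple M -> m.-tuple M -> m.-tuple M)
         (f : n.-tuple M -> m.-tuple M),
    definable_group rel H mulH /\ definable_iso (rel_P rel P) G mulG H mulH f.
Proof.
case: Hlt => flt Hflt; case: Hop => fop Hfop.
have [U [UU Uoo]] := ultraFilterLemma eventually_filter.
pose m0 : S := e; pose K := upower m0 U.
have tK : tame (emb flt) (emb fop) K.
  exact: (@tame_upower M I ar rel lt op e inv Hog flt fop Hflt Hfop Hom P Hdense Hind one one_gt0 m0 U UU
    Uoo (@fcode I ar) (@fcode_inj I ar)).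
case: HG => defG [defM gG].
have [fG [dG [qG EG]]] := definable_At defG.
have [fM [dM [qM EM]]] := definable_At defM.
(* Slots 0 and 1 hold the parameters of G and of its multiplication. Slots 2 to 4 are placeholders
   until the group in K has been found. *)
pose v0 j : S := if j %% 5 is 0 then qG (j %/ 5) else qM (j %/ 5).
have AG (v : nat -> S) : (forall k, v (5 * k + 0) = v0 (5 * k + 0)) ->
    (fun x : n.-tuple S => At fG dG 0 v x) = G.
  move=> Hv; apply/funext => x; apply/propext; rewrite -EG // => k _.
  by rewrite Hv /v0 rem5 // quo5.
have AM (v : nat -> S) : (forall k, v (5 * k + 1) = v0 (5 * k + 1)) ->
    (fun x y z : n.-tuple S => At fM dM 1 v (x ++ y ++ z)) =
    (fun x y z : n.-tuple S => G x /\ (G y /\ mulG x y = z)).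
  move=> Hv; apply/funext => x; apply/funext => y; apply/funext => z; apply/propext.
  rewrite -graph_opE (EM v 1) // => k _.
  by rewrite Hv /v0 rem5 // quo5.
pose vK k : K := @ucls _ _ S m0 U UU (fun=> v0 k).
have spK : group_spec (fun g : n.-tuple K => At fG dG 0 vK g)
    (fun x y z => At fM dM 1 vK (x ++ y ++ z)).
  have [f _ Hf] := FO_group_spec n fG fM dG dM.
  apply/Hf/(@Los _ _ S m0 U UU f (fun k _ => v0 k)); apply: filterS filterT => j _ /=.
  by apply/Hf; rewrite AG // AM //; apply: spec_of_group.
have [mulK gK HMK] := group_of_spec spK.
pose GK := fun g : n.-tuple K => At fG dG 0 vK g.
have dGK : Def false (fun u : nat -> K => GK (tk n u)).
  have [D HD] := At_Def fG dG 0 vK (map id (iota 0 n)).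
  by exists D; apply: DefO_eqv HD => u; rewrite -tval_tk.
have dMK : Def false (blocks (GM GK mulK)).
  have [D HD] := At_Def fM dM 1 vK (map id (iota 0 n) ++ map (addn n) (iota 0 n) ++
    map (fun k => n + (n + k)) (iota 0 n)).
  exists D; apply: DefO_eqv HD => u; rewrite !map_cat -!tval_tk /blocks /GM.
  exact: HMK.
have [H [N [fr [dH dN df iso]]]] := tame_group (isL_emb flt) (isL_emb fop) tK gK dGK dMK.
have kd : K by exact: (vK 0).
have [fH [hH [qH [LH EH]]]] := Def_At kd dH.
have [fN [hN [qN [LN EN]]]] := Def_At kd dN.
have [ff [hf [qf [_ Ef]]]] := Def_At kd df.
(* A representing sequence for each parameter. Those in slots 0 and 1 are constant, so at every
   index of the ultrapower they define the original group. *)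
pose g j : nat -> S := match j %% 5 with
  | 0 | 1 => fun=> v0 j
  | 2 => urep (qH (j %/ 5)) | 3 => urep (qN (j %/ 5)) | _ => urep (qf (j %/ 5)) end.
pose vF k : K := @ucls _ _ S m0 U UU (g k).
have vF0 : vF 0 = vK 0 by [].
have isoK : iso_spec (fun x : n.-tuple K => At fG dG 0 vF x)
    (fun x y z => At fM dM 1 vF (x ++ y ++ z)) (fun t : n.+1.-tuple K => At fH hH 2 vF t)
    (fun x y z => At fN hN 3 vF (x ++ y ++ z)) (fun x t => At ff hf 4 vF (x ++ t)).
  have -> : (fun x : n.-tuple K => At fG dG 0 vF x) = GK.
    apply/funext => x; apply/propext; apply: At_ext => // k.
    by rewrite /vF /g rem5.
  have -> : (fun x y z : n.-tuple K => At fM dM 1 vF (x ++ y ++ z)) = GM GK mulK.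
    apply/funext => x; apply/funext => y; apply/funext => z; apply/propext; rewrite /GM -HMK.
    by apply: At_ext => // k; rewrite /vF /g rem5.
  have -> : (fun t : n.+1.-tuple K => At fH hH 2 vF t) = H.
    apply/funext => t; apply/propext; rewrite -EH; last first.
      by move=> k _; rewrite /vF /g rem5 // quo5 // urepK.
    by rewrite (@tk_nth _ (vF 0) _ t).
  have -> : (fun x y z : n.+1.-tuple K => At fN hN 3 vF (x ++ y ++ z)) = N.
    apply/funext => x; apply/funext => y; apply/funext => z; apply/propext; rewrite -EN; last first.
      by move=> k _; rewrite /vF /g rem5 // quo5 // urepK.
    rewrite (@tk_nth _ (vF 0) _ x); last by move=> k kn; rewrite nth_cat size_tuple kn.
    rewrite (@tk_nth _ (vF 0) _ y); last first.
      by move=> k kn; rewrite nth_cat size_tuple ltnNge leq_addr /= addKn nth_cat size_tuple kn.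
    rewrite (@tk_nth _ (vF 0) _ z) // => k kn.
    rewrite -addnA nth_cat size_tuple ltnNge leq_addr /= addKn nth_cat size_tuple.
    by rewrite ltnNge leq_addr /= addKn.
  have -> // : (fun (x : n.-tuple K) (t : n.+1.-tuple K) => At ff hf 4 vF (x ++ t)) = fr.
    apply/funext => x; apply/funext => t; apply/propext; rewrite -Ef; last first.
      by move=> k _; rewrite /vF /g rem5 // quo5 // urepK.
    rewrite (@tk_nth _ (vF 0) _ x); last by move=> k kn; rewrite nth_cat size_tuple kn.
    rewrite (@tk_nth _ (vF 0) _ t) // => k kn.
    by rewrite nth_cat size_tuple ltnNge leq_addr /= addKn.
have [v isoS] : exists2 v : nat -> S, forall k i, i < 2 -> v (5 * k + i) = v0 (5 * k + i) &
    iso_spec (fun x : n.-tuple S => At fG dG 0 v x)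
    (fun x y z => At fM dM 1 v (x ++ y ++ z)) (fun t : n.+1.-tuple S => At fH hH 2 v t)
    (fun x y z => At fN hN 3 v (x ++ y ++ z)) (fun x t => At ff hf 4 v (x ++ t)).
  have [f _ Hf] := FO_iso_spec n n.+1 fG fM fH fN ff dG dM hH hN hf.
  (* By Los's theorem the statement holds at some index j0, where the representing sequences supply
     parameters in M. *)
  move/Hf/(@Los _ _ S m0 U UU f g)/filter_ex: isoK => [j0 /= /Hf isoS].
  exists (fun k => g k j0) => // k [|[|]] // _; by rewrite /g rem5.
rewrite AG; last by move=> k; apply: isoS.
rewrite AM; last by move=> k; apply: isoS.
move=> isoR; have [mulH [f [gH NE fE [fH_ finj fsur fmul]]]] := iso_group (e : S) gG isoR.
exists n.+1, (fun t : n.+1.-tuple S => At fH hH 2 v t), mulH, f; split.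
  split; first exact: (At_definable _ _ _ _ _).2.
  split=> //; apply: definable_ext ((At_definable (n.+1 + (n.+1 + n.+1)) fN hN 3 v).2 LN) => t.
  have [x [yz ->]] := cat_tupleP t; have [y [z ->]] := cat_tupleP yz.
  rewrite NE; split=> [[Hx [Hy <-]]|]; first by exists x, y.
  by move=> [x' [y' [Gx [Gy /cat_tuple_inj[-> /cat_tuple_inj[-> ->]]]]]].
split=> //; split=> //; split=> //; split=> //.
apply: definable_ext (At_definable (n + n.+1) ff hf 4 v).1 => t.
have [x [y ->]] := cat_tupleP t; rewrite fE; split=> [[Gx <-]|]; first by exists x.
by move=> [x' [Gx /cat_tuple_inj[-> ->]]].
Qed.

End Countable.

(** * Reduction to a finite language *)

Fixpoint syms (J : Type) (a : J -> nat) (C : eqType) (sym : J -> option C) (f : formula a) : seq C :=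
  match f with
  | FRel j _ => seq_of_opt (sym j)
  | FEq _ _ => [::]
  | FNot g => syms sym g
  | FAnd g h => syms sym g ++ syms sym h
  | FEx _ g => syms sym g
  end.

Section Translation.
Variables (M J' J : Type) (a' : J' -> nat) (a : J -> nat).
Variables (R' : forall j : J', (a' j).-tuple M -> Prop) (R : forall j : J, (a j).-tuple M -> Prop).
Variable th : forall j : J', (a' j).-tuple nat -> formula a.
Hypothesis sat_th : forall v j (vs : (a' j).-tuple nat), sat R v (th vs) <-> R' (map_tuple v vs).

Fixpoint back (f : formula a') : formula a :=
  match f with
  | FRel i vs => th vs
  | FEq x y => FEq _ x y
  | FNot g => FNot (back g)
  | FAnd g h => FAnd (back g) (back h)
  | FEx x g => FEx x (back g)
  end.

Lemma sat_back v f : sat R v (back f) <-> sat R' v f.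
Proof.
elim: f v => [i vs|x y|f IH|f IHf g IHg|x f IH] v //=.
- by have := IH v; tauto.
- by have := IHf v; have := IHg v; tauto.
- by split=> -[c /IH]; exists c.
Qed.

Lemma definable_back N (X : N.-tuple M -> Prop) : definable R' X -> definable R X.
Proof. by move=> [f [w H]]; exists (back f), w => x; rewrite sat_back. Qed.

Lemma dcl_back A b : in_dcl R' A b -> in_dcl R A b.
Proof.
by move=> [f [m [x [Ax H]]]]; exists (back f), m, x; split=> // y w; rewrite sat_back.
Qed.

Variables (C : eqType) (sym : J -> option C) (l : seq C).
Hypothesis th_surj : forall j (vs : (a j).-tuple nat), (forall c, sym j = Some c -> c \in l) ->
  exists j' (vs' : (a' j').-tuple nat), th vs' = FRel vs.

Lemma back_surj f : {subset syms sym f <= l} -> exists g, back g = f.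
Proof.
elim: f => [i vs|x y|f IH|f IHf g IHg|x f IH] /= H.
- have [|j [vs' E]] := @th_surj i vs; last by exists (FRel vs').
  by move=> c E; apply: H; rewrite E inE.
- by exists (FEq _ x y).
- by have [g <-] := IH H; exists (FNot g).
- have [|f' <-] := IHf; first by move=> c cf; apply: H; rewrite mem_cat cf.
  have [|g' <-] := IHg; first by move=> c cg; apply: H; rewrite mem_cat cg orbT.
  by exists (FAnd f' g').
- by have [g <-] := IH H; exists (FEx x g).
Qed.

End Translation.

Lemma definable_trivial (M I : Type) (ar : I -> nat) (rel : forall i : I, (ar i).-tuple M -> Prop) e N
  (X : N.-tuple M -> Prop) : (forall x : M, x = e) -> definable rel X.
Proof.
move=> E; have ET (x y : N.-tuple M) : x = y.
  by apply: eq_from_tnth => i; rewrite (E (tnth x i)) (E (tnth y i)).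
case: (pselect (exists x, X x)) => [[x Xx]|nX].
  by exists (FEq _ 0 0), (fun=> e) => y; rewrite (ET y x).
by exists (FNot (FEq _ 0 0)), (fun=> e) => y; split=> [Xy|[]//]; case: nX; exists y.
Qed.

Theorem theorem1p2
  (M : Type) (I : Type) (ar : I -> nat) (rel : forall i : I, (ar i).-tuple M -> Prop)
  (lt : M -> M -> Prop) (op : M -> M -> M) (e : M) (inv : M -> M)
  (Hog : ordered_group lt op e inv)
  (Hlt : definable0 rel (fun t : 2.-tuple M => lt (tnth t ord0) (tnth t ord_max)))
  (Hop : definable0 rel (fun t : 3.-tuple M =>
           op (tnth t ord0) (tnth t (Ordinal (isT : 1 < 3))) = tnth t ord_max))
  (Hom : o_minimal rel lt)
  (P : M -> Prop) (Hdense : dense_in lt P) (Hind : dcl_independent rel P)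
  (n : nat) (G : n.-tuple M -> Prop) (mulG : n.-tuple M -> n.-tuple M -> n.-tuple M)
  (HG : definable_group (rel_P rel P) G mulG) :
  exists (m : nat) (H : m.-tuple M -> Prop) (mulH : m.-tuple M -> m.-tuple M -> m.-tuple M)
         (f : n.-tuple M -> m.-tuple M),
    definable_group rel H mulH /\ definable_iso (rel_P rel P) G mulG H mulH f.
Proof.
(* Without a positive element M is a single point and every set is definable. A positive element
   makes the order unbounded in both directions, as the general argument assumes. *)
case: (pselect (exists x, lt e x)) => [[one one_gt0]|triv]; last first.
  have E x : x = e.
    case: Hog => _ [op1 [opV [_ [_ [tot mono]]]]].
    case: (tot e x) => [ex|[//|xe]]; first by case: triv; exists x.
    case: triv; exists (inv x); have [] := mono _ _ (inv x) xe.
    by rewrite (proj1 (opV x)) (proj2 (op1 (inv x))).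
  exists n, G, mulG, id; case: HG => _ [_ gG]; split.
    by split; [|split=> //]; apply: definable_trivial E.
  do 2!split=> //; split; first by move=> z Gz; exists z.
  by split=> //; apply: definable_trivial E.
case: Hlt => flt Hflt; case: Hop => fop Hfop.
case: HG => -[fG [wG HfG]] [[fM [wM HfM]] gG].
pose C : choiceType := {classic I}.
pose s1 : I -> option C := Some; pose s2 : option I -> option C := id.
(* The symbols in the definitions of the order, the operation, G and its multiplication. A reduct
   has fewer definable sets, so it stays o-minimal and P stays independent, and what is definable in
   it is definable in the full structure. *)
pose l : seq C := (syms s1 flt ++ syms s1 fop) ++ (syms s2 fG ++ syms s2 fM).
pose ar' (j : seq_sub l) := ar (ssval j).
pose rel' (j : seq_sub l) : (ar' j).-tuple M -> Prop := @rel (ssval j).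
pose th1 j (vs : (ar' j).-tuple nat) := @FRel _ ar (ssval j) vs.
pose th2 (o : option (seq_sub l)) : (ar_P ar' o).-tuple nat -> formula (ar_P ar) :=
  match o with
  | Some j => fun vs => @FRel _ (ar_P ar) (Some (ssval j : I)) vs
  | None => fun vs => @FRel _ (ar_P ar) None vs
  end.
have sat1 v j (vs : (ar' j).-tuple nat) : sat rel v (th1 j vs) <-> rel' j (map_tuple v vs) by [].
have sat2 v o (vs : (ar_P ar' o).-tuple nat) :
    sat (rel_P rel P) v (th2 o vs) <-> rel_P rel' P (map_tuple v vs) by case: o vs.
have th1_surj j (vs : (ar j).-tuple nat) : (forall c, s1 j = Some c -> c \in l) ->
    exists j' (vs' : (ar' j').-tuple nat), th1 j' vs' = FRel vs.
  by move=> /(_ _ erefl) jl; exists (SeqSub jl), vs.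
have th2_surj o (vs : (ar_P ar o).-tuple nat) : (forall c, s2 o = Some c -> c \in l) ->
    exists j' (vs' : (ar_P ar' j').-tuple nat), th2 j' vs' = FRel vs.
  case: o vs => [j|] vs H; last by exists None, vs.
  by have jl := H _ erefl; exists (Some (SeqSub jl)), vs.
have [|flt' Elt] := @back_surj _ _ _ _ th1 _ s1 l th1_surj flt.
  by move=> c cf; rewrite !mem_cat cf.
have [|fop' Eop] := @back_surj _ _ _ _ th1 _ s1 l th1_surj fop.
  by move=> c cf; rewrite !mem_cat cf orbT.
have [|fG' EG] := @back_surj _ _ _ _ th2 _ s2 l th2_surj fG.
  by move=> c cf; rewrite !mem_cat cf !orbT.
have [|fM' EM] := @back_surj _ _ _ _ th2 _ s2 l th2_surj fM.
  by move=> c cf; rewrite !mem_cat cf !orbT.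
have [|||||m [H [mulH [f [[dH [dN gH]] [fH [finj [fsur [fmul df]]]]]]]]] :=
  @definable_group_iso_countable M _ ar' rel' lt op e inv Hog _ _ _ P Hdense _ one one_gt0 n G mulG.
- by exists flt' => x w; rewrite (Hflt x w) -Elt (sat_back sat1).
- by exists fop' => x w; rewrite (Hfop x w) -Eop (sat_back sat1).
- by move=> X /(definable_back sat1)/Hom.
- by move=> p Pp /(dcl_back sat1); apply: Hind.
- split; first by exists fG', wG => x; rewrite HfG -EG (sat_back sat2).
  by split=> //; exists fM', wM => x; rewrite HfM -EM (sat_back sat2).
exists m, H, mulH, f; split.
  by split; [|split=> //]; apply: definable_back sat1 _ _ _.
by do 4!split=> //; apply: definable_back sat2 _ _ _.
Qed.
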